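(* Let $\Omega\subset\mathbb{C}^n$ be a bounded domain with $\mathcal{C}^2$-smooth strongly convex boundary. Then for every $p\in\partial\Omega$, $\displaystyle\lim_{\Omega\ni q\to p}\sigma_\Omega(q)=1$.
   Context: For $q\in\mathbb{C}^n$ and $r>0$ let $\mathbb{B}^n(q;r)=\{z\in\mathbb{C}^n:\|z-q\|<r\}$ (Euclidean norm) and $\mathbb{B}^n=\mathbb{B}^n(0;1)$. For a complex manifold $\Omega$ of dimension $n$ and $p\in\Omega$, let $\mathcal{F}(p,\Omega)$ be the set of injective holomorphic maps $f:\Omega\to\mathbb{B}^n$ with $f(p)=0$. The squeezing function is $\sigma_\Omega(p)=\sup\{r>0:\ \mathbb{B}^n(0;r)\subset f(\Omega)\text{ for some }f\in\mathcal{F}(p,\Omega)\}$. A bounded domain has $\mathcal{C}^2$ strongly convex boundary if it has a $\mathcal{C}^2$ defining function $\rho$ ($\Omega=\{\rho<0\}$, $d\rho\ne0$ on $\partial\Omega$) whose real Hessian is positive definite on the real tangent space of $\partial\Omega$ at every boundary point. *)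

(* Defs.v *)
From Stdlib Require Import Reals Lra Arith Classical ClassicalEpsilon FunctionalExtensionality.
Open Scope R_scope.

Definition idx (n : nat) := {j : nat | (j < n)%nat}.
Definition Cn (n : nat) := idx n -> (R * R).

Definition cadd (a b : R * R) : R * R := (fst a + fst b, snd a + snd b).
Definition cmul (a b : R * R) : R * R :=
  (fst a * fst b - snd a * snd b, fst a * snd b + snd a * fst b).

Fixpoint nsum (m : nat) (f : nat -> R) : R :=
  match m with O => 0 | S k => nsum k f + f k end.

Definition isum (n : nat) (g : idx n -> R) : R :=
  nsum n (fun j => match lt_dec j n with
                   | left h => g (exist _ j h)
                   | right _ => 0 end).

Definition csum (n : nat) (g : idx n -> R * R) : R * R :=
  (isum n (fun k => fst (g k)), isum n (fun k => snd (g k))).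

Definition vzero {n : nat} : Cn n := fun _ => (0, 0).
Definition vadd {n : nat} (z w : Cn n) : Cn n :=
  fun j => (fst (z j) + fst (w j), snd (z j) + snd (w j)).
Definition vsub {n : nat} (z w : Cn n) : Cn n :=
  fun j => (fst (z j) - fst (w j), snd (z j) - snd (w j)).
Definition vscale {n : nat} (a : R) (z : Cn n) : Cn n :=
  fun j => (a * fst (z j), a * snd (z j)).

Definition vnorm {n : nat} (z : Cn n) : R :=
  sqrt (isum n (fun j => fst (z j) ^ 2 + snd (z j) ^ 2)).

Definition ball {n : nat} (q : Cn n) (r : R) (z : Cn n) : Prop :=
  vnorm (vsub z q) < r.

Definition is_open {n : nat} (U : Cn n -> Prop) : Prop :=
  forall z, U z -> exists r, 0 < r /\ forall w, ball z r w -> U w.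

Definition closure {n : nat} (A : Cn n -> Prop) (z : Cn n) : Prop :=
  forall r, 0 < r -> exists w, A w /\ ball z r w.

Definition boundary {n : nat} (A : Cn n -> Prop) (z : Cn n) : Prop :=
  closure A z /\ ~ A z.

Definition is_connected {n : nat} (A : Cn n -> Prop) : Prop :=
  forall U V : Cn n -> Prop, is_open U -> is_open V ->
    (forall z, A z -> U z \/ V z) ->
    (exists z, A z /\ U z) -> (exists z, A z /\ V z) ->
    exists z, A z /\ U z /\ V z.

Definition bounded_domain {n : nat} (Om : Cn n -> Prop) : Prop :=
  is_open Om /\ is_connected Om /\ (exists z, Om z) /\
  (exists M, forall z, Om z -> vnorm z <= M).

Definition real_linear {n : nat} (L : Cn n -> R) : Prop :=
  (forall x y, L (vadd x y) = L x + L y) /\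
  (forall a x, L (vscale a x) = a * L x).

Definition rdiff_at {n : nat} (rho : Cn n -> R) (z : Cn n) (L : Cn n -> R) : Prop :=
  real_linear L /\
  forall eps, 0 < eps -> exists delta, 0 < delta /\
    forall h, vnorm h < delta ->
      Rabs (rho (vadd z h) - rho z - L h) <= eps * vnorm h.

Definition rcont_at {n : nat} (g : Cn n -> R) (z : Cn n) : Prop :=
  forall eps, 0 < eps -> exists delta, 0 < delta /\
    forall w, ball z delta w -> Rabs (g w - g z) < eps.

Definition is_C2_on {n : nat} (U : Cn n -> Prop) (rho : Cn n -> R)
  (D : Cn n -> Cn n -> R) (D2 : Cn n -> Cn n -> Cn n -> R) : Prop :=
  (forall z, U z -> rdiff_at rho z (D z)) /\
  (forall z h, U z -> rdiff_at (fun w => D w h) z (D2 z h)) /\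
  (forall z h k, U z -> rcont_at (fun w => D2 w h k) z).

Definition C2_strongly_convex_boundary {n : nat} (Om : Cn n -> Prop) : Prop :=
  exists (U : Cn n -> Prop) (rho : Cn n -> R)
         (D : Cn n -> Cn n -> R) (D2 : Cn n -> Cn n -> Cn n -> R),
    is_open U /\ (forall z, closure Om z -> U z) /\
    is_C2_on U rho D D2 /\
    (forall z, Om z <-> (U z /\ rho z < 0)) /\
    (forall p, boundary Om p -> exists v, D p v <> 0) /\
    (forall p, boundary Om p -> forall v, v <> vzero -> D p v = 0 ->
        D2 p v v > 0).

Definition mapply {n : nat} (A : idx n -> idx n -> R * R) (h : Cn n) : Cn n :=
  fun j => csum n (fun k => cmul (A j k) (h k)).

Definition holo_at {n : nat} (f : Cn n -> Cn n) (z : Cn n) : Prop :=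
  exists A : idx n -> idx n -> R * R,
    forall eps, 0 < eps -> exists delta, 0 < delta /\
      forall h, vnorm h < delta ->
        vnorm (vsub (vsub (f (vadd z h)) (f z)) (mapply A h)) <= eps * vnorm h.

Definition holomorphic_on {n : nat} (Om : Cn n -> Prop) (f : Cn n -> Cn n) : Prop :=
  forall z, Om z -> holo_at f z.

Definition squeeze_family {n : nat} (p : Cn n) (Om : Cn n -> Prop)
  (f : Cn n -> Cn n) : Prop :=
  holomorphic_on Om f /\
  (forall z w, Om z -> Om w -> f z = f w -> z = w) /\
  (forall z, Om z -> vnorm (f z) < 1) /\
  f p = vzero.

Definition squeeze_radii {n : nat} (Om : Cn n -> Prop) (p : Cn n) (r : R) : Prop :=
  0 < r /\ exists f, squeeze_family p Om f /\
    forall w, ball vzero r w -> exists z, Om z /\ f z = w.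

(* squeezing function: the supremum of squeeze_radii (0 if no sup exists,
   which never happens for bounded domains) *)
Definition squeezing {n : nat} (Om : Cn n -> Prop) (p : Cn n) : R :=
  match excluded_middle_informative (exists s, is_lub (squeeze_radii Om p) s) with
  | left h => proj1_sig (constructive_indefinite_description _ h)
  | right _ => 0
  end.

(* Main.v *)
(* At p in the boundary write the complex Taylor expansion of the defining function as
   [- Re l + Re A + h], with [l] complex linear, [A] a complex quadratic form and [h] a positive
   definite Hermitian form (strong convexity, after adding a multiple of the squared differential
   of the defining function).  The model domain [Re (l - A) > h] is a ball in the coordinates
   (tangential part, [l - A]), by a Cayley transform that can send any prescribed point on the
   normal to the centre.  The domain is globally convex, so [Re l] controls [|v|^2] on all of
   it; to keep the map injective with [Re (l - A) > 0] far away from p, [A] is replaced by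
   [A * chi l], where [chi] is a rational cut-off that varies slowly on the logarithmic scale.
   Moving the base point to a boundary point p' with [q - p'] normal and letting [q] tend to p,
   the image lies in a ball of radius 1 + eps and contains one of radius 1 - eps; surjectivity
   onto the latter is a one-variable contraction. *)

From Stdlib Require Import Reals Lra Psatz Lia Arith Classical ClassicalEpsilon FunctionalExtensionality.
From Coquelicot Require Import Coquelicot.
Require Import Defs.
Open Scope R_scope.

(** * Norms on C^n *)

(** Globally [A] is tied to [l] only through [|A v v| <= K |v|^2 <= (K / c) Re l], with
    [K / c >= 1]: far from p the function [l - A] may vanish, or repeat values on a line parallel to
    [nu]. A factor depending on [l] alone keeps it holomorphic, and the poles of the factor may sit
    in the left half-plane, since [Re l > 0] on the domain. Injectivity along such lines asks that
    [|A| |chi w - chi w'|] be a small part of [|w - w'|]; as [|A|] is at most of the order of [|w|],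
    it is [|w chi'(w)|] that has to be small. A cut-off with a single scale makes it of order one;
    an average over many scales divides it by their number. With [W = l - A chi(l)] and centre [b],
    the squared norm of the image exceeds 1 by [4 Re b (h - Re W) / |W + conj b|^2], [h] taken at
    the tangential part. Near p the numerator is controlled by the Taylor expansion; away from p the
    denominator stays bounded below while [b] tends to 0. [A] and [h] are frozen at p and only [l]
    follows the base point, so every estimate is uniform in p'. *)

Lemma nsum_ext (m : nat) (f g : nat -> R) :
  (forall j, (j < m)%nat -> f j = g j) -> nsum m f = nsum m g.
Proof.
  induction m as [|m IH]; intros H; simpl; [reflexivity|].
  rewrite IH by (intros; apply H; lia). rewrite H by lia. reflexivity.
Qed.

Lemma nsum_plus (m : nat) (f g : nat -> R) :
  nsum m (fun j => f j + g j) = nsum m f + nsum m g.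
Proof. induction m as [|m IH]; simpl; [ring | rewrite IH; ring]. Qed.

Lemma nsum_scal (m : nat) (a : R) (f : nat -> R) :
  nsum m (fun j => a * f j) = a * nsum m f.
Proof. induction m as [|m IH]; simpl; [ring | rewrite IH; ring]. Qed.

Lemma nsum_le (m : nat) (f g : nat -> R) :
  (forall j, (j < m)%nat -> f j <= g j) -> nsum m f <= nsum m g.
Proof.
  induction m as [|m IH]; intros H; simpl; [lra|].
  apply Rplus_le_compat; [apply IH; intros; apply H|apply H]; lia.
Qed.

Lemma nsum_const (m : nat) (a : R) : nsum m (fun _ => a) = INR m * a.
Proof. induction m as [|m IH]; [simpl; ring | rewrite S_INR; simpl; rewrite IH; ring]. Qed.

Lemma nsum_nonneg (m : nat) (f : nat -> R) :
  (forall j, (j < m)%nat -> 0 <= f j) -> 0 <= nsum m f.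
Proof.
  intros H. apply Rle_trans with (nsum m (fun _ => 0)).
  - rewrite nsum_const; lra.
  - now apply nsum_le.
Qed.

Lemma nsum_ge_term (m : nat) (f : nat -> R) (k : nat) :
  (forall j, (j < m)%nat -> 0 <= f j) -> (k < m)%nat -> f k <= nsum m f.
Proof.
  induction m as [|m IH]; intros H Hk; [lia|]; simpl.
  destruct (Nat.eq_dec k m) as [->|Hne].
  - assert (0 <= nsum m f) by (apply nsum_nonneg; intros; apply H; lia). lra.
  - assert (f k <= nsum m f) by (apply IH; [intros; apply H; lia | lia]).
    assert (0 <= f m) by (apply H; lia). lra.
Qed.

Lemma isum_ext (n : nat) (f g : idx n -> R) :
  (forall j, f j = g j) -> isum n f = isum n g.
Proof.
  intros H. apply nsum_ext. intros j _. destruct (lt_dec j n); [apply H|reflexivity].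
Qed.

Lemma isum_plus (n : nat) (f g : idx n -> R) :
  isum n (fun j => f j + g j) = isum n f + isum n g.
Proof.
  unfold isum. rewrite <- nsum_plus. apply nsum_ext. intros j _.
  destruct (lt_dec j n); ring.
Qed.

Lemma isum_scal (n : nat) (a : R) (f : idx n -> R) :
  isum n (fun j => a * f j) = a * isum n f.
Proof.
  unfold isum. rewrite <- nsum_scal. apply nsum_ext. intros j _.
  destruct (lt_dec j n); ring.
Qed.

Lemma isum_le (n : nat) (f g : idx n -> R) :
  (forall j, f j <= g j) -> isum n f <= isum n g.
Proof.
  intros H. apply nsum_le. intros j _. destruct (lt_dec j n); [apply H|lra].
Qed.

Lemma isum_nonneg (n : nat) (f : idx n -> R) :
  (forall j, 0 <= f j) -> 0 <= isum n f.
Proof.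
  intros H. apply nsum_nonneg. intros j _. destruct (lt_dec j n); [apply H|lra].
Qed.

Lemma isum_ge_term (n : nat) (f : idx n -> R) (k : idx n) :
  (forall j, 0 <= f j) -> f k <= isum n f.
Proof.
  intros H. destruct k as [k Hk]. unfold isum.
  pose (g := fun j => match lt_dec j n with
                      | left h => f (exist _ j h) | right _ => 0 end).
  assert (E : g k = f (exist _ k Hk)).
  { unfold g. destruct (lt_dec k n) as [h|h]; [|contradiction].
    now rewrite (le_unique _ _ h Hk). }
  rewrite <- E. apply nsum_ge_term; [|exact Hk].
  intros j _. unfold g. destruct (lt_dec j n); [apply H|lra].
Qed.

Lemma isum_const (n : nat) (a : R) : isum n (fun _ => a) = INR n * a.
Proof.
  rewrite <- nsum_const. apply nsum_ext. intros j Hj.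
  destruct (lt_dec j n); [reflexivity|contradiction].
Qed.

Ltac mono_l := apply Rmult_le_compat_l; lra.
Ltac mono_r := apply Rmult_le_compat_r; lra.
Ltac div_pos := apply Rdiv_lt_0_compat; lra.

Definition cscale {n : nat} (c : C) (v : Cn n) : Cn n := fun j => Cmult c (v j).

Ltac fext j := apply functional_extensionality; intros j.
Ltac cpair := apply injective_projections; simpl; ring.

Ltac vec := apply functional_extensionality; intros ?j;
  unfold vadd, vsub, vscale, cscale, vzero, Cmult, Cplus, Cminus, Copp, RtoC, Ci;
  cpair.

(** The real part of the Hermitian product, that is, the Euclidean product of the underlying real
    space. *)
Definition rip {n : nat} (u v : Cn n) : R :=
  isum n (fun j => fst (u j) * fst (v j) + snd (u j) * snd (v j)).

Lemma vnorm_rip {n : nat} (v : Cn n) : vnorm v = sqrt (rip v v).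
Proof.
  unfold vnorm, rip. f_equal. apply isum_ext. intros j. ring.
Qed.

Lemma rip_nonneg {n : nat} (v : Cn n) : 0 <= rip v v.
Proof. apply isum_nonneg. intros j. nra. Qed.

Lemma vnorm_sq {n : nat} (v : Cn n) : vnorm v ^ 2 = rip v v.
Proof. rewrite vnorm_rip. apply pow2_sqrt, rip_nonneg. Qed.

Lemma vnorm_nonneg {n : nat} (v : Cn n) : 0 <= vnorm v.
Proof. rewrite vnorm_rip. apply sqrt_pos. Qed.

Lemma rip_comb {n : nat} (a b : R) (u v : Cn n) :
  rip (vadd (vscale a u) (vscale b v)) (vadd (vscale a u) (vscale b v))
  = a ^ 2 * rip u u + 2 * a * b * rip u v + b ^ 2 * rip v v.
Proof.
  unfold rip. rewrite <- !isum_scal, <- !isum_plus. apply isum_ext. intros j.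
  unfold vadd, vscale; simpl. ring.
Qed.

Lemma vcomp_le_norm {n : nat} (v : Cn n) (j : idx n) : Cmod (v j) <= vnorm v.
Proof.
  unfold Cmod, vnorm. apply sqrt_le_1_alt.
  apply (isum_ge_term n (fun j => fst (v j) ^ 2 + snd (v j) ^ 2)). intros k. nra.
Qed.

Lemma vnorm_le_comp {n : nat} (v : Cn n) (e : R) :
  0 <= e -> (forall j, Cmod (v j) <= e) -> vnorm v <= INR n * e.
Proof.
  intros He H. pose proof (pos_INR n) as Hn.
  apply Rsqr_incr_0_var; [|nra].
  unfold Rsqr. replace (vnorm v * vnorm v) with (rip v v) by (rewrite <- vnorm_sq; ring).
  apply Rle_trans with (INR n * e ^ 2).
  - rewrite <- isum_const. apply isum_le. intros j. specialize (H j).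
    pose proof (Cmod_ge_0 (v j)). pose proof (Cmod2_alt (v j)) as E.
    unfold Re, Im in E.
    assert (Cmod (v j) ^ 2 <= e ^ 2) by (apply pow_incr; lra). lra.
  - destruct n as [|n]; [simpl; lra|].
    assert (1 <= INR (S n)) by (rewrite S_INR; pose proof (pos_INR n); lra).
    assert (0 <= e ^ 2) by nra. nra.
Qed.

Lemma vnorm_zero_eq {n : nat} (v : Cn n) : vnorm v = 0 -> v = vzero.
Proof.
  intros H. fext j. apply Cmod_eq_0.
  pose proof (vcomp_le_norm v j). pose proof (Cmod_ge_0 (v j)). lra.
Qed.

Lemma vnorm_vzero {n : nat} : vnorm (@vzero n) = 0.
Proof.
  rewrite vnorm_rip. unfold rip. rewrite (isum_ext n _ (fun _ => 0)).
  - rewrite isum_const, Rmult_0_r. apply sqrt_0.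
  - intros j. simpl. ring.
Qed.

Lemma vnorm_pos {n : nat} (v : Cn n) : v <> vzero -> 0 < vnorm v.
Proof.
  intros H. pose proof (vnorm_nonneg v). destruct (Req_dec (vnorm v) 0) as [E|E].
  - elim H. now apply vnorm_zero_eq.
  - lra.
Qed.

Lemma vnorm_cscale {n : nat} (c : C) (v : Cn n) : vnorm (cscale c v) = Cmod c * vnorm v.
Proof.
  apply Rsqr_inj; [apply vnorm_nonneg|apply Rmult_le_pos; [apply Cmod_ge_0|apply vnorm_nonneg]|].
  rewrite !Rsqr_pow2, Rpow_mult_distr, !vnorm_sq, Cmod2_alt.
  unfold rip. rewrite <- isum_scal. apply isum_ext. intros j.
  unfold cscale, Cmult, Re, Im; simpl. ring.
Qed.

Lemma vscale_cscale {n : nat} (a : R) (v : Cn n) : vscale a v = cscale (RtoC a) v.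
Proof. vec. Qed.

Lemma vnorm_vscale {n : nat} (a : R) (v : Cn n) : vnorm (vscale a v) = Rabs a * vnorm v.
Proof. now rewrite vscale_cscale, vnorm_cscale, Cmod_R. Qed.

(** Cauchy-Schwarz, from the nonnegative square of [|v| u - |u| v]. *)
Lemma rip_le {n : nat} (u v : Cn n) : rip u v <= vnorm u * vnorm v.
Proof.
  pose proof (vnorm_nonneg u). pose proof (vnorm_nonneg v).
  assert (K : forall a b, 0 <= a ^ 2 * vnorm u ^ 2 + 2 * a * b * rip u v + b ^ 2 * vnorm v ^ 2).
  { intros a b. rewrite !vnorm_sq, <- rip_comb. apply rip_nonneg. }
  destruct (Req_dec (vnorm u) 0) as [E|E].
  - apply vnorm_zero_eq in E. subst u. rewrite vnorm_vzero. unfold rip.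
    rewrite (isum_ext n _ (fun _ => 0)).
    + rewrite isum_const. lra.
    + intros j. simpl. ring.
  - destruct (Req_dec (vnorm v) 0) as [E'|E'].
    + apply vnorm_zero_eq in E'. subst v. rewrite vnorm_vzero. unfold rip.
      rewrite (isum_ext n _ (fun _ => 0)).
      * rewrite isum_const. lra.
      * intros j. simpl. ring.
    + specialize (K (vnorm v) (- vnorm u)).
      assert (0 < vnorm u * vnorm v) by nra.
      assert (0 <= (vnorm u * vnorm v) * (vnorm u * vnorm v - rip u v)) by nra.
      nra.
Qed.

Lemma vnorm_triangle {n : nat} (u v : Cn n) : vnorm (vadd u v) <= vnorm u + vnorm v.
Proof.
  pose proof (vnorm_nonneg u). pose proof (vnorm_nonneg v).
  apply Rsqr_incr_0_var; [|lra]. rewrite !Rsqr_pow2.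
  replace (vadd u v) with (vadd (vscale 1 u) (vscale 1 v)) by vec.
  rewrite vnorm_sq, rip_comb. pose proof (rip_le u v).
  rewrite <- !vnorm_sq. nra.
Qed.

Lemma vnorm_sub_triangle {n : nat} (u v w : Cn n) :
  vnorm (vsub u w) <= vnorm (vsub u v) + vnorm (vsub v w).
Proof.
  replace (vsub u w) with (vadd (vsub u v) (vsub v w)) by vec. apply vnorm_triangle.
Qed.

Lemma vsub_vadd {n : nat} (p v : Cn n) : vsub (vadd p v) p = v.
Proof. vec. Qed.

Lemma vadd_vsub {n : nat} (p z : Cn n) : vadd p (vsub z p) = z.
Proof. vec. Qed.

Lemma vsub_eq_zero {n : nat} (u v : Cn n) : vsub u v = vzero -> u = v.
Proof.
  intros H. rewrite <- (vadd_vsub v u), H. vec.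
Qed.

(** * Linear and bilinear forms *)

(** Indexed by all naturals, with the zero vector from [n] on, so that inductions over coordinates
    carry no bound proofs; [co] follows the same convention. *)
Definition bas {n : nat} (k : nat) : Cn n :=
  fun j => if Nat.eqb k (proj1_sig j) then RtoC 1 else RtoC 0.

Definition co {n : nat} (v : Cn n) (k : nat) : C :=
  match lt_dec k n with left h => v (exist _ k h) | right _ => RtoC 0 end.

Definition trunc {n : nat} (m : nat) (v : Cn n) : Cn n :=
  fun j => if Nat.ltb (proj1_sig j) m then v j else RtoC 0.

Lemma co_idx {n : nat} (v : Cn n) (j : idx n) : co v (proj1_sig j) = v j.
Proof.
  destruct j as [j Hj]. unfold co; simpl. destruct (lt_dec j n) as [h|h]; [|contradiction].
  now rewrite (le_unique _ _ h Hj).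
Qed.

Lemma trunc_0 {n : nat} (v : Cn n) : trunc 0 v = vzero.
Proof. reflexivity. Qed.

Lemma trunc_all {n : nat} (v : Cn n) : trunc n v = v.
Proof.
  apply functional_extensionality. intros [j Hj]. unfold trunc; simpl.
  apply Nat.ltb_lt in Hj as E. now rewrite E.
Qed.

Lemma trunc_S {n : nat} (m : nat) (v : Cn n) :
  trunc (S m) v = vadd (trunc m v) (cscale (co v m) (bas m)).
Proof.
  fext j.
  unfold trunc, vadd, cscale, bas.
  destruct (Nat.eqb_spec m (proj1_sig j)) as [E|E].
  - subst m. rewrite co_idx.
    replace (Nat.ltb (proj1_sig j) (S (proj1_sig j))) with true by (symmetry; apply Nat.ltb_lt; lia).
    replace (Nat.ltb (proj1_sig j) (proj1_sig j)) with false by (symmetry; apply Nat.ltb_ge; lia).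
    cpair.
  - destruct (Nat.ltb_spec (proj1_sig j) m) as [h|h].
    + replace (Nat.ltb (proj1_sig j) (S m)) with true by (symmetry; apply Nat.ltb_lt; lia).
      cpair.
    + replace (Nat.ltb (proj1_sig j) (S m)) with false by (symmetry; apply Nat.ltb_ge; lia).
      cpair.
Qed.

Lemma cscale_re_im {n : nat} (c : C) (v : Cn n) :
  cscale c v = vadd (vscale (fst c) v) (vscale (snd c) (cscale Ci v)).
Proof. vec. Qed.

Lemma real_linear_comb {n : nat} (L : Cn n -> R) (a b : R) (u v : Cn n) :
  real_linear L -> L (vadd (vscale a u) (vscale b v)) = a * L u + b * L v.
Proof. intros [H1 H2]. now rewrite H1, !H2. Qed.

Lemma real_linear_vzero {n : nat} (L : Cn n -> R) : real_linear L -> L vzero = 0.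
Proof.
  intros [_ H]. replace (@vzero n) with (vscale 0 (@vzero n)) by vec. rewrite H. ring.
Qed.

Lemma real_linear_vsub {n : nat} (L : Cn n -> R) (u v : Cn n) :
  real_linear L -> L (vsub u v) = L u - L v.
Proof.
  intros H. replace (vsub u v) with (vadd (vscale 1 u) (vscale (-1) v)) by vec.
  rewrite real_linear_comb by exact H. ring.
Qed.

(** Sum of the absolute values on the real basis [bas j], [i bas j]. It dominates the operator norm
    and, being a finite sum, turns pointwise limits of forms into uniform ones. *)
Definition opn {n : nat} (L : Cn n -> R) : R :=
  nsum n (fun j => Rabs (L (bas j)) + Rabs (L (cscale Ci (bas j)))).

Lemma opn_nonneg {n : nat} (L : Cn n -> R) : 0 <= opn L.
Proof.
  apply nsum_nonneg. intros j _.
  pose proof (Rabs_pos (L (bas j))). pose proof (Rabs_pos (L (cscale Ci (bas j)))). lra.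
Qed.

Lemma co_le_norm {n : nat} (v : Cn n) (k : nat) : Cmod (co v k) <= vnorm v.
Proof.
  unfold co. destruct (lt_dec k n); [apply vcomp_le_norm|].
  rewrite Cmod_0. apply vnorm_nonneg.
Qed.

Lemma real_linear_bound {n : nat} (L : Cn n -> R) (v : Cn n) :
  real_linear L -> Rabs (L v) <= opn L * vnorm v.
Proof.
  intros HL. unfold opn. rewrite <- (trunc_all v) at 1.
  assert (G : forall m, Rabs (L (trunc m v)) <=
    nsum m (fun j => Rabs (L (bas j)) + Rabs (L (cscale Ci (bas j)))) * vnorm v).
  { induction m as [|m IH].
    - rewrite trunc_0, real_linear_vzero by exact HL. rewrite Rabs_R0. simpl. lra.
    - rewrite trunc_S, (proj1 HL), cscale_re_im, real_linear_comb by exact HL. simpl.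
      pose proof (co_le_norm v m) as Hc. pose proof (Rmax_Cmod (co v m)) as Hm.
      pose proof (Rmax_l (Rabs (fst (co v m))) (Rabs (snd (co v m)))).
      pose proof (Rmax_r (Rabs (fst (co v m))) (Rabs (snd (co v m)))).
      eapply Rle_trans; [apply Rabs_triang|].
      eapply Rle_trans; [apply Rplus_le_compat_l, Rabs_triang|]. rewrite !Rabs_mult.
      pose proof (Rabs_pos (L (bas m))). pose proof (Rabs_pos (L (cscale Ci (bas m)))).
      pose proof (Rabs_pos (fst (co v m))). pose proof (Rabs_pos (snd (co v m))).
      assert (Rabs (fst (co v m)) * Rabs (L (bas m)) <= vnorm v * Rabs (L (bas m)))
        by mono_r.
      assert (Rabs (snd (co v m)) * Rabs (L (cscale Ci (bas m)))
              <= vnorm v * Rabs (L (cscale Ci (bas m))))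
        by mono_r.
      lra. }
  apply G.
Qed.

Definition clinear {n : nat} (l : Cn n -> C) : Prop :=
  (forall u v, l (vadd u v) = Cplus (l u) (l v)) /\
  (forall c v, l (cscale c v) = Cmult c (l v)).

(** The complex-linear form with real part [L]: [v |-> L v - i L (i v)]. *)
Definition cplx {n : nat} (L : Cn n -> R) (v : Cn n) : C := (L v, - L (cscale Ci v)).

Lemma cplx_clinear {n : nat} (L : Cn n -> R) : real_linear L -> clinear (cplx L).
Proof.
  intros HL. split.
  - intros u v. unfold cplx, Cplus; simpl.
    replace (cscale Ci (vadd u v)) with (vadd (cscale Ci u) (cscale Ci v)) by vec.
    rewrite !(proj1 HL). f_equal. ring.
  - intros c v. unfold cplx, Cmult; simpl.
    replace (cscale Ci (cscale c v)) with
      (vadd (vscale (- snd c) v) (vscale (fst c) (cscale Ci v))) by vec.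
    rewrite (cscale_re_im c v), !real_linear_comb by exact HL. f_equal; ring.
Qed.

Lemma clinear_vzero {n : nat} (l : Cn n -> C) : clinear l -> l vzero = RtoC 0.
Proof.
  intros [_ H]. replace (@vzero n) with (cscale (RtoC 0) (@vzero n)) by vec.
  rewrite H. ring.
Qed.

Lemma clinear_vsub {n : nat} (l : Cn n -> C) (u v : Cn n) :
  clinear l -> l (vsub u v) = Cminus (l u) (l v).
Proof.
  intros [H1 H2]. replace (vsub u v) with (vadd u (cscale (RtoC (-1)) v)) by vec.
  rewrite H1, H2. unfold Cminus. f_equal. cpair.
Qed.

Lemma Cmod_le_sum (x y : R) : Cmod (x, y) <= Rabs x + Rabs y.
Proof.
  replace (x, y) with (Cplus (RtoC x) (Cmult (RtoC y) Ci))
    by cpair.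
  eapply Rle_trans; [apply Cmod_triangle|].
  rewrite Cmod_mult, !Cmod_R, Cmod_Ci. lra.
Qed.

Lemma vnorm_Ci {n : nat} (v : Cn n) : vnorm (cscale Ci v) = vnorm v.
Proof. rewrite vnorm_cscale, Cmod_Ci. ring. Qed.

Lemma cplx_bound {n : nat} (L : Cn n -> R) (k : R) :
  (forall v, Rabs (L v) <= k * vnorm v) -> forall v, Cmod (cplx L v) <= 2 * k * vnorm v.
Proof.
  intros H v. eapply Rle_trans; [apply Cmod_le_sum|]. rewrite Rabs_Ropp.
  pose proof (H v). pose proof (H (cscale Ci v)) as H'. rewrite vnorm_Ci in H'. lra.
Qed.

(** * Symmetric bilinear forms and coercivity *)

Definition sbil {n : nat} (B : Cn n -> Cn n -> R) : Prop :=
  (forall y, real_linear (fun x => B x y)) /\ (forall x y, B x y = B y x).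

Lemma sbil_add_l {n : nat} (B : Cn n -> Cn n -> R) : sbil B ->
  forall x x' y, B (vadd x x') y = B x y + B x' y.
Proof. intros [H _] x x' y. apply (proj1 (H y)). Qed.

Lemma sbil_scale_l {n : nat} (B : Cn n -> Cn n -> R) : sbil B ->
  forall a x y, B (vscale a x) y = a * B x y.
Proof. intros [H _] a x y. apply (proj2 (H y)). Qed.

Lemma sbil_add_r {n : nat} (B : Cn n -> Cn n -> R) : sbil B ->
  forall x y y', B x (vadd y y') = B x y + B x y'.
Proof. intros HB x y y'. rewrite !(proj2 HB x). now apply sbil_add_l. Qed.

Lemma sbil_scale_r {n : nat} (B : Cn n -> Cn n -> R) : sbil B ->
  forall a x y, B x (vscale a y) = a * B x y.
Proof. intros HB a x y. rewrite !(proj2 HB x). now apply sbil_scale_l. Qed.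

Definition opn2 {n : nat} (B : Cn n -> Cn n -> R) : R :=
  nsum n (fun j => opn (B (bas j)) + opn (B (cscale Ci (bas j)))).

Lemma opn2_nonneg {n : nat} (B : Cn n -> Cn n -> R) : 0 <= opn2 B.
Proof.
  apply nsum_nonneg. intros j _.
  pose proof (opn_nonneg (B (bas j))). pose proof (opn_nonneg (B (cscale Ci (bas j)))). lra.
Qed.

Lemma bilinear_bound {n : nat} (B : Cn n -> Cn n -> R) (x y : Cn n) :
  (forall y, real_linear (fun x => B x y)) -> (forall x, real_linear (B x)) ->
  Rabs (B x y) <= opn2 B * vnorm x * vnorm y.
Proof.
  intros H1 H2. eapply Rle_trans; [apply (real_linear_bound (fun x => B x y)), H1|].
  pose proof (vnorm_nonneg x).
  replace (opn2 B * vnorm x * vnorm y) with ((opn2 B * vnorm y) * vnorm x) by ring.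
  apply Rmult_le_compat_r; [lra|]. unfold opn2, opn at 1.
  rewrite (Rmult_comm (nsum _ _)), <- nsum_scal. apply nsum_le. intros j _.
  pose proof (real_linear_bound (B (bas j)) y (H2 _)).
  pose proof (real_linear_bound (B (cscale Ci (bas j))) y (H2 _)). lra.
Qed.

Lemma sbil_bound {n : nat} (B : Cn n -> Cn n -> R) (x y : Cn n) :
  sbil B -> Rabs (B x y) <= opn2 B * vnorm x * vnorm y.
Proof.
  intros HB. apply bilinear_bound; [apply HB|].
  intros x'. split; [intros; now apply sbil_add_r|intros; now apply sbil_scale_r].
Qed.

Ltac mpos := repeat match goal with |- 0 <= _ * _ => apply Rmult_le_pos end.

(** Quantified over all forms at once, because the induction on the space passes from a form to its
    Schur complement. This algebraic route takes the place of compactness of the unit sphere. *)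
Definition coercive_on {n : nat} (V : Cn n -> Prop) : Prop :=
  forall B, sbil B -> (forall v, V v -> v <> vzero -> 0 < B v v) ->
  exists K, 0 < K /\ forall v, V v -> vnorm v ^ 2 <= K * B v v.

(* Completing the square along [b] reduces the claim to the Schur complement of [B] on [V]. *)
Lemma coercive_extend {n : nat} (V V' : Cn n -> Prop) (b : Cn n) :
  coercive_on V ->
  (forall v x, V v -> V' (vadd v (vscale x b))) ->
  (forall v, V' v -> exists u x, V u /\ v = vadd u (vscale x b)) ->
  (forall u x, V u -> vadd u (vscale x b) = vzero -> u = vzero) ->
  V vzero -> b <> vzero ->
  coercive_on V'.
Proof.
  intros HV Hin Hdec Hind H0 Hb B HB Hpos.
  set (al := B b b).
  assert (Hal : 0 < al).
  { apply Hpos; [|exact Hb]. replace b with (vadd vzero (vscale 1 b)) by vec. now apply Hin. }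
  set (B' := fun u v => B u v - B u b * B v b / al).
  assert (HB' : sbil B').
  { split.
    - intros y. unfold B'. split; intros; rewrite ?(sbil_add_l B HB), ?(sbil_scale_l B HB);
        unfold Rdiv; ring.
    - intros x y. unfold B'. rewrite (proj2 HB x y). unfold Rdiv; ring. }
  assert (Hsq : forall u x, B (vadd u (vscale x b)) (vadd u (vscale x b))
                = al * (x + B u b / al) ^ 2 + B' u u).
  { intros u x. rewrite (sbil_add_l B HB), !(sbil_add_r B HB), !(sbil_scale_l B HB),
      !(sbil_scale_r B HB), (proj2 HB b u). fold al. unfold B'. field. lra. }
  destruct (HV B' HB') as [K [HK HKv]].
  { intros u Hu Hne.
    replace (B' u u) with (B (vadd u (vscale (- (B u b / al)) b)) (vadd u (vscale (- (B u b / al)) b))).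
    - apply Hpos; [now apply Hin|]. intros E. apply Hne. eapply Hind; eauto.
    - rewrite Hsq. ring. }
  set (M := opn2 B * vnorm b / al).
  assert (HM : forall u, Rabs (B u b / al) <= M * vnorm u).
  { intros u. unfold M, Rdiv. rewrite Rabs_mult, (Rabs_pos_eq (/ al))
      by (left; now apply Rinv_0_lt_compat).
    pose proof (sbil_bound B u b HB).
    replace (opn2 B * vnorm b * / al * vnorm u) with ((opn2 B * vnorm u * vnorm b) * / al) by ring.
    apply Rmult_le_compat_r; [left; now apply Rinv_0_lt_compat|lra]. }
  set (nb := vnorm b).
  (* With [y = x + B u b / al], the constant collects [|v|^2 <= 2 |u|^2 + 2 |b|^2 x^2] and
     [x^2 <= 2 y^2 + 2 M^2 |u|^2], while [B v v = al y^2 + B' u u]. *)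
  exists (2 * K + 4 * nb ^ 2 * (/ al + M ^ 2 * K)). split.
  { assert (0 < / al) by now apply Rinv_0_lt_compat.
    assert (0 <= nb ^ 2) by nra. assert (0 <= M ^ 2) by nra.
    assert (0 <= M ^ 2 * K) by nra. nra. }
  intros v Hv. destruct (Hdec v Hv) as [u [x [Hu ->]]]. rewrite Hsq.
  set (y := x + B u b / al). set (q := B' u u).
  assert (Hq : vnorm u ^ 2 <= K * q) by now apply HKv.
  assert (Hxb : x ^ 2 <= 2 * y ^ 2 + 2 * M ^ 2 * vnorm u ^ 2).
  { replace x with (y - B u b / al) by (unfold y; ring). specialize (HM u).
    assert ((B u b / al) ^ 2 <= (M * vnorm u) ^ 2).
    { rewrite <- (pow2_abs (B u b / al)). apply pow_incr. split; [apply Rabs_pos|exact HM]. }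
    pose proof (pow2_ge_0 (y + B u b / al)). nra. }
  assert (Hn : vnorm (vadd u (vscale x b)) ^ 2 <= 2 * vnorm u ^ 2 + 2 * nb ^ 2 * x ^ 2).
  { pose proof (vnorm_triangle u (vscale x b)) as Ht. rewrite vnorm_vscale in Ht. fold nb in Ht.
    assert (vnorm (vadd u (vscale x b)) ^ 2 <= (vnorm u + Rabs x * nb) ^ 2).
    { apply pow_incr. split; [apply vnorm_nonneg|exact Ht]. }
    rewrite <- (pow2_abs x). pose proof (pow2_ge_0 (vnorm u - Rabs x * nb)). nra. }
  assert (0 <= q) by (pose proof (pow2_ge_0 (vnorm u)); nra).
  assert (H2 : 2 * nb ^ 2 * x ^ 2 <= 4 * nb ^ 2 * y ^ 2 + 4 * nb ^ 2 * M ^ 2 * (K * q)).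
  { assert (0 <= nb ^ 2) by nra. assert (0 <= M ^ 2) by nra.
    assert (M ^ 2 * vnorm u ^ 2 <= M ^ 2 * (K * q)) by mono_l.
    assert (nb ^ 2 * x ^ 2 <= nb ^ 2 * (2 * y ^ 2 + 2 * (M ^ 2 * (K * q))))
      by mono_l. nra. }
  eapply Rle_trans; [exact Hn|].
  replace ((2 * K + 4 * nb ^ 2 * (/ al + M ^ 2 * K)) * (al * y ^ 2 + q)) with
    (2 * (K * q) + 4 * nb ^ 2 * y ^ 2 + 4 * nb ^ 2 * M ^ 2 * (K * q)
     + (2 * K * al * y ^ 2 + 4 * nb ^ 2 * M ^ 2 * K * al * y ^ 2 + 4 * nb ^ 2 * / al * q))
    by (field; lra).
  assert (0 <= / al) by (left; now apply Rinv_0_lt_compat).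
  assert (0 <= nb ^ 2) by nra. assert (0 <= M ^ 2) by nra. assert (0 <= y ^ 2) by nra.
  assert (0 <= 2 * K * al * y ^ 2) by (mpos; lra).
  assert (0 <= 4 * nb ^ 2 * M ^ 2 * K * al * y ^ 2) by (mpos; lra).
  assert (0 <= 4 * nb ^ 2 * / al * q) by (mpos; lra).
  lra.
Qed.

Definition supp_lt {n : nat} (k : nat) (v : Cn n) : Prop :=
  forall j : idx n, (k <= proj1_sig j)%nat -> v j = RtoC 0.

Lemma bas_self {n : nat} (j : idx n) : @bas n (proj1_sig j) j = RtoC 1.
Proof. unfold bas. now rewrite Nat.eqb_refl. Qed.

Lemma bas_other {n : nat} (k : nat) (j : idx n) : k <> proj1_sig j -> @bas n k j = RtoC 0.
Proof. intros H. unfold bas. destruct (Nat.eqb_spec k (proj1_sig j)); [contradiction|reflexivity]. Qed.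

Lemma supp_lt_trunc {n : nat} (k : nat) (v : Cn n) : supp_lt k v <-> trunc k v = v.
Proof.
  split.
  - intros H. fext j. unfold trunc.
    destruct (Nat.ltb_spec (proj1_sig j) k); [reflexivity|]. symmetry. now apply H.
  - intros <- j Hj. unfold trunc. destruct (Nat.ltb_spec (proj1_sig j) k); [lia|reflexivity].
Qed.

Lemma supp_lt_trunc_self {n : nat} (k : nat) (v : Cn n) : supp_lt k (trunc k v).
Proof.
  intros j Hj. unfold trunc. destruct (Nat.ltb_spec (proj1_sig j) k); [lia|reflexivity].
Qed.

(** Each complex coordinate contributes the two real directions [bas k] and [i bas k], hence two
    extensions per step, through the intermediate space [V1]. *)
Lemma coercive_supp {n : nat} (k : nat) : (k <= n)%nat -> coercive_on (@supp_lt n k).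
Proof.
  induction k as [|k IH]; intros Hk.
  - intros B HB _. exists 1. split; [lra|]. intros v Hv. apply supp_lt_trunc in Hv.
    rewrite trunc_0 in Hv. subst v. rewrite vnorm_vzero.
    rewrite (real_linear_vzero (fun x => B x vzero)) by apply HB. lra.
  - assert (Hkn : (k < n)%nat) by lia.
    set (j0 := exist (fun j => (j < n)%nat) k Hkn : idx n).
    assert (Hj0 : forall w : Cn n, supp_lt k w -> w j0 = RtoC 0) by (intros w Hw; apply Hw; simpl; lia).
    assert (Hb0 : @bas n k j0 = RtoC 1) by apply (bas_self j0).
    assert (Hjk : forall j : idx n, (S k <= proj1_sig j)%nat -> @bas n k j = RtoC 0)
      by (intros j Hj; apply bas_other; lia).
    set (V1 := fun v : Cn n => exists u x, supp_lt k u /\ v = vadd u (vscale x (bas k))).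
    assert (H1 : coercive_on V1).
    { apply (coercive_extend (supp_lt k) V1 (bas k)).
      - apply IH; lia.
      - intros v x Hv. now exists v, x.
      - intros v Hv. exact Hv.
      - intros u x Hu E.
        assert (Ex : x = 0).
        { apply (f_equal (fun w => fst (w j0))) in E. unfold vadd, vscale, vzero in E.
          simpl in E. rewrite Hb0, (Hj0 u Hu) in E. simpl in E. lra. }
        rewrite <- E, Ex. vec.
      - intros j _. reflexivity.
      - intros E. apply (f_equal (fun w => fst (w j0))) in E. rewrite Hb0 in E.
        simpl in E. lra. }
    apply (coercive_extend V1 (supp_lt (S k)) (cscale Ci (bas k)) H1).
    + intros v x [u [y [Hu ->]]] j Hj. unfold vadd, vscale, cscale.
      rewrite (Hu j) by lia. rewrite (Hjk j Hj). cpair.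
    + intros v Hv. exists (vadd (trunc k v) (vscale (fst (co v k)) (bas k))), (snd (co v k)). split.
      * exists (trunc k v), (fst (co v k)). split; [apply supp_lt_trunc_self|reflexivity].
      * apply supp_lt_trunc in Hv. rewrite <- Hv at 1. rewrite trunc_S, cscale_re_im. vec.
    + intros v x [u [y [Hu ->]]] E.
      assert (Ex : x = 0).
      { apply (f_equal (fun w => snd (w j0))) in E. unfold vadd, vscale, cscale, vzero in E.
        simpl in E. rewrite Hb0, (Hj0 u Hu) in E. simpl in E. lra. }
      rewrite <- E, Ex. vec.
    + exists vzero, 0. split; [intros j _; reflexivity|vec].
    + intros E. apply (f_equal (fun w => snd (w j0))) in E. unfold cscale in E.
      rewrite Hb0 in E. simpl in E. lra.
Qed.

Lemma posdef_coercive {n : nat} (B : Cn n -> Cn n -> R) :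
  sbil B -> (forall v, v <> vzero -> 0 < B v v) ->
  exists c, 0 < c /\ forall v, c * vnorm v ^ 2 <= B v v.
Proof.
  intros HB Hpos. destruct (coercive_supp n (le_n n) B HB) as [K [HK H]].
  { intros v _. apply Hpos. }
  exists (/ K). split; [now apply Rinv_0_lt_compat|]. intros v.
  apply Rmult_le_reg_l with K; [exact HK|].
  replace (K * (/ K * vnorm v ^ 2)) with (vnorm v ^ 2) by (field; lra).
  apply H. intros [j Hj] Hjn. simpl in Hjn. lia.
Qed.

(** * Hermitian forms and orthonormal bases *)

Definition herm {n : nat} (h : Cn n -> Cn n -> C) : Prop :=
  (forall v, clinear (fun u => h u v)) /\
  (forall u v, h v u = Cconj (h u v)).

Fixpoint vsumn {n : nat} (m : nat) (F : nat -> Cn n) : Cn n :=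
  match m with O => vzero | S k => vadd (vsumn k F) (F k) end.

Fixpoint csumn (m : nat) (F : nat -> C) : C :=
  match m with O => RtoC 0 | S k => Cplus (csumn k F) (F k) end.

Lemma clinear_vsumn {n : nat} (l : Cn n -> C) (m : nat) (F : nat -> Cn n) :
  clinear l -> l (vsumn m F) = csumn m (fun j => l (F j)).
Proof.
  intros Hl. induction m as [|m IH]; simpl; [now apply clinear_vzero|].
  now rewrite (proj1 Hl), IH.
Qed.

Lemma vsumn_ext {n : nat} (m : nat) (F G : nat -> Cn n) :
  (forall j, (j < m)%nat -> F j = G j) -> vsumn m F = vsumn m G.
Proof.
  induction m as [|m IH]; intros H; simpl; [reflexivity|].
  rewrite IH by (intros; apply H; lia). now rewrite H by lia.
Qed.

Lemma csumn_ext (m : nat) (F G : nat -> C) :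
  (forall j, (j < m)%nat -> F j = G j) -> csumn m F = csumn m G.
Proof.
  induction m as [|m IH]; intros H; simpl; [reflexivity|].
  rewrite IH by (intros; apply H; lia). now rewrite H by lia.
Qed.

Lemma csumn_delta (m : nat) (F : nat -> C) (i : nat) :
  (i < m)%nat ->
  csumn m (fun j => Cmult (F j) (if Nat.eqb i j then RtoC 1 else RtoC 0)) = F i.
Proof.
  assert (Z : forall k, (k <= i)%nat ->
    csumn k (fun j => Cmult (F j) (if Nat.eqb i j then RtoC 1 else RtoC 0)) = RtoC 0).
  { induction k as [|k IH]; intros Hk; simpl; [reflexivity|].
    rewrite IH by lia. destruct (Nat.eqb_spec i k); [lia|]. ring. }
  induction m as [|m IH]; intros Hi; [lia|]; simpl.
  destruct (Nat.eqb_spec i m) as [->|E].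
  - rewrite Z by lia. ring.
  - rewrite IH by lia. ring.
Qed.

Definition orthonormal {n : nat} (h : Cn n -> Cn n -> C) (k : nat) (e : nat -> Cn n) : Prop :=
  forall i j, (i < k)%nat -> (j < k)%nat ->
    h (e i) (e j) = if Nat.eqb j i then RtoC 1 else RtoC 0.

Lemma vsumn_supp {n : nat} (k m : nat) (F : nat -> Cn n) :
  (forall i, (i < m)%nat -> supp_lt k (F i)) -> supp_lt k (vsumn m F).
Proof.
  induction m as [|m IH]; intros H j Hj; simpl; [reflexivity|].
  unfold vadd. rewrite IH by (try assumption; intros; apply H; lia).
  rewrite (H m) by (try assumption; lia). cpair.
Qed.

(** Keeping [e i] supported on the first [k] coordinates gives the new vector [g] the value 1 at
    coordinate [k]: it is nonzero, and together with the earlier vectors it spans the next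
    coordinate subspace. *)
Lemma gram_schmidt_step {n : nat} (h : Cn n -> Cn n -> C) :
  herm h -> (forall v, v <> vzero -> 0 < fst (h v v)) ->
  forall k, (k <= n)%nat -> exists e : nat -> Cn n,
    orthonormal h k e /\ (forall i, (i < k)%nat -> supp_lt k (e i)) /\
    (forall v, supp_lt k v -> v = vsumn k (fun j => cscale (h v (e j)) (e j))).
Proof.
  intros [Hl Hc] Hpos. induction k as [|k IH]; intros Hk.
  - exists (fun _ => vzero). split; [intros i j; lia|]. split; [intros i; lia|].
    intros v Hv. apply supp_lt_trunc in Hv. now rewrite <- Hv.
  - destruct IH as [e [Ho [Hs He]]]; [lia|].
    set (s := vsumn k (fun j => cscale (h (bas k) (e j)) (e j))).
    set (g := vsub (bas k) s).
    assert (Hss : supp_lt k s).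
    { apply vsumn_supp. intros i Hi j Hj. unfold cscale. rewrite (Hs i Hi j Hj). apply Cmult_0_r. }
    assert (Hge : forall i, (i < k)%nat -> h g (e i) = RtoC 0).
    { intros i Hi. unfold g. rewrite (clinear_vsub _ _ _ (Hl (e i))).
      unfold s. rewrite (clinear_vsumn _ _ _ (Hl (e i))).
      rewrite (csumn_ext k _ (fun j => Cmult (h (bas k) (e j))
                 (if Nat.eqb i j then RtoC 1 else RtoC 0))).
      - rewrite csumn_delta by exact Hi. ring.
      - intros j Hj. rewrite (proj2 (Hl (e i))), (Ho j i Hj Hi). reflexivity. }
    assert (Hkn : (k < n)%nat) by lia.
    set (j0 := exist (fun j => (j < n)%nat) k Hkn : idx n).
    assert (Hg0 : g j0 = RtoC 1).
    { unfold g, vsub. rewrite (Hss j0) by (simpl; lia).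
      replace (@bas n k j0) with (RtoC 1) by (symmetry; apply (bas_self j0)).
      cpair. }
    assert (Hg : g <> vzero).
    { intros E. rewrite E in Hg0. apply (f_equal fst) in Hg0. simpl in Hg0. lra. }
    assert (Hgs : supp_lt (S k) g).
    { intros j Hj. unfold g, vsub. rewrite (Hss j) by lia. rewrite bas_other by lia.
      cpair. }
    pose proof (Hpos g Hg) as Hq. set (q := fst (h g g)) in Hq.
    assert (Hgg : h g g = RtoC q).
    { pose proof (Hc g g) as E. apply (f_equal snd) in E. simpl in E.
      apply injective_projections; simpl; [reflexivity|lra]. }
    assert (Hsq : 0 < sqrt q) by now apply sqrt_lt_R0.
    assert (Hsq2 : sqrt q * sqrt q = q) by (apply sqrt_sqrt; lra).
    set (ek := cscale (RtoC (/ sqrt q)) g).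
    assert (Hr : forall u, h u ek = Cmult (RtoC (/ sqrt q)) (h u g)).
    { intros u. rewrite Hc. unfold ek. rewrite (proj2 (Hl u)), Hc.
      cpair. }
    assert (Hlk : forall u, h ek u = Cmult (RtoC (/ sqrt q)) (h g u))
      by (intros u; unfold ek; now rewrite (proj2 (Hl u))).
    assert (Hkk : h ek ek = RtoC 1).
    { rewrite Hr, Hlk, Hgg. rewrite <- !RtoC_mult. f_equal. rewrite <- Hsq2 at 3. field. lra. }
    assert (Hek : forall i, (i < k)%nat -> h ek (e i) = RtoC 0).
    { intros i Hi. rewrite Hlk, Hge by exact Hi. ring. }
    assert (Hke : forall i, (i < k)%nat -> h (e i) ek = RtoC 0).
    { intros i Hi. rewrite Hc, Hek by exact Hi. cpair. }
    exists (fun j => if Nat.ltb j k then e j else ek). split; [|split].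
    + intros i j Hi Hj.
      destruct (Nat.ltb_spec i k) as [Hi'|Hi'], (Nat.ltb_spec j k) as [Hj'|Hj'].
      * now apply Ho.
      * rewrite Hke by exact Hi'. destruct (Nat.eqb_spec j i); [lia|reflexivity].
      * rewrite Hek by exact Hj'. destruct (Nat.eqb_spec j i); [lia|reflexivity].
      * rewrite Hkk. destruct (Nat.eqb_spec j i); [reflexivity|lia].
    + intros i Hi j Hj. destruct (Nat.ltb_spec i k) as [Hi'|Hi'].
      * apply Hs; lia.
      * unfold ek, cscale. rewrite (Hgs j) by lia. apply Cmult_0_r.
    + intros v Hv. set (x := v j0). set (u := vsub v (cscale x g)).
      assert (Hu : supp_lt k u).
      { intros j Hj. destruct (Nat.eq_dec (proj1_sig j) k) as [E|E].
        - assert (j = j0) as ->.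
          { destruct j as [j Hjn]. simpl in E. subst j. unfold j0. f_equal. apply le_unique. }
          unfold u, vsub, cscale. rewrite Hg0. fold x. cpair.
        - unfold u, vsub, cscale. rewrite (Hv j), (Hgs j) by lia.
          cpair. }
      assert (Hvu : v = vadd u (cscale (Cmult x (RtoC (sqrt q))) ek)).
      { unfold u, ek. replace (cscale (Cmult x (RtoC (sqrt q))) (cscale (RtoC (/ sqrt q)) g))
          with (cscale x g); [vec|].
        fext j. unfold cscale.
        rewrite RtoC_inv by lra. change (Cmult x (g j) = Cmult (Cmult x (RtoC (sqrt q))) (Cmult (Cinv (RtoC (sqrt q))) (g j)) :> C). field. intros E. apply (f_equal fst) in E. simpl in E. lra. }
      pose proof (He u Hu) as Eu.
      assert (Huk : h u ek = RtoC 0).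
      { rewrite Eu, (clinear_vsumn _ _ _ (Hl ek)).
        rewrite (csumn_ext k _ (fun _ => RtoC 0)).
        - clear. induction k as [|k IH]; simpl; [reflexivity|]. rewrite IH. ring.
        - intros j Hj. rewrite (proj2 (Hl ek)), (Hke j Hj). ring. }
      simpl. destruct (Nat.ltb_spec k k) as [HH|_]; [lia|].
      rewrite (vsumn_ext k _ (fun j => cscale (h u (e j)) (e j))).
      * rewrite <- Eu. rewrite Hvu at 1. f_equal. f_equal.
        rewrite Hvu at 1. rewrite (proj1 (Hl ek)), (proj2 (Hl ek)), Huk, Hkk. ring.
      * intros j Hj. destruct (Nat.ltb_spec j k) as [_|HH]; [|lia]. f_equal.
        rewrite Hvu at 1. rewrite (proj1 (Hl (e j))), (proj2 (Hl (e j))), (Hek j Hj). ring.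
Qed.

Lemma Cconj_csumn (m : nat) (F : nat -> C) :
  Cconj (csumn m F) = csumn m (fun j => Cconj (F j)).
Proof.
  induction m as [|m IH]; simpl.
  - cpair.
  - rewrite <- IH. cpair.
Qed.

Lemma fst_csumn (m : nat) (F : nat -> C) : fst (csumn m F) = nsum m (fun j => fst (F j)).
Proof. induction m as [|m IH]; simpl; [reflexivity|now rewrite IH]. Qed.

Lemma gram_schmidt {n : nat} (h : Cn n -> Cn n -> C) :
  herm h -> (forall v, v <> vzero -> 0 < fst (h v v)) ->
  exists e : nat -> Cn n, orthonormal h n e /\
    forall v, v = vsumn n (fun j => cscale (h v (e j)) (e j)).
Proof.
  intros Hh Hpos. destruct (gram_schmidt_step h Hh Hpos n (le_n n)) as [e [Ho [_ He]]].
  exists e. split; [exact Ho|]. intros v. apply He. intros [j Hj] Hjn. simpl in Hjn. lia.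
Qed.

(** [T v] lists the coordinates of [v] in an orthonormal basis of [h]. It turns the unit ball of [h]
    into the Euclidean one. *)
Lemma herm_isometry {n : nat} (h : Cn n -> Cn n -> C) :
  herm h -> (forall v, v <> vzero -> 0 < fst (h v v)) ->
  exists T : Cn n -> Cn n,
    (forall j, clinear (fun v => T v j)) /\
    (forall v, vnorm (T v) ^ 2 = fst (h v v)) /\
    (forall x, exists v, T v = x).
Proof.
  intros Hh Hpos. destruct (gram_schmidt h Hh Hpos) as [e [Ho He]]. destruct Hh as [Hl Hc].
  exists (fun v j => h v (e (proj1_sig j))). split; [|split].
  - intros j. apply Hl.
  - intros v. rewrite vnorm_sq.
    replace (h v v) with (h (vsumn n (fun j => cscale (h v (e j)) (e j))) v)
      by (f_equal; symmetry; apply He).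
    rewrite (clinear_vsumn _ _ _ (Hl v)), fst_csumn. apply nsum_ext. intros j Hj.
    destruct (lt_dec j n) as [H|H]; [|contradiction]. simpl.
    rewrite (proj2 (Hl v)), (Hc v (e j)). simpl. ring.
  - intros x. exists (vsumn n (fun j => cscale (co x j) (e j))).
    fext j. rewrite (clinear_vsumn _ _ _ (Hl _)).
    rewrite (csumn_ext n _ (fun i => Cmult (co x i) (if Nat.eqb (proj1_sig j) i then RtoC 1 else RtoC 0))).
    + rewrite csumn_delta by apply (proj2_sig j). apply co_idx.
    + intros i Hi. rewrite (proj2 (Hl _)), (Ho i (proj1_sig j) Hi (proj2_sig j)). reflexivity.
Qed.

(** Applied to the differential at p, this yields the vector [nu] whose [h]-orthogonal complement is
    the complex tangent space of the boundary. *)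
Lemma herm_riesz {n : nat} (h : Cn n -> Cn n -> C) (l : Cn n -> C) :
  herm h -> (forall v, v <> vzero -> 0 < fst (h v v)) -> clinear l ->
  exists nu, forall v, l v = h v nu.
Proof.
  intros Hh Hpos HL. destruct (gram_schmidt h Hh Hpos) as [e [Ho He]]. destruct Hh as [Hl Hc].
  exists (vsumn n (fun j => cscale (Cconj (l (e j))) (e j))). intros v.
  rewrite (Hc _ v), (clinear_vsumn _ _ _ (Hl v)), Cconj_csumn.
  replace (l v) with (l (vsumn n (fun j => cscale (h v (e j)) (e j))))
    by (f_equal; symmetry; apply He).
  rewrite (clinear_vsumn _ _ _ HL). apply csumn_ext. intros j Hj.
  rewrite (proj2 HL), (proj2 (Hl v)), (Hc v (e j)). cpair.
Qed.

Lemma cscale_Ci_Ci {n : nat} (v : Cn n) : cscale Ci (cscale Ci v) = vscale (-1) v.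
Proof. vec. Qed.

Lemma cscale_Ci_vadd {n : nat} (u v : Cn n) :
  cscale Ci (vadd u v) = vadd (cscale Ci u) (cscale Ci v).
Proof. vec. Qed.

Lemma cscale_Ci_vscale {n : nat} (a : R) (u : Cn n) :
  cscale Ci (vscale a u) = vscale a (cscale Ci u).
Proof. vec. Qed.

(** [g] and [a] are the parts of [B] that are invariant and anti-invariant under multiplication by
    [i]; the first is the real part of a Hermitian form, the second of a complex bilinear one. The
    lower bound passes to [h] because [h v v] is the mean of [B] at [v] and at [i v]. *)
Lemma sbil_complex_parts {n : nat} (B : Cn n -> Cn n -> R) (c : R) :
  sbil B -> (forall v, c * vnorm v ^ 2 <= B v v) ->
  exists (h A : Cn n -> Cn n -> C) (K : R),
    0 < K /\ herm h /\ (forall v, clinear (fun u => A u v)) /\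
    (forall u v, A u v = A v u) /\
    (forall v, B v v = fst (A v v) + fst (h v v)) /\
    (forall v, c * vnorm v ^ 2 <= fst (h v v)) /\
    (forall v, fst (h v v) <= K * vnorm v ^ 2) /\
    (forall u v, Cmod (A u v) <= K * vnorm u * vnorm v).
Proof.
  intros HB Hc.
  set (g := fun u v => / 2 * (B u v + B (cscale Ci u) (cscale Ci v))).
  set (a := fun u v => / 2 * (B u v - B (cscale Ci u) (cscale Ci v))).
  assert (Hg : forall v, real_linear (fun u => g u v)).
  { intros v. unfold g. split; intros;
      rewrite ?cscale_Ci_vadd, ?cscale_Ci_vscale, ?(sbil_add_l B HB), ?(sbil_scale_l B HB); ring. }
  assert (Ha : forall v, real_linear (fun u => a u v)).
  { intros v. unfold a. split; intros;
      rewrite ?cscale_Ci_vadd, ?cscale_Ci_vscale, ?(sbil_add_l B HB), ?(sbil_scale_l B HB); ring. }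
  pose proof (opn2_nonneg B) as HK0.
  assert (HBb : forall u v, Rabs (B (cscale Ci u) (cscale Ci v)) <= opn2 B * vnorm u * vnorm v).
  { intros u v. pose proof (sbil_bound B (cscale Ci u) (cscale Ci v) HB) as H.
    now rewrite !vnorm_Ci in H. }
  assert (Hgb : forall u v, Rabs (g u v) <= opn2 B * vnorm u * vnorm v).
  { intros u v. unfold g. rewrite Rabs_mult, (Rabs_pos_eq (/ 2)) by lra.
    pose proof (Rabs_triang (B u v) (B (cscale Ci u) (cscale Ci v))).
    pose proof (sbil_bound B u v HB). pose proof (HBb u v). lra. }
  assert (Hab : forall u v, Rabs (a u v) <= opn2 B * vnorm u * vnorm v).
  { intros u v. unfold a. rewrite Rabs_mult, (Rabs_pos_eq (/ 2)) by lra.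
    pose proof (Rabs_triang (B u v) (- B (cscale Ci u) (cscale Ci v))) as H.
    rewrite Rabs_Ropp in H. unfold Rminus.
    pose proof (sbil_bound B u v HB). pose proof (HBb u v). lra. }
  exists (fun u v => cplx (fun x => g x v) u), (fun u v => cplx (fun x => a x v) u),
    (2 * opn2 B + 1).
  split; [lra|]. split; [split|].
  - intros v. apply (cplx_clinear (fun x => g x v)), Hg.
  - intros u v. unfold cplx, Cconj, g; simpl.
    rewrite !cscale_Ci_Ci, !(sbil_scale_l B HB), (proj2 HB v u),
      (proj2 HB (cscale Ci v) (cscale Ci u)), (proj2 HB (cscale Ci v) u), (proj2 HB v (cscale Ci u)).
    f_equal. ring.
  - split; [|split; [|split; [|split; [|split]]]].
    + intros v. apply (cplx_clinear (fun x => a x v)), Ha.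
    + intros u v. unfold cplx, a; simpl.
      rewrite !cscale_Ci_Ci, !(sbil_scale_l B HB), (proj2 HB v u),
        (proj2 HB (cscale Ci v) (cscale Ci u)), (proj2 HB (cscale Ci v) u), (proj2 HB v (cscale Ci u)).
      f_equal; ring.
    + intros v. unfold cplx, a, g; simpl. lra.
    + intros v. unfold cplx, g; simpl. pose proof (Hc v). pose proof (Hc (cscale Ci v)) as H'.
      rewrite vnorm_Ci in H'. lra.
    + intros v. unfold cplx; simpl fst. pose proof (Rle_abs (g v v)). pose proof (Hgb v v).
      pose proof (vnorm_nonneg v). assert (0 <= vnorm v ^ 2) by nra.
      assert (0 <= opn2 B * vnorm v ^ 2) by (mpos; lra). nra.
    + intros u v. pose proof (cplx_bound (fun x => a x v) (opn2 B * vnorm v)) as H.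
      eapply Rle_trans; [apply H; intros x; eapply Rle_trans; [apply Hab|right; ring]|].
      pose proof (vnorm_nonneg u). pose proof (vnorm_nonneg v).
      assert (0 <= vnorm u * vnorm v) by nra. nra.
Qed.

(** * Second-order Taylor expansion *)

Definition near {n : nat} (p : Cn n) (P : Cn n -> Prop) : Prop :=
  exists r, 0 < r /\ forall w, vnorm (vsub w p) < r -> P w.

Lemma near_and {n : nat} (p : Cn n) (P Q : Cn n -> Prop) :
  near p P -> near p Q -> near p (fun w => P w /\ Q w).
Proof.
  intros [r [Hr H]] [s [Hs H']]. exists (Rmin r s). split; [now apply Rmin_glb_lt|].
  intros w Hw. pose proof (Rmin_l r s). pose proof (Rmin_r r s). split; [apply H|apply H']; lra.
Qed.

Lemma near_imp {n : nat} (p : Cn n) (P Q : Cn n -> Prop) :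
  (forall w, P w -> Q w) -> near p P -> near p Q.
Proof. intros HPQ [r [Hr H]]. exists r. split; [exact Hr|]. intros w Hw. apply HPQ, H, Hw. Qed.

Lemma near_open {n : nat} (U : Cn n -> Prop) (p : Cn n) : is_open U -> U p -> near p U.
Proof. intros HU Hp. apply (HU p Hp). Qed.

Definition vanish_at {n : nat} (p : Cn n) (g : Cn n -> R) : Prop :=
  forall eps, 0 < eps -> near p (fun w => Rabs (g w) <= eps).

Lemma vanish_plus {n : nat} (p : Cn n) (f g : Cn n -> R) :
  vanish_at p f -> vanish_at p g -> vanish_at p (fun w => f w + g w).
Proof.
  intros Hf Hg eps He. assert (He2 : 0 < eps / 2) by lra.
  eapply near_imp; [|exact (near_and p _ _ (Hf _ He2) (Hg _ He2))].
  intros w [H1 H2]. eapply Rle_trans; [apply Rabs_triang|]. lra.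
Qed.

Lemma vanish_abs {n : nat} (p : Cn n) (f : Cn n -> R) :
  vanish_at p f -> vanish_at p (fun w => Rabs (f w)).
Proof.
  intros Hf eps He. eapply near_imp; [|exact (Hf eps He)]. intros w H. now rewrite Rabs_Rabsolu.
Qed.

Lemma vanish_nsum {n : nat} (p : Cn n) (m : nat) (f : nat -> Cn n -> R) :
  (forall j, vanish_at p (f j)) -> vanish_at p (fun w => nsum m (fun j => f j w)).
Proof.
  intros H. induction m as [|m IH]; simpl.
  - intros eps He. exists 1. split; [lra|]. intros w _. rewrite Rabs_R0. lra.
  - now apply vanish_plus.
Qed.

Lemma vanish_opn {n : nat} (p : Cn n) (F : Cn n -> Cn n -> R) :
  (forall h, vanish_at p (fun w => F w h)) -> vanish_at p (fun w => opn (F w)).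
Proof.
  intros H. apply (vanish_nsum p n (fun j w => Rabs (F w (bas j)) + Rabs (F w (cscale Ci (bas j))))).
  intros j. apply vanish_plus; apply vanish_abs, H.
Qed.

Lemma vanish_opn2 {n : nat} (p : Cn n) (F : Cn n -> Cn n -> Cn n -> R) :
  (forall h k, vanish_at p (fun w => F w h k)) -> vanish_at p (fun w => opn2 (F w)).
Proof.
  intros H. apply (vanish_nsum p n (fun j w => opn (F w (bas j)) + opn (F w (cscale Ci (bas j))))).
  intros j. apply vanish_plus; apply (vanish_opn p (fun w => F w _)); intros k; apply H.
Qed.

Lemma vnorm_vadd_vscale {n : nat} (x v : Cn n) (s : R) :
  vnorm (vsub (vadd x (vscale s v)) x) = Rabs s * vnorm v.
Proof. now rewrite vsub_vadd, vnorm_vscale. Qed.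

Lemma le_of_small_linears (x k : R) : 0 <= k -> (forall e, 0 < e -> x <= e * k) -> x <= 0.
Proof.
  intros Hk H. destruct (Rle_or_lt x 0) as [|Hx]; [assumption|exfalso].
  specialize (H (x / (2 * (k + 1)))).
  assert (0 < x / (2 * (k + 1))) by div_pos. specialize (H H0).
  assert (x / (2 * (k + 1)) * (2 * (k + 1)) = x) by (field; lra). nra.
Qed.

(** Uniqueness of the derivative, phrased so that a linear relation between functions near a point
    passes to their derivatives. Applied to [w |-> D w h] it makes [D2 z h k] linear in [h]. *)
Lemma rdiff_comb_unique {n : nat} (z : Cn n) (a b : R) (F1 F2 F3 L1 L2 L3 : Cn n -> R) :
  rdiff_at F1 z L1 -> rdiff_at F2 z L2 -> rdiff_at F3 z L3 ->
  near z (fun w => F3 w = a * F1 w + b * F2 w) ->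
  forall k, L3 k = a * L1 k + b * L2 k.
Proof.
  intros [HL1 H1] [HL2 H2] [HL3 H3] [r [Hr HF]] k.
  apply Rminus_diag_uniq. pose proof (vnorm_nonneg k) as Hk.
  set (d := L3 k - (a * L1 k + b * L2 k)).
  assert (Hd : Rabs d <= 0); [|pose proof (Rabs_pos d); destruct (Req_dec d 0) as [|Hne];
    [assumption|pose proof (Rabs_pos_lt d Hne); lra]].
  apply le_of_small_linears with ((1 + Rabs a + Rabs b) * vnorm k).
  { pose proof (Rabs_pos a). pose proof (Rabs_pos b). nra. }
  intros e He. destruct (H1 e He) as [d1 [Hd1 K1]], (H2 e He) as [d2 [Hd2 K2]],
    (H3 e He) as [d3 [Hd3 K3]].
  set (m := Rmin (Rmin d1 d2) (Rmin d3 r)).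
  assert (Hm : 0 < m) by (unfold m; repeat apply Rmin_glb_lt; assumption).
  assert (m <= d1 /\ m <= d2 /\ m <= d3 /\ m <= r) as [M1 [M2 [M3 M4]]].
  { unfold m. pose proof (Rmin_l (Rmin d1 d2) (Rmin d3 r)). pose proof (Rmin_r (Rmin d1 d2) (Rmin d3 r)).
    pose proof (Rmin_l d1 d2). pose proof (Rmin_r d1 d2). pose proof (Rmin_l d3 r).
    pose proof (Rmin_r d3 r). repeat split; lra. }
  set (s := m / (2 * (vnorm k + 1))).
  assert (Hs : 0 < s) by div_pos.
  assert (Hsk : vnorm (vscale s k) < m).
  { rewrite vnorm_vscale, Rabs_pos_eq by lra.
    assert (s * (2 * (vnorm k + 1)) = m) by (unfold s; field; lra). nra. }
  specialize (K1 (vscale s k)). specialize (K2 (vscale s k)). specialize (K3 (vscale s k)).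
  rewrite (proj2 HL1), vnorm_vscale, (Rabs_pos_eq s) in K1 by lra.
  rewrite (proj2 HL2), vnorm_vscale, (Rabs_pos_eq s) in K2 by lra.
  rewrite (proj2 HL3), vnorm_vscale, (Rabs_pos_eq s) in K3 by lra.
  rewrite vnorm_vscale, (Rabs_pos_eq s) in Hsk by lra.
  specialize (K1 ltac:(lra)). specialize (K2 ltac:(lra)). specialize (K3 ltac:(lra)).
  assert (E0 : F3 z = a * F1 z + b * F2 z).
  { apply HF. replace (vsub z z) with (@vzero n) by vec. now rewrite vnorm_vzero. }
  assert (E1 : F3 (vadd z (vscale s k)) = a * F1 (vadd z (vscale s k)) + b * F2 (vadd z (vscale s k))).
  { apply HF. rewrite vnorm_vadd_vscale, Rabs_pos_eq by lra. lra. }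
  set (X1 := F1 (vadd z (vscale s k)) - F1 z - s * L1 k) in *.
  set (X2 := F2 (vadd z (vscale s k)) - F2 z - s * L2 k) in *.
  set (X3 := F3 (vadd z (vscale s k)) - F3 z - s * L3 k) in *.
  assert (E : s * d = - X3 + (a * X1 + b * X2)).
  { unfold X1, X2, X3, d. rewrite E0, E1. ring. }
  apply Rmult_le_reg_l with s; [exact Hs|].
  rewrite <- (Rabs_pos_eq s) at 1 by lra. rewrite <- Rabs_mult, E.
  eapply Rle_trans; [apply Rabs_triang|]. rewrite Rabs_Ropp.
  eapply Rle_trans; [apply Rplus_le_compat_l, Rabs_triang|]. rewrite !Rabs_mult.
  assert (Rabs a * Rabs X1 <= Rabs a * (e * (s * vnorm k)))
    by (apply Rmult_le_compat_l; [apply Rabs_pos|exact K1]).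
  assert (Rabs b * Rabs X2 <= Rabs b * (e * (s * vnorm k)))
    by (apply Rmult_le_compat_l; [apply Rabs_pos|exact K2]).
  lra.
Qed.

Lemma rdiff_line {n : nat} (rho : Cn n -> R) (x v : Cn n) (s : R) (L : Cn n -> R) :
  rdiff_at rho (vadd x (vscale s v)) L ->
  derivable_pt_lim (fun t => rho (vadd x (vscale t v))) s (L v).
Proof.
  intros [HL H] e He. pose proof (vnorm_nonneg v) as Hv.
  set (e' := e / (2 * (vnorm v + 1))).
  assert (He' : 0 < e') by div_pos.
  destruct (H e' He') as [d [Hd K]].
  assert (Hd' : 0 < d / (vnorm v + 1)) by div_pos.
  exists (mkposreal _ Hd'). intros t Ht Htd. simpl in Htd.
  specialize (K (vscale t v)). rewrite vnorm_vscale, (proj2 HL) in K.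
  replace (vadd (vadd x (vscale s v)) (vscale t v)) with (vadd x (vscale (s + t) v)) in K by vec.
  pose proof (Rabs_pos_lt t Ht) as Hta.
  assert (Rabs t * vnorm v < d).
  { assert (d / (vnorm v + 1) * (vnorm v + 1) = d) by (field; lra). nra. }
  specialize (K H0).
  replace ((rho (vadd x (vscale (s + t) v)) - rho (vadd x (vscale s v))) / t - L v)
    with ((rho (vadd x (vscale (s + t) v)) - rho (vadd x (vscale s v)) - t * L v) / t) by (field; exact Ht).
  unfold Rdiv. rewrite Rabs_mult, Rabs_inv.
  apply Rle_lt_trans with (e' * (Rabs t * vnorm v) * / Rabs t).
  - apply Rmult_le_compat_r; [left; now apply Rinv_0_lt_compat|exact K].
  - replace (e' * (Rabs t * vnorm v) * / Rabs t) with (e' * vnorm v) by (field; lra).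
    assert (e' * (2 * (vnorm v + 1)) = e) by (unfold e'; field; lra). nra.
Qed.

Lemma rdiff_vanish {n : nat} (rho : Cn n -> R) (p : Cn n) (L : Cn n -> R) :
  rdiff_at rho p L -> vanish_at p (fun w => rho w - rho p).
Proof.
  intros [HL H] eps He. destruct (H 1 Rlt_0_1) as [d [Hd K]].
  pose proof (opn_nonneg L) as HM. set (M := opn L + 1).
  assert (HM0 : 0 < eps / M) by (apply Rdiv_lt_0_compat; unfold M; lra).
  exists (Rmin d (eps / M)). split; [now apply Rmin_glb_lt|]. intros w Hw.
  pose proof (Rmin_l d (eps / M)). pose proof (Rmin_r d (eps / M)).
  specialize (K (vsub w p)). rewrite vadd_vsub in K. specialize (K ltac:(lra)).
  pose proof (real_linear_bound L (vsub w p) HL).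
  replace (rho w - rho p) with ((rho w - rho p - L (vsub w p)) + L (vsub w p)) by ring.
  eapply Rle_trans; [apply Rabs_triang|].
  assert (M * vnorm (vsub w p) <= M * (eps / M)) by (apply Rmult_le_compat_l; unfold M in *; lra).
  replace (M * (eps / M)) with eps in H3 by (field; unfold M; lra). unfold M in *. lra.
Qed.

Lemma derivable_quadratic_remainder (f : R -> R) (c0 c1 c2 s l : R) :
  derivable_pt_lim f s l ->
  derivable_pt_lim (fun t => f t - c0 - t * c1 - / 2 * (t * t) * c2) s (l - c1 - s * c2).
Proof.
  intros Hd. apply is_derive_Reals in Hd. apply is_derive_Reals. auto_derive.
  - now exists l.
  - apply is_derive_unique in Hd. change (Derive (fun x : R => f x) s) with (Derive f s). rewrite Hd. field.
Qed.

Section C2.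
Context {n : nat} (U : Cn n -> Prop) (rho : Cn n -> R)
  (D : Cn n -> Cn n -> R) (D2 : Cn n -> Cn n -> Cn n -> R).
Hypothesis HU : is_open U.
Hypothesis HC2 : is_C2_on U rho D D2.

Lemma D2_linear_r (z h : Cn n) : U z -> real_linear (D2 z h).
Proof. intros Hz. apply (proj1 (proj2 HC2) z h Hz). Qed.

Lemma D_linear (z : Cn n) : U z -> real_linear (D z).
Proof. intros Hz. apply (proj1 HC2 z Hz). Qed.

Lemma D2_linear_l (z k : Cn n) : U z -> real_linear (fun h => D2 z h k).
Proof.
  intros Hz. destruct HC2 as [H1 [H2 _]].
  assert (HD : forall a b h h', near z (fun w => D w (vadd (vscale a h) (vscale b h')) = a * D w h + b * D w h')).
  { intros a b h h'. eapply near_imp; [|exact (near_open U z HU Hz)]. intros w Hw.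
    apply real_linear_comb, D_linear, Hw. }
  assert (K : forall a b h h', D2 z (vadd (vscale a h) (vscale b h')) k = a * D2 z h k + b * D2 z h' k).
  { intros a b h h'.
    apply (rdiff_comb_unique z a b (fun w => D w h) (fun w => D w h')
      (fun w => D w (vadd (vscale a h) (vscale b h')))); auto. }
  split.
  - intros x y. replace (vadd x y) with (vadd (vscale 1 x) (vscale 1 y)) by vec. rewrite K. ring.
  - intros a x. replace (vscale a x) with (vadd (vscale a x) (vscale 0 x)) by vec. rewrite K. ring.
Qed.

(** Continuity for each fixed direction becomes uniform in the direction because [opn] involves
    finitely many directions only. *)
Lemma D_continuous (p : Cn n) : U p -> forall eps, 0 < eps ->
  near p (fun w => forall v, Rabs (D w v - D p v) <= eps * vnorm v).
Proof.
  intros Hp eps He.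
  assert (HV : vanish_at p (fun w => opn (fun v => D w v - D p v))).
  { apply (vanish_opn p (fun w v => D w v - D p v)). intros h.
    apply (rdiff_vanish (fun w => D w h) p (D2 p h)). now apply HC2. }
  eapply near_imp; [|exact (near_and p _ _ (HV eps He) (near_open U p HU Hp))].
  intros w [H1 H2] v. simpl in H1.
  assert (Hl : real_linear (fun v => D w v - D p v)).
  { pose proof (D_linear w H2) as [A1 A2]. pose proof (D_linear p Hp) as [B1 B2].
    split; intros; rewrite ?A1, ?A2, ?B1, ?B2; ring. }
  eapply Rle_trans; [apply (real_linear_bound (fun v => D w v - D p v) v Hl)|].
  pose proof (Rle_abs (opn (fun v => D w v - D p v))).
  apply Rmult_le_compat_r; [apply vnorm_nonneg|lra].
Qed.

Lemma D2_continuous (p : Cn n) : U p -> forall eps, 0 < eps ->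
  near p (fun w => forall v, Rabs (D2 w v v - D2 p v v) <= eps * vnorm v ^ 2).
Proof.
  intros Hp eps He.
  assert (HV : vanish_at p (fun w => opn2 (fun h k => D2 w h k - D2 p h k))).
  { apply (vanish_opn2 p (fun w h k => D2 w h k - D2 p h k)). intros h k e Hee.
    destruct (proj2 (proj2 HC2) p h k Hp e Hee) as [d [Hd H]].
    exists d. split; [exact Hd|]. intros w Hw. left. now apply H. }
  eapply near_imp; [|exact (near_and p _ _ (HV eps He) (near_open U p HU Hp))].
  intros w [H1 H2] v. simpl in H1.
  eapply Rle_trans; [apply (bilinear_bound (fun h k => D2 w h k - D2 p h k) v v)|].
  - intros k. pose proof (D2_linear_l w k H2) as [A1 A2]. pose proof (D2_linear_l p k Hp) as [B1 B2].
    split; intros; rewrite ?A1, ?A2, ?B1, ?B2; ring.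
  - intros h. pose proof (D2_linear_r w h H2) as [A1 A2]. pose proof (D2_linear_r p h Hp) as [B1 B2].
    split; intros; rewrite ?A1, ?A2, ?B1, ?B2; ring.
  - pose proof (Rle_abs (opn2 (fun h k => D2 w h k - D2 p h k))).
    rewrite Rmult_assoc. replace (vnorm v * vnorm v) with (vnorm v ^ 2) by ring.
    apply Rmult_le_compat_r; [pose proof (vnorm_nonneg v); nra|lra].
Qed.

(* The mean value theorem is used twice along the segment, so only the diagonal of [D2] enters
   and its symmetry is not needed. *)
Lemma taylor2 (p : Cn n) : U p -> forall eps, 0 < eps -> exists r, 0 < r /\
  forall x v, vnorm (vsub x p) < r -> vnorm v < r ->
    U x /\ U (vadd x v) /\
    Rabs (rho (vadd x v) - rho x - D x v - / 2 * D2 p v v) <= eps * vnorm v ^ 2.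
Proof.
  intros Hp eps He.
  destruct (near_and p _ _ (D2_continuous p Hp eps He) (near_open U p HU Hp)) as [r [Hr H]].
  exists (r / 2). split; [lra|]. intros x v Hx Hv.
  assert (Hin : forall s, 0 <= s <= 1 -> vnorm (vsub (vadd x (vscale s v)) p) < r).
  { intros s Hs.
    eapply Rle_lt_trans; [apply (vnorm_sub_triangle _ x)|]. rewrite vnorm_vadd_vscale, Rabs_pos_eq by lra.
    pose proof (vnorm_nonneg v). nra. }
  pose (ps := fun s => rho (vadd x (vscale s v)) - rho x - s * D x v - / 2 * (s * s) * D2 p v v).
  pose (ps' := fun s => D (vadd x (vscale s v)) v - D x v - s * D2 p v v).
  assert (E0 : vadd x (vscale 0 v) = x) by vec. assert (E1 : vadd x (vscale 1 v) = vadd x v) by vec.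
  assert (Hder : forall s, 0 <= s <= 1 -> derivable_pt_lim ps s (ps' s)).
  { intros s Hs. apply (derivable_quadratic_remainder (fun t => rho (vadd x (vscale t v)))).
    apply rdiff_line, (proj1 HC2), H, Hin, Hs. }
  assert (Hb : forall s, 0 <= s <= 1 -> Rabs (ps' s) <= eps * vnorm v ^ 2).
  { intros s Hs. assert (Hv2 : 0 <= eps * vnorm v ^ 2) by (pose proof (vnorm_nonneg v); mpos; nra).
    destruct (Req_dec s 0) as [->|Hs0].
    - unfold ps'. rewrite E0. replace (D x v - D x v - 0 * D2 p v v) with 0 by ring.
      now rewrite Rabs_R0.
    - destruct (MVT_cor2 (fun t => D (vadd x (vscale t v)) v)
        (fun t => D2 (vadd x (vscale t v)) v v) 0 s) as [c [Hc Hcs]]; [lra| |].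
      + intros c Hc. apply (rdiff_line (fun w => D w v) x v c). apply HC2, H, Hin. lra.
      + unfold ps'. rewrite E0 in Hc. rewrite Hc.
        replace (D2 (vadd x (vscale c v)) v v * (s - 0) - s * D2 p v v)
          with (s * (D2 (vadd x (vscale c v)) v v - D2 p v v)) by ring.
        rewrite Rabs_mult, (Rabs_pos_eq s) by lra.
        assert (Rabs (D2 (vadd x (vscale c v)) v v - D2 p v v) <= eps * vnorm v ^ 2)
          by (apply H, Hin; lra).
        pose proof (Rabs_pos (D2 (vadd x (vscale c v)) v v - D2 p v v)). nra. }
  split; [|split].
  - rewrite <- E0. apply H, Hin. lra.
  - rewrite <- E1. apply H, Hin. lra.
  - destruct (MVT_cor2 ps ps' 0 1) as [c [Hc Hcs]]; [lra|exact Hder|].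
    replace (rho (vadd x v) - rho x - D x v - / 2 * D2 p v v) with (ps 1 - ps 0).
    + rewrite Hc, Rmult_minus_distr_l, Rmult_0_r, Rmult_1_r, Rminus_0_r. apply Hb. lra.
    + unfold ps. rewrite E0, E1. field.
Qed.

End C2.

(** * Strongly convex domains *)

(** [P] projects onto the kernel of [D] along [g], so [q] is positive definite and therefore
    coercive. Expanding [q v v] in terms of [S v v] leaves a cross term, absorbed half by the
    coercivity and half by the multiple of [D v ^ 2]. *)
Lemma posdef_on_kernel {n : nat} (S : Cn n -> Cn n -> R) (D : Cn n -> R) (g : Cn n) :
  sbil S -> real_linear D -> D g = 1 ->
  (forall v, v <> vzero -> D v = 0 -> 0 < S v v) ->
  exists K c, 0 <= K /\ 0 < c /\ forall v, c * vnorm v ^ 2 <= S v v + K * D v ^ 2.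
Proof.
  intros HS HD Hg Hpos.
  set (P := fun v => vsub v (vscale (D v) g)).
  set (q := fun u v => S (P u) (P v) + D u * D v).
  assert (HPa : forall u v, P (vadd u v) = vadd (P u) (P v)).
  { intros u v. unfold P. rewrite (proj1 HD). vec. }
  assert (HPs : forall a v, P (vscale a v) = vscale a (P v)).
  { intros a v. unfold P. rewrite (proj2 HD). vec. }
  assert (Hq : sbil q).
  { split.
    - intros y. unfold q. split; intros; rewrite ?HPa, ?HPs, ?(sbil_add_l S HS), ?(sbil_scale_l S HS),
        ?(proj1 HD), ?(proj2 HD); ring.
    - intros x y. unfold q. rewrite (proj2 HS (P x)). ring. }
  assert (HDP : forall v, D (P v) = 0).
  { intros v. unfold P. rewrite real_linear_vsub, (proj2 HD), Hg by exact HD. ring. }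
  destruct (posdef_coercive q Hq) as [c [Hc Hcq]].
  { intros v Hv. unfold q. destruct (classic (P v = vzero)) as [E|E].
    - rewrite E. rewrite (real_linear_vzero (fun x => S x vzero)) by apply HS.
      assert (D v <> 0).
      { intros E'. apply Hv. unfold P in E. rewrite E' in E. rewrite <- E. vec. }
      nra.
    - pose proof (Hpos (P v) E (HDP v)). nra. }
  set (M := opn2 S * vnorm g).
  (* The three summands pay for the terms [d^2], [-2 d S v g] and [d^2 S g g] of [q v v]; the cross
     term also costs half of [c]. *)
  exists (1 + 2 * M ^ 2 / c + Rabs (S g g)), (c / 2).
  assert (HM2 : 0 <= 2 * M ^ 2 / c).
  { apply Rmult_le_pos; [pose proof (pow2_ge_0 M); lra|left; now apply Rinv_0_lt_compat]. }
  split; [pose proof (Rabs_pos (S g g)); lra|]. split; [lra|].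
  intros v. specialize (Hcq v). set (d := D v).
  assert (Eq : q v v = S v v - 2 * d * S v g + d ^ 2 * S g g + d ^ 2).
  { unfold q, P. fold d. replace (vsub v (vscale d g)) with (vadd v (vscale (- d) g)) by vec.
    rewrite !(sbil_add_l S HS), !(sbil_add_r S HS), !(sbil_scale_l S HS), !(sbil_scale_r S HS),
      (proj2 HS g v). ring. }
  assert (HSg : Rabs (S v g) <= M * vnorm v).
  { eapply Rle_trans; [now apply sbil_bound|]. unfold M. right; ring. }
  assert (H1 : - (2 * d * S v g) <= c / 2 * vnorm v ^ 2 + 2 * M ^ 2 / c * d ^ 2).
  { assert (Ha : - (d * S v g) <= Rabs d * (M * vnorm v)).
    { eapply Rle_trans; [apply Rle_abs|]. rewrite Rabs_Ropp, Rabs_mult.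
      apply Rmult_le_compat_l; [apply Rabs_pos|exact HSg]. }
    (* AM-GM *)
    assert (Hb : 0 <= c / 2 * (vnorm v - 2 * M / c * Rabs d) ^ 2)
      by (apply Rmult_le_pos; [lra|apply pow2_ge_0]).
    replace (c / 2 * (vnorm v - 2 * M / c * Rabs d) ^ 2) with
      (c / 2 * vnorm v ^ 2 - 2 * (Rabs d * (M * vnorm v)) + 2 * M ^ 2 / c * Rabs d ^ 2) in Hb
      by (field; lra).
    rewrite pow2_abs in Hb. lra. }
  assert (H2 : S g g * d ^ 2 <= Rabs (S g g) * d ^ 2)
    by (apply Rmult_le_compat_r; [apply pow2_ge_0|apply Rle_abs]).
  rewrite Eq in Hcq. lra.
Qed.

(** [l p'] is the complex-linear form whose real part is minus the differential of the defining
    function at [p']. The bound [lm_support] reaches every point of the domain, whereas [lm_taylor]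
    is local and works in both directions: it constrains points of the domain and certifies
    membership. The term [|Re l|] in its error is the price of making [h] positive definite in all
    directions. *)
Record local_model {n : nat} (Om : Cn n -> Prop) (p : Cn n) (l : Cn n -> Cn n -> C)
  (h A : Cn n -> Cn n -> C) (nu : Cn n) (K c r0 : R) : Prop := {
  lm_K : 0 < K;
  lm_c : 0 < c;
  lm_r : 0 < r0;
  lm_h : herm h;
  lm_h_low : forall v, c * vnorm v ^ 2 <= fst (h v v);
  lm_h_up : forall v, fst (h v v) <= K * vnorm v ^ 2;
  lm_A : forall v, clinear (fun u => A u v);
  lm_A_sym : forall u v, A u v = A v u;
  lm_A_up : forall u v, Cmod (A u v) <= K * vnorm u * vnorm v;
  lm_l : forall p', boundary Om p' -> vnorm (vsub p' p) < r0 -> clinear (l p');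
  lm_l_up : forall p', boundary Om p' -> vnorm (vsub p' p) < r0 ->
    forall v, Cmod (l p' v) <= K * vnorm v;
  lm_support : forall p', boundary Om p' -> vnorm (vsub p' p) < r0 ->
    forall z, Om z -> c * vnorm (vsub z p') ^ 2 <= fst (l p' (vsub z p'));
  lm_nu : forall v, l p v = h v nu;
  lm_nu0 : nu <> vzero;
  lm_cont : forall eps, 0 < eps -> exists r, 0 < r /\
    forall p', boundary Om p' -> vnorm (vsub p' p) < r ->
    forall v, Cmod (Cminus (l p' v) (l p v)) <= eps * vnorm v;
  lm_taylor : forall eps, 0 < eps -> exists r, 0 < r /\
    forall p' v, boundary Om p' -> vnorm (vsub p' p) < r -> vnorm v < r ->
    (Om (vadd p' v) -> fst (A v v) + fst (h v v)
       <= fst (l p' v) + eps * (vnorm v ^ 2 + Rabs (fst (l p' v)))) /\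
    (fst (A v v) + fst (h v v) + eps * (vnorm v ^ 2 + Rabs (fst (l p' v))) < fst (l p' v) ->
       Om (vadd p' v));
  lm_exit : forall r, 0 < r -> near p (fun q => Om q -> exists p' t, boundary Om p' /\
    vnorm (vsub p' p) < r /\ 0 < t < r /\ q = vadd p' (vscale t nu))
}.

Arguments lm_K {n Om p l h A nu K c r0} _.
Arguments lm_c {n Om p l h A nu K c r0} _.
Arguments lm_r {n Om p l h A nu K c r0} _.
Arguments lm_h {n Om p l h A nu K c r0} _.
Arguments lm_h_low {n Om p l h A nu K c r0} _.
Arguments lm_h_up {n Om p l h A nu K c r0} _.
Arguments lm_A {n Om p l h A nu K c r0} _.
Arguments lm_A_sym {n Om p l h A nu K c r0} _.
Arguments lm_A_up {n Om p l h A nu K c r0} _.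
Arguments lm_l {n Om p l h A nu K c r0} _.
Arguments lm_l_up {n Om p l h A nu K c r0} _.
Arguments lm_support {n Om p l h A nu K c r0} _.
Arguments lm_nu {n Om p l h A nu K c r0} _.
Arguments lm_nu0 {n Om p l h A nu K c r0} _.
Arguments lm_cont {n Om p l h A nu K c r0} _.
Arguments lm_taylor {n Om p l h A nu K c r0} _.
Arguments lm_exit {n Om p l h A nu K c r0} _.

Section Domain.
Context {n : nat} (Om U : Cn n -> Prop) (rho : Cn n -> R)
  (D : Cn n -> Cn n -> R) (D2 : Cn n -> Cn n -> Cn n -> R).
Hypothesis HU : is_open U.
Hypothesis Hcl : forall z, closure Om z -> U z.
Hypothesis HC2 : is_C2_on U rho D D2.
Hypothesis Hdef : forall z, Om z <-> (U z /\ rho z < 0).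
Hypothesis Hgrad : forall p, boundary Om p -> exists v, D p v <> 0.
Hypothesis Hsc : forall p, boundary Om p -> forall v, v <> vzero -> D p v = 0 -> D2 p v v > 0.
Hypothesis Hopen : is_open Om.
Hypothesis Hconn : is_connected Om.

Lemma closure_rho (z : Cn n) : closure Om z -> rho z <= 0.
Proof.
  intros Hz. destruct (Rle_or_lt (rho z) 0) as [|H]; [assumption|exfalso].
  destruct (rdiff_vanish rho z (D z) (proj1 HC2 z (Hcl z Hz)) (rho z / 2)) as [r [Hr K]]; [lra|].
  destruct (Hz r Hr) as [w [Hw Hwb]]. specialize (K w Hwb). apply Hdef in Hw.
  apply Rabs_le_between in K. lra.
Qed.

Lemma boundary_rho (z : Cn n) : boundary Om z -> rho z = 0.
Proof.
  intros [Hz Hn]. apply Rle_antisym; [now apply closure_rho|].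
  destruct (Rle_or_lt 0 (rho z)) as [|H]; [assumption|]. elim Hn. apply Hdef. auto.
Qed.

(** If [z] were a boundary point, [rho] along the segment would be at most 0 with value 0 in the
    middle. The second-order expansion then forces [D z v = 0] and [D2 z v v <= 0], against strong
    convexity. *)
Lemma segment_touch (z v : Cn n) (d : R) : 0 < d ->
  (forall t, Rabs t < d -> closure Om (vadd z (vscale t v))) -> v <> vzero -> Om z.
Proof.
  intros Hd Hseg Hv. apply NNPP. intros Hn.
  assert (Hz : closure Om z).
  { replace z with (vadd z (vscale 0 v)) by vec. apply Hseg. rewrite Rabs_R0. exact Hd. }
  assert (Hb : boundary Om z) by now split.
  pose proof (Hcl z Hz) as HUz. pose proof (boundary_rho z Hb) as H0.
  pose proof (vnorm_pos v Hv) as Hvp.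
  pose proof (D_linear U rho D D2 HC2 z HUz) as HDl.
  pose proof (D2_linear_l U rho D D2 HU HC2 z v HUz) as Hl1.
  pose proof (D2_linear_r U rho D D2 HC2 z) as Hl2.
  set (a := D z v). set (b := D2 z v v).
  assert (K : forall eps, 0 < eps -> exists s, 0 < s /\ forall t, Rabs t < s ->
    t * a + / 2 * (t * t) * b <= eps * (t * t)).
  { intros eps He.
    destruct (taylor2 U rho D D2 HU HC2 z HUz (eps / vnorm v ^ 2)) as [r [Hr Ht]].
    { apply Rdiv_lt_0_compat; [exact He|]. now apply pow_lt. }
    exists (Rmin d (r / vnorm v)).
    split; [apply Rmin_glb_lt; [exact Hd|now apply Rdiv_lt_0_compat]|]. intros t Hts.
    pose proof (Rmin_l d (r / vnorm v)). pose proof (Rmin_r d (r / vnorm v)).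
    destruct (Ht z (vscale t v)) as [_ [_ Hr']].
    - replace (vsub z z) with (@vzero n) by vec. now rewrite vnorm_vzero.
    - rewrite vnorm_vscale. assert (r / vnorm v * vnorm v = r) by (field; lra). nra.
    - rewrite H0, vnorm_vscale, (proj2 HDl), (proj2 (Hl2 _ HUz)), (proj2 Hl1) in Hr'.
      fold a b in Hr'.
      assert (Hc : rho (vadd z (vscale t v)) <= 0) by (apply closure_rho, Hseg; lra).
      replace (eps / vnorm v ^ 2 * (Rabs t * vnorm v) ^ 2) with (eps * (Rabs t ^ 2)) in Hr'
        by (field; lra).
      rewrite pow2_abs in Hr'. apply Rabs_le_between in Hr'. lra. }
  (* Adding the inequalities at [t] and [-t] cancels the linear term. *)
  assert (Hb0 : b <= 0).
  { apply le_of_small_linears with 2; [lra|]. intros e He. destruct (K e He) as [s [Hs Ks]].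
    pose proof (Ks (s / 2)) as K1. pose proof (Ks (- (s / 2))) as K2.
    rewrite Rabs_pos_eq in K1 by lra. rewrite Rabs_Ropp, Rabs_pos_eq in K2 by lra.
    specialize (K1 ltac:(lra)). specialize (K2 ltac:(lra)).
    assert (0 < s / 2 * (s / 2)) by nra. nra. }
  assert (Ha0 : a = 0).
  { destruct (K 1 Rlt_0_1) as [s [Hs Ks]].
    assert (G : Rabs a <= 0).
    { apply le_of_small_linears with (1 + Rabs b); [pose proof (Rabs_pos b); lra|]. intros e He.
      set (t := Rmin (s / 2) e).
      assert (0 < t) by (apply Rmin_glb_lt; lra).
      assert (t <= s / 2) by apply Rmin_l. assert (t <= e) by apply Rmin_r.
      pose proof (Ks t) as K1. pose proof (Ks (- t)) as K2.
      rewrite Rabs_Ropp in K2. rewrite Rabs_pos_eq in K1, K2 by lra.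
      specialize (K1 ltac:(lra)). specialize (K2 ltac:(lra)).
      pose proof (Rle_abs (- b)). rewrite Rabs_Ropp in H3. pose proof (Rabs_pos b).
      assert (A1 : a <= t * (1 + Rabs b)) by nra. assert (A2 : - a <= t * (1 + Rabs b)) by nra.
      assert (Rabs a <= t * (1 + Rabs b)) by (apply Rabs_le; lra). nra. }
    destruct (Req_dec a 0) as [|Hne]; [assumption|]. pose proof (Rabs_pos_lt a Hne). lra. }
  pose proof (Hsc z Hb v Hv Ha0). unfold b in Hb0. lra.
Qed.

(** * Convexity of the domain *)

Definition seg (x y : Cn n) (s : R) : Cn n := vadd x (vscale s (vsub y x)).

Lemma seg_dist (x y y' : Cn n) (s s' : R) :
  vnorm (vsub (seg x y' s') (seg x y s)) <= Rabs (s' - s) * vnorm (vsub y x) + Rabs s' * vnorm (vsub y' y).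
Proof.
  replace (vsub (seg x y' s') (seg x y s)) with
    (vadd (vscale (s' - s) (vsub y x)) (vscale s' (vsub y' y))) by (unfold seg; vec).
  rewrite <- !vnorm_vscale. apply vnorm_triangle.
Qed.

(** Each point of the segment has a margin inside the domain; compactness of [[0, 1]] makes the
    margins uniform. *)
Lemma visible_open (x y : Cn n) : (forall s, 0 <= s <= 1 -> Om (seg x y s)) ->
  exists r, 0 < r /\ forall y', ball y r y' -> forall s, 0 <= s <= 1 -> Om (seg x y' s).
Proof.
  intros H. pose proof (vnorm_nonneg (vsub y x)) as Hn.
  assert (L : forall s, exists d : posreal, 0 <= s <= 1 -> forall s' y', 0 <= s' <= 1 ->
    Rabs (s' - s) < d -> ball y d y' -> Om (seg x y' s')).
  { intros s. destruct (classic (0 <= s <= 1)) as [Hs|Hs].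
    - destruct (Hopen _ (H s Hs)) as [r [Hr Hb]].
      assert (Hd : 0 < r / (vnorm (vsub y x) + 1)) by div_pos.
      exists (mkposreal _ Hd). intros _ s' y' Hs' Hss Hy. simpl in Hss. unfold ball in Hy. simpl in Hy.
      apply Hb. unfold ball. eapply Rle_lt_trans; [apply seg_dist|].
      rewrite (Rabs_pos_eq s') by lra.
      assert (E : r / (vnorm (vsub y x) + 1) * (vnorm (vsub y x) + 1) = r) by (field; lra).
      pose proof (vnorm_nonneg (vsub y' y)). pose proof (Rabs_pos (s' - s)).
      assert (s' * vnorm (vsub y' y) <= vnorm (vsub y' y)) by nra. nra.
    (* The gauge has to be positive on the whole line; off [[0, 1]] its value is arbitrary. *)
    - exists (mkposreal 1 Rlt_0_1). intros; contradiction. }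
  set (delta := fun s => proj1_sig (constructive_indefinite_description _ (L s))).
  destruct (compactness_value_1d 0 1 delta) as [d Hd].
  exists d. split; [apply cond_pos|]. intros y' Hy s Hs. apply NNPP. intros Hno.
  apply (Hd s Hs). intros [t [Ht [Hst Hdt]]]. apply Hno.
  revert Hst Hdt. unfold delta.
  destruct (constructive_indefinite_description _ (L t)) as [dt Hdt]; simpl.
  intros Hst Hle. apply (Hdt Ht s y' Hs Hst). unfold ball in *. lra.
Qed.

(* The points of [Om] visible from [x] form an open and closed subset: a limit of segments
   inside [Om] cannot touch the boundary from inside because of the strong convexity. *)
Lemma domain_convex (x y : Cn n) (s : R) : Om x -> Om y -> 0 <= s <= 1 -> Om (seg x y s).
Proof.
  intros Hx Hy Hs.
  set (V1 := fun y => forall s, 0 <= s <= 1 -> Om (seg x y s)).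
  set (V2 := fun y => Om y /\ ~ V1 y).
  apply NNPP. intros Hno.
  destruct (Hconn V1 V2) as [z [_ [Hz1 [_ Hz2]]]]; [| | | | |contradiction].
  - intros z Hz. now apply visible_open.
  - intros z [Hz HzV]. apply NNPP. intros Hcontra. apply HzV.
    destruct (Hopen z Hz) as [r0 [Hr0 Hb0]].
    assert (Hlim : forall r, 0 < r -> exists w, ball z r w /\ V1 w).
    { intros r Hr. apply NNPP. intros Hnw. apply Hcontra. exists (Rmin r r0).
      split; [now apply Rmin_glb_lt|]. intros w Hw. unfold ball in Hw.
      pose proof (Rmin_l r r0). pose proof (Rmin_r r r0). split.
      - apply Hb0. unfold ball. lra.
      - intros Hv. apply Hnw. exists w. split; [unfold ball; lra|exact Hv]. }
    assert (Hclo : forall t, 0 <= t <= 1 -> closure Om (seg x z t)).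
    { intros t Ht r Hr. destruct (Hlim r Hr) as [w [Hw Hv]]. exists (seg x w t).
      split; [now apply Hv|]. unfold ball in *. eapply Rle_lt_trans; [apply seg_dist|].
      replace (t - t) with 0 by ring. rewrite Rabs_R0, (Rabs_pos_eq t) by lra.
      pose proof (vnorm_nonneg (vsub w z)). nra. }
    intros t Ht. destruct (classic (vsub z x = vzero)) as [E|E].
    + replace (seg x z t) with x by (unfold seg; rewrite E; vec). exact Hx.
    + destruct (Req_dec t 0) as [->|Ht0]; [replace (seg x z 0) with x by (unfold seg; vec); exact Hx|].
      destruct (Req_dec t 1) as [->|Ht1]; [replace (seg x z 1) with z by (unfold seg; vec); exact Hz|].
      apply (segment_touch _ (vsub z x) (Rmin t (1 - t))); [apply Rmin_glb_lt; lra| |exact E].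
      intros u Hu. replace (vadd (seg x z t) (vscale u (vsub z x))) with (seg x z (t + u))
        by (unfold seg; vec).
      pose proof (Rmin_l t (1 - t)). pose proof (Rmin_r t (1 - t)).
      apply Hclo. apply Rabs_lt_between in Hu. lra.
  - intros z Hz. destruct (classic (V1 z)); [now left|right; now split].
  - exists x. split; [exact Hx|]. intros t Ht. replace (seg x x t) with x by (unfold seg; vec). exact Hx.
  - exists y. split; [exact Hy|]. split; [exact Hy|]. intros Hv. apply Hno, Hv, Hs.
Qed.

Lemma closure_segment (p z : Cn n) (s : R) :
  closure Om p -> Om z -> 0 <= s <= 1 -> closure Om (seg p z s).
Proof.
  intros Hp Hz Hs r Hr. destruct (Hp r Hr) as [w [Hw Hwb]]. exists (seg w z s).
  split; [now apply domain_convex|]. unfold ball in *.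
  replace (vsub (seg w z s) (seg p z s)) with (vscale (1 - s) (vsub w p)) by (unfold seg; vec).
  rewrite vnorm_vscale, Rabs_pos_eq by lra. pose proof (vnorm_nonneg (vsub w p)). nra.
Qed.

(** Going from [q] by [s0] in the direction [-nu] leads out of the domain, since the end point is
    close to [p - s0 nu], which either has [rho > 0] or lies off [U] and hence off the closure. The
    last parameter in the closure gives the boundary point. *)
Lemma exit_point (p nu : Cn n) : boundary Om p -> D p nu < 0 -> forall r, 0 < r ->
  near p (fun q => Om q -> exists p' t, boundary Om p' /\ vnorm (vsub p' p) < r /\
    0 < t < r /\ q = vadd p' (vscale t nu)).
Proof.
  intros Hp Hnu r Hr. pose proof (vnorm_nonneg nu) as Hn.
  pose proof (Hcl p (proj1 Hp)) as HUp. pose proof (proj1 HC2 p HUp) as [HDl Hdiff].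
  destruct (Hdiff (- D p nu / (2 * (vnorm nu + 1)))) as [d [Hd Hd']].
  { div_pos. }
  destruct (near_open U p HU HUp) as [rU [HrU HrU']].
  set (m := Rmin (Rmin d r) (r / 2)).
  assert (Hm : 0 < m) by (unfold m; repeat apply Rmin_glb_lt; lra).
  assert (m <= d /\ m <= r / 2) as [Hmd Hmr].
  { unfold m. pose proof (Rmin_l (Rmin d r) (r / 2)). pose proof (Rmin_r (Rmin d r) (r / 2)).
    pose proof (Rmin_l d r). split; lra. }
  set (s0 := m / (vnorm nu + 1)).
  assert (Hs0 : 0 < s0) by div_pos.
  assert (Es0 : s0 * (vnorm nu + 1) = m) by (unfold s0; field; lra).
  assert (Hpos : 0 < rho (vadd p (vscale (- s0) nu))).
  { specialize (Hd' (vscale (- s0) nu)).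
    rewrite vnorm_vscale, Rabs_Ropp, (Rabs_pos_eq s0), (proj2 HDl), (boundary_rho p Hp) in Hd' by lra.
    assert (s0 * vnorm nu < d) by nra. specialize (Hd' H).
    apply Rabs_le_between in Hd'.
    assert (Hk : - D p nu / (2 * (vnorm nu + 1)) * (s0 * vnorm nu) <= s0 * (- D p nu) / 2).
    { replace (- D p nu / (2 * (vnorm nu + 1)) * (s0 * vnorm nu)) with
        (s0 * (- D p nu) / 2 * (vnorm nu / (vnorm nu + 1))) by (field; lra).
      assert (vnorm nu / (vnorm nu + 1) <= 1).
      { apply Rmult_le_reg_r with (vnorm nu + 1); [lra|].
        replace (vnorm nu / (vnorm nu + 1) * (vnorm nu + 1)) with (vnorm nu) by (field; lra). lra. }
      assert (0 <= s0 * (- D p nu) / 2) by nra. nra. }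
    assert (0 < s0 * (- D p nu)) by nra. lra. }
  assert (Hout : near p (fun q => ~ Om (vadd q (vscale (- s0) nu)))).
  { set (x := vadd p (vscale (- s0) nu)) in *.
    destruct (classic (U x)) as [HUx|HUx].
    - destruct (rdiff_vanish rho x (D x) (proj1 HC2 x HUx) (rho x / 2)) as [r1 [Hr1 K]]; [lra|].
      exists r1. split; [exact Hr1|]. intros q Hq HOm. apply Hdef in HOm.
      specialize (K (vadd q (vscale (- s0) nu))).
      replace (vsub (vadd q (vscale (- s0) nu)) x) with (vsub q p) in K by (unfold x; vec).
      specialize (K Hq). apply Rabs_le_between in K. lra.
    - assert (Hncl : ~ closure Om x) by (intros Hc; apply HUx, Hcl, Hc).
      apply NNPP. intros Hno. apply Hncl. intros e He. apply NNPP. intros Hne. apply Hno.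
      exists e. split; [exact He|]. intros q Hq HOm. apply Hne.
      exists (vadd q (vscale (- s0) nu)). split; [exact HOm|]. unfold ball.
      now replace (vsub (vadd q (vscale (- s0) nu)) x) with (vsub q p) by (unfold x; vec). }
  destruct Hout as [r1 [Hr1 Hout]].
  exists (Rmin r1 (r / 2)). split; [apply Rmin_glb_lt; lra|]. intros q Hq Hqo.
  pose proof (Rmin_l r1 (r / 2)). pose proof (Rmin_r r1 (r / 2)).
  specialize (Hout q ltac:(lra)).
  (* The supremum of [E] gives a point of the closure, and openness of the domain shows that this
     point is not inside. *)
  set (E := fun s => 0 <= s <= s0 /\ Om (vadd q (vscale (- s) nu))).
  assert (E0 : E 0).
  { split; [lra|]. now replace (vadd q (vscale (- 0) nu)) with q by vec. }
  destruct (completeness E) as [t [Hub Hlub]].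
  { exists s0. intros s [Hs _]. lra. }
  { now exists 0. }
  assert (Ht0 : 0 <= t) by now apply Hub.
  assert (Hts : t <= s0) by (apply Hlub; intros s [Hs _]; lra).
  assert (Hclt : closure Om (vadd q (vscale (- t) nu))).
  { intros e He. set (e' := e / (vnorm nu + 1)).
    assert (He' : 0 < e') by div_pos.
    assert (Hex : exists s, E s /\ t - e' < s).
    { apply NNPP. intros Hno. assert (t <= t - e'); [|lra]. apply Hlub. intros s Hs.
      destruct (Rle_or_lt s (t - e')) as [|Hlt]; [assumption|]. elim Hno. now exists s. }
    destruct Hex as [s [Hs Hse]]. exists (vadd q (vscale (- s) nu)). split; [apply Hs|].
    unfold ball.
    replace (vsub (vadd q (vscale (- s) nu)) (vadd q (vscale (- t) nu))) with (vscale (t - s) nu) by vec.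
    pose proof (Hub s Hs). rewrite vnorm_vscale, Rabs_pos_eq by lra.
    assert (e' * (vnorm nu + 1) = e) by (unfold e'; field; lra). nra. }
  assert (Hnt : ~ Om (vadd q (vscale (- t) nu))).
  { intros HOm. destruct (Req_dec t s0) as [->|Hne]; [contradiction|].
    destruct (Hopen _ HOm) as [e [He Hb]].
    set (a := Rmin (s0 - t) (e / (2 * (vnorm nu + 1)))).
    assert (Ha : 0 < a) by (apply Rmin_glb_lt; [lra|div_pos]).
    assert (Ha1 : a <= s0 - t) by apply Rmin_l.
    assert (Ha2 : a <= e / (2 * (vnorm nu + 1))) by apply Rmin_r.
    assert (E (t + a)).
    { split; [lra|]. apply Hb. unfold ball.
      replace (vsub (vadd q (vscale (- (t + a)) nu)) (vadd q (vscale (- t) nu)))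
        with (vscale (- a) nu) by vec.
      rewrite vnorm_vscale, Rabs_Ropp, Rabs_pos_eq by lra.
      assert (e / (2 * (vnorm nu + 1)) * (2 * (vnorm nu + 1)) = e) by (field; lra). nra. }
    pose proof (Hub (t + a) H1). lra. }
  exists (vadd q (vscale (- t) nu)), t. split; [now split|]. split; [|split].
  - eapply Rle_lt_trans; [apply (vnorm_sub_triangle _ q)|].
    rewrite vnorm_vadd_vscale, Rabs_Ropp, Rabs_pos_eq by lra. nra.
  - split.
    + destruct (Req_dec t 0) as [E1|]; [|lra]. subst t. elim Hnt.
      now replace (vadd q (vscale (- 0) nu)) with q by vec.
    + apply Rle_lt_trans with s0; [exact Hts|]. nra.
  - vec.
Qed.

(** * The local model at a boundary point *)

Lemma real_linear_opp (L : Cn n -> R) : real_linear L -> real_linear (fun v => - L v).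
Proof. intros [H1 H2]. split; intros; rewrite ?H1, ?H2; ring. Qed.

(** The added term [K (D p v)^2] need not be small against [|v|^2]. It is absorbed because
    [(D p v)^2 <= 2 (D p' v)^2 + 2 e2^2 |v|^2], and [(D p' v)^2 <= M |v| |D p' v|] is a small
    multiple of [|D p' v|] when [v] is small. *)
Lemma boundary_taylor (p : Cn n) (K : R) : boundary Om p -> 0 <= K ->
  forall eps, 0 < eps -> exists r, 0 < r /\
  forall p' v, boundary Om p' -> vnorm (vsub p' p) < r -> vnorm v < r ->
    U (vadd p' v) /\
    Rabs (rho (vadd p' v) - D p' v - (/ 2 * D2 p v v + K * D p v ^ 2))
      <= eps * (vnorm v ^ 2 + Rabs (D p' v)).
Proof.
  intros Hp HK eps He. pose proof (Hcl p (proj1 Hp)) as HUp.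
  set (M := opn (D p) + 1). pose proof (opn_nonneg (D p)) as HM.
  set (e2 := Rmin 1 (eps / (4 * (K + 1)))).
  assert (He2 : 0 < e2) by (apply Rmin_glb_lt; [lra|div_pos]).
  assert (He21 : e2 <= 1) by apply Rmin_l.
  assert (He2K : 2 * K * (e2 * e2) <= eps / 2).
  { assert (e2 <= eps / (4 * (K + 1))) by apply Rmin_r.
    assert (eps / (4 * (K + 1)) * (4 * (K + 1)) = eps) by (field; lra).
    assert (e2 * (4 * (K + 1)) <= eps) by nra.
    assert (K * (e2 * e2) <= K * e2) by (apply Rmult_le_compat_l; nra). nra. }
  destruct (taylor2 U rho D D2 HU HC2 p HUp (eps / 2)) as [r1 [Hr1 HT]]; [lra|].
  destruct (D_continuous U rho D D2 HU HC2 p HUp e2 He2) as [r2 [Hr2 HD]].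
  set (r3 := eps / (2 * K * M + 1)).
  assert (HKM : 0 <= 2 * K * M) by (unfold M; mpos; lra).
  assert (Hr3 : 0 < r3) by div_pos.
  exists (Rmin (Rmin r1 r2) r3). split; [repeat apply Rmin_glb_lt; assumption|].
  intros p' v Hp' Hpp Hv.
  pose proof (Rmin_l (Rmin r1 r2) r3). pose proof (Rmin_r (Rmin r1 r2) r3).
  pose proof (Rmin_l r1 r2). pose proof (Rmin_r r1 r2).
  destruct (HT p' v) as [_ [HUv Ht]]; [lra|lra|]. split; [exact HUv|].
  specialize (HD p' ltac:(lra) v). rewrite (boundary_rho p' Hp') in Ht.
  pose proof (real_linear_bound (D p) v (D_linear U rho D D2 HC2 p HUp)) as HDp.
  pose proof (vnorm_nonneg v) as Hvn.
  set (x := D p' v) in *. set (y := D p v) in *. set (N := vnorm v) in *.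
  assert (Hx : Rabs x <= M * N).
  { replace x with ((x - y) + y) by ring. eapply Rle_trans; [apply Rabs_triang|]. unfold M. nra. }
  assert (Hy2 : y ^ 2 <= 2 * (Rabs x * (M * N)) + 2 * (e2 * e2) * N ^ 2).
  { assert (A1 : y ^ 2 <= 2 * x ^ 2 + 2 * (x - y) ^ 2) by (pose proof (pow2_ge_0 (2 * x - y)); nra).
    assert (A2 : (x - y) ^ 2 <= (e2 * N) ^ 2).
    { rewrite <- (pow2_abs (x - y)). apply pow_incr. split; [apply Rabs_pos|exact HD]. }
    assert (A3 : x ^ 2 <= Rabs x * (M * N)).
    { rewrite <- (pow2_abs x). simpl. rewrite Rmult_1_r.
      apply Rmult_le_compat_l; [apply Rabs_pos|exact Hx]. }
    nra. }
  assert (Hr3' : 2 * K * M * N <= eps).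
  { assert (E : r3 * (2 * K * M + 1) = eps) by (unfold r3; field; lra).
    assert (N * (2 * K * M) <= r3 * (2 * K * M)) by mono_r. lra. }
  assert (HKy : 0 <= K * y ^ 2 <= eps * Rabs x + eps / 2 * N ^ 2).
  { split; [apply Rmult_le_pos; [lra|apply pow2_ge_0]|].
    assert (B1 : K * y ^ 2 <= K * (2 * (Rabs x * (M * N)) + 2 * (e2 * e2) * N ^ 2))
      by (apply Rmult_le_compat_l; assumption).
    assert (B2 : 2 * K * M * N * Rabs x <= eps * Rabs x)
      by (apply Rmult_le_compat_r; [apply Rabs_pos|exact Hr3']).
    assert (B3 : 2 * K * (e2 * e2) * N ^ 2 <= eps / 2 * N ^ 2)
      by (apply Rmult_le_compat_r; [apply pow2_ge_0|exact He2K]).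
    lra. }
  apply Rabs_le_between in Ht. apply Rabs_le. lra.
Qed.

(** Convexity makes the local estimate global. The factor [s] shrinks every chord from [p'] into the
    region of the Taylor expansion, which is possible since the domain is bounded; the shrunken
    chord ends in the closure, where [rho <= 0]. Linearity of [D p'] carries the bound back to
    [z]. *)
Lemma support_inequality (p : Cn n) (K c : R) : boundary Om p -> 0 <= K -> 0 < c ->
  (forall v, c * vnorm v ^ 2 <= / 2 * D2 p v v + K * D p v ^ 2) ->
  (exists M, forall z, Om z -> vnorm z <= M) ->
  exists c' r, 0 < c' /\ 0 < r /\ forall p' z, boundary Om p' -> vnorm (vsub p' p) < r -> Om z ->
    c' * vnorm (vsub z p') ^ 2 <= - D p' (vsub z p').
Proof.
  intros Hp HK Hc HB [M HM].
  set (e := Rmin 1 (c / 2)).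
  assert (He : 0 < e) by (apply Rmin_glb_lt; lra).
  assert (He1 : e <= 1) by apply Rmin_l. assert (Hec : e <= c / 2) by apply Rmin_r.
  destruct (boundary_taylor p K Hp HK e He) as [r [Hr HT]].
  set (M' := Rabs M + vnorm p + r).
  pose proof (vnorm_nonneg p) as Hnp. pose proof (Rabs_pos M) as HMa.
  set (s := r / (r + 2 * (M' + 1))).
  assert (HM'0 : 0 <= M') by (unfold M'; lra).
  assert (Hs : 0 < s) by div_pos.
  assert (Es : s * (r + 2 * (M' + 1)) = r) by (unfold s; field; lra).
  assert (Hs1 : s <= 1) by nra.
  exists (c / 4 * s), r. split; [nra|]. split; [exact Hr|].
  intros p' z Hp' Hpp Hz. set (v := vsub z p').
  assert (Hv : vnorm v <= M').
  { unfold v. replace (vsub z p') with (vadd z (vscale (-1) (vadd p (vsub p' p)))) by vec.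
    eapply Rle_trans; [apply vnorm_triangle|]. rewrite vnorm_vscale, Rabs_left by lra.
    pose proof (vnorm_triangle p (vsub p' p)). pose proof (HM z Hz). pose proof (Rle_abs M).
    unfold M'. lra. }
  pose proof (vnorm_nonneg v) as Hv0.
  destruct (HT p' (vscale s v) Hp' Hpp) as [_ Ht].
  { rewrite vnorm_vscale, Rabs_pos_eq by lra. nra. }
  assert (Hle : rho (vadd p' (vscale s v)) <= 0).
  { apply closure_rho. apply (closure_segment p' z s); [apply Hp'|exact Hz|lra]. }
  pose proof (HB (vscale s v)) as HBv.
  assert (HDl : real_linear (D p')) by (apply (D_linear U rho D D2 HC2), Hcl, Hp').
  rewrite (proj2 HDl) in Ht. rewrite vnorm_vscale, (Rabs_pos_eq s) in Ht, HBv by lra.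
  apply Rabs_le_between in Ht.
  set (B := / 2 * D2 p (vscale s v) (vscale s v) + K * D p (vscale s v) ^ 2) in *.
  set (x := D p' v) in *. set (N := (s * vnorm v) ^ 2) in *.
  assert (HN : 0 <= N) by apply pow2_ge_0.
  pose proof (Rabs_pos (s * x)).
  assert (H1 : c / 2 * N <= Rabs (s * x) - s * x) by nra.
  assert (H2 : c / 4 * N <= - (s * x)).
  { destruct (Rle_or_lt 0 (s * x)) as [Hx|Hx].
    - rewrite Rabs_pos_eq in H1 by exact Hx. assert (HN0 : N = 0) by nra.
      assert (Hvz : vnorm v = 0).
      { assert (Hsv : s * vnorm v = 0) by (apply Rsqr_0_uniq; rewrite Rsqr_pow2; exact HN0).
        apply Rmult_integral in Hsv. destruct Hsv; lra. }
      apply vnorm_zero_eq in Hvz. unfold x. rewrite Hvz, (real_linear_vzero _ HDl). lra.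
    - rewrite Rabs_left in H1 by exact Hx. lra. }
  apply Rmult_le_reg_l with s; [exact Hs|]. unfold N in H2. nra.
Qed.

Lemma local_model_exists (p : Cn n) : boundary Om p ->
  (exists M, forall z, Om z -> vnorm z <= M) ->
  exists l h A nu K c r0, local_model Om p l h A nu K c r0.
Proof.
  intros Hp Hbd. pose proof (Hcl p (proj1 Hp)) as HUp.
  pose proof (D_linear U rho D D2 HC2) as HDl.
  pose proof (D2_linear_l U rho D D2 HU HC2) as Hl1.
  pose proof (D2_linear_r U rho D D2 HC2) as Hl2.
  (* The factor 1/4 symmetrises and halves at once, so that [S v v] is the second-order Taylor
     term. *)
  set (S := fun u v => / 4 * (D2 p u v + D2 p v u)).
  assert (HS : sbil S).
  { split.
    - intros y. destruct (Hl1 p y HUp) as [A1 A2], (Hl2 p y HUp) as [B1 B2].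
      unfold S. split; intros; rewrite ?A1, ?A2, ?B1, ?B2; ring.
    - intros x y. unfold S. ring. }
  assert (HSd : forall v, S v v = / 2 * D2 p v v) by (intros v; unfold S; field).
  destruct (Hgrad p Hp) as [g0 Hg0]. set (g := vscale (/ D p g0) g0).
  assert (Hg : D p g = 1) by (unfold g; rewrite (proj2 (HDl p HUp)); field; exact Hg0).
  destruct (posdef_on_kernel S (D p) g HS (HDl p HUp) Hg) as [K0 [c0 [HK0 [Hc0 Hpd]]]].
  { intros v Hv Hv0. rewrite HSd. pose proof (Hsc p Hp v Hv Hv0). lra. }
  set (B := fun u v => S u v + K0 * (D p u * D p v)).
  assert (HBs : sbil B).
  { split.
    - intros y. destruct (HDl p HUp) as [A1 A2]. unfold B.
      split; intros; rewrite ?(sbil_add_l S HS), ?(sbil_scale_l S HS), ?A1, ?A2; ring.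
    - intros x y. unfold B. rewrite (proj2 HS x y). ring. }
  assert (HBd : forall v, B v v = / 2 * D2 p v v + K0 * D p v ^ 2)
    by (intros v; unfold B; rewrite HSd; ring).
  destruct (sbil_complex_parts B c0 HBs) as
    [h [A [K1 [HK1 [Hh [HA [HAs [HBA [Hhl [Hhu HAu]]]]]]]]]].
  { intros v. rewrite HBd, <- HSd. apply Hpd. }
  set (l := fun p' => cplx (fun v => - D p' v)).
  assert (Hlc : forall p', U p' -> clinear (l p'))
    by (intros p' Hp'; apply cplx_clinear, real_linear_opp, HDl, Hp').
  assert (Hhp : forall v, v <> vzero -> 0 < fst (h v v)).
  { intros v Hv. pose proof (Hhl v). pose proof (vnorm_pos v Hv).
    assert (0 < vnorm v ^ 2) by now apply pow_lt. nra. }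
  destruct (herm_riesz h (l p) Hh Hhp (Hlc p HUp)) as [nu Hnu].
  assert (Hnu0 : nu <> vzero).
  { intros E. pose proof (Hnu g) as F. rewrite E, (proj2 Hh vzero g) in F.
    rewrite (clinear_vzero _ (proj1 Hh g)) in F. apply (f_equal fst) in F.
    unfold l, cplx in F; simpl in F. lra. }
  destruct (support_inequality p K0 c0 Hp HK0 Hc0) as [c1 [r1 [Hc1 [Hr1 Hsup]]]].
  { intros v. rewrite <- HSd. apply Hpd. }
  { exact Hbd. }
  destruct (D_continuous U rho D D2 HU HC2 p HUp 1 Rlt_0_1) as [r2 [Hr2 HD1]].
  set (M := opn (D p) + 1). pose proof (opn_nonneg (D p)) as HM.
  assert (Hcc : Rmin c0 c1 <= c0) by apply Rmin_l.
  assert (Hcc' : Rmin c0 c1 <= c1) by apply Rmin_r.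
  (* [M] bounds [D p'] for [p'] within [r2] of p, and complexifying at most doubles that bound. *)
  exists l, h, A, nu, (K1 + 2 * M), (Rmin c0 c1), (Rmin r1 r2).
  split.
  - unfold M; lra.
  - now apply Rmin_glb_lt.
  - now apply Rmin_glb_lt.
  - exact Hh.
  - intros v. eapply Rle_trans; [|apply Hhl]. apply Rmult_le_compat_r; [apply pow2_ge_0|exact Hcc].
  - intros v. eapply Rle_trans; [apply Hhu|]. apply Rmult_le_compat_r; [apply pow2_ge_0|unfold M; lra].
  - exact HA.
  - exact HAs.
  - intros u v. eapply Rle_trans; [apply HAu|]. rewrite !Rmult_assoc.
    apply Rmult_le_compat_r; [apply Rmult_le_pos; apply vnorm_nonneg|unfold M; lra].
  - intros p' Hp' _. apply Hlc, Hcl, Hp'.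
  - intros p' Hp' Hpp v. pose proof (Rmin_r r1 r2).
    eapply Rle_trans; [apply (cplx_bound _ M)|].
    + intros w. rewrite Rabs_Ropp. specialize (HD1 p' ltac:(lra) w).
      pose proof (real_linear_bound (D p) w (HDl p HUp)) as Hb.
      replace (D p' w) with ((D p' w - D p w) + D p w) by ring.
      eapply Rle_trans; [apply Rabs_triang|]. unfold M. lra.
    + apply Rmult_le_compat_r; [apply vnorm_nonneg|lra].
  - intros p' Hp' Hpp z Hz. pose proof (Rmin_l r1 r2). unfold l, cplx; simpl fst.
    eapply Rle_trans; [|apply (Hsup p' z Hp' ltac:(lra) Hz)].
    apply Rmult_le_compat_r; [apply pow2_ge_0|exact Hcc'].
  - exact Hnu.
  - exact Hnu0.
  - intros eps He. destruct (D_continuous U rho D D2 HU HC2 p HUp (eps / 2)) as [r [Hr H]]; [lra|].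
    exists r. split; [exact Hr|]. intros p' _ Hpp v. specialize (H p' Hpp).
    replace (Cminus (l p' v) (l p v)) with (cplx (fun v => D p v - D p' v) v)
      by (unfold l, cplx; cpair).
    replace (eps * vnorm v) with (2 * (eps / 2) * vnorm v) by field. apply cplx_bound.
    intros w. rewrite Rabs_minus_sym. apply H.
  - intros eps He. destruct (boundary_taylor p K0 Hp HK0 eps He) as [r [Hr H]].
    exists r. split; [exact Hr|]. intros p' v Hp' Hpp Hv.
    destruct (H p' v Hp' Hpp Hv) as [HUv Ht]. rewrite <- HBd, HBA in Ht.
    unfold l, cplx; simpl fst. rewrite Rabs_Ropp. apply Rabs_le_between in Ht. split.
    + intros HOm. apply Hdef in HOm. lra.
    + intros Hlt. apply Hdef. split; [exact HUv|]. lra.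
  - intros r Hr. apply exit_point; [exact Hp| |exact Hr].
    pose proof (Hhp nu Hnu0) as F. rewrite <- Hnu in F. unfold l, cplx in F; simpl in F. lra.
Qed.

End Domain.

(** * Holomorphic functions and contractions *)

Lemma clinear_bound {n : nat} (l : Cn n -> C) : clinear l ->
  exists K, 0 < K /\ forall v, Cmod (l v) <= K * vnorm v.
Proof.
  intros [H1 H2].
  assert (Hr : real_linear (fun v => fst (l v))).
  { split; intros; rewrite ?vscale_cscale, ?H1, ?H2; simpl; ring. }
  assert (Hi : real_linear (fun v => snd (l v))).
  { split; intros; rewrite ?vscale_cscale, ?H1, ?H2; simpl; ring. }
  exists (opn (fun v => fst (l v)) + opn (fun v => snd (l v)) + 1).
  pose proof (opn_nonneg (fun v => fst (l v))). pose proof (opn_nonneg (fun v => snd (l v))).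
  split; [lra|]. intros v.
  pose proof (real_linear_bound _ v Hr) as Br. pose proof (real_linear_bound _ v Hi) as Bi.
  simpl in Br, Bi. pose proof (Cmod_le_sum (fst (l v)) (snd (l v))) as Hs.
  rewrite <- surjective_pairing in Hs. pose proof (vnorm_nonneg v). lra.
Qed.

(** Complex differentiability of a scalar function. The map is assembled from affine and quadratic
    functions by sums, products and inverses, so the closure rules below suffice; vector values are
    treated componentwise at the end. *)
Definition chol {n : nat} (g : Cn n -> C) (z : Cn n) : Prop :=
  exists l, clinear l /\ forall eps, 0 < eps -> exists d, 0 < d /\
    forall v, vnorm v < d ->
      Cmod (Cminus (Cminus (g (vadd z v)) (g z)) (l v)) <= eps * vnorm v.

Lemma chol_const {n : nat} (c : C) (z : Cn n) : chol (fun _ => c) z.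
Proof.
  exists (fun _ => RtoC 0). split.
  - split; intros; ring.
  - intros eps He. exists 1. split; [lra|]. intros v _.
    replace (Cminus (Cminus c c) (RtoC 0)) with (RtoC 0) by ring. rewrite Cmod_0.
    pose proof (vnorm_nonneg v). nra.
Qed.

Lemma chol_affine {n : nat} (l : Cn n -> C) (p z : Cn n) :
  clinear l -> chol (fun v => l (vsub v p)) z.
Proof.
  intros Hl. exists l. split; [exact Hl|]. intros eps He. exists 1. split; [lra|]. intros v _.
  rewrite !(clinear_vsub l) by exact Hl. rewrite (proj1 Hl).
  replace (Cminus (Cminus (Cminus (Cplus (l z) (l v)) (l p)) (Cminus (l z) (l p))) (l v))
    with (RtoC 0) by ring.
  rewrite Cmod_0. pose proof (vnorm_nonneg v). nra.
Qed.

Lemma chol_plus {n : nat} (f g : Cn n -> C) (z : Cn n) :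
  chol f z -> chol g z -> chol (fun v => Cplus (f v) (g v)) z.
Proof.
  intros [l [Hl H]] [m [Hm H']]. exists (fun v => Cplus (l v) (m v)). split.
  - split; intros; rewrite ?(proj1 Hl), ?(proj1 Hm), ?(proj2 Hl), ?(proj2 Hm); ring.
  - intros eps He. destruct (H (eps / 2)) as [d [Hd K]]; [lra|].
    destruct (H' (eps / 2)) as [d' [Hd' K']]; [lra|].
    exists (Rmin d d'). split; [now apply Rmin_glb_lt|]. intros v Hv.
    pose proof (Rmin_l d d'). pose proof (Rmin_r d d').
    specialize (K v ltac:(lra)). specialize (K' v ltac:(lra)).
    match goal with |- Cmod ?X <= _ => replace X with
      (Cplus (Cminus (Cminus (f (vadd z v)) (f z)) (l v))
             (Cminus (Cminus (g (vadd z v)) (g z)) (m v))) by ring end.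
    eapply Rle_trans; [apply Cmod_triangle|]. lra.
Qed.

Lemma chol_continuous {n : nat} (g : Cn n -> C) (z : Cn n) : chol g z ->
  forall eps, 0 < eps -> exists d, 0 < d /\ forall v, vnorm v < d ->
    Cmod (Cminus (g (vadd z v)) (g z)) <= eps.
Proof.
  intros [l [Hl H]] eps He. destruct (H 1 Rlt_0_1) as [d [Hd K]].
  destruct (clinear_bound l Hl) as [M [HM HMv]].
  assert (Hq : 0 < eps / (1 + M)) by div_pos.
  exists (Rmin d (eps / (1 + M))). split; [now apply Rmin_glb_lt|]. intros v Hv.
  pose proof (Rmin_l d (eps / (1 + M))). pose proof (Rmin_r d (eps / (1 + M))).
  specialize (K v ltac:(lra)). specialize (HMv v).
  replace (Cminus (g (vadd z v)) (g z)) with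
    (Cplus (Cminus (Cminus (g (vadd z v)) (g z)) (l v)) (l v)) by ring.
  eapply Rle_trans; [apply Cmod_triangle|].
  assert (eps / (1 + M) * (1 + M) = eps) by (field; lra). pose proof (vnorm_nonneg v). nra.
Qed.

Lemma chol_mult {n : nat} (f g : Cn n -> C) (z : Cn n) :
  chol f z -> chol g z -> chol (fun v => Cmult (f v) (g v)) z.
Proof.
  intros Hf [m [Hm H']]. pose proof (chol_continuous f z Hf) as Hfc. destruct Hf as [l [Hl H]].
  exists (fun v => Cplus (Cmult (f z) (m v)) (Cmult (g z) (l v))). split.
  - split; intros; rewrite ?(proj1 Hl), ?(proj1 Hm), ?(proj2 Hl), ?(proj2 Hm); ring.
  - intros eps He. destruct (clinear_bound m Hm) as [M [HM HMv]].
    set (a := Cmod (f z)). set (b := Cmod (g z)).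
    assert (Ha : 0 <= a) by apply Cmod_ge_0. assert (Hb : 0 <= b) by apply Cmod_ge_0.
    destruct (H' (eps / (3 * (a + 1)))) as [d1 [Hd1 K1]]; [div_pos|].
    destruct (H (eps / (3 * (b + 1)))) as [d2 [Hd2 K2]]; [div_pos|].
    destruct (Hfc (Rmin 1 (eps / (3 * M)))) as [d3 [Hd3 K3]];
      [apply Rmin_glb_lt; [lra|div_pos]|].
    exists (Rmin (Rmin d1 d2) d3). split; [repeat apply Rmin_glb_lt; assumption|]. intros v Hv.
    pose proof (Rmin_l (Rmin d1 d2) d3). pose proof (Rmin_r (Rmin d1 d2) d3).
    pose proof (Rmin_l d1 d2). pose proof (Rmin_r d1 d2).
    specialize (K1 v ltac:(lra)). specialize (K2 v ltac:(lra)). specialize (K3 v ltac:(lra)).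
    specialize (HMv v). pose proof (vnorm_nonneg v) as Hn.
    pose proof (Rmin_l 1 (eps / (3 * M))). pose proof (Rmin_r 1 (eps / (3 * M))).
    set (f1 := f (vadd z v)) in *. set (g1 := g (vadd z v)) in *.
    set (rf := Cminus (Cminus f1 (f z)) (l v)) in *. set (rg := Cminus (Cminus g1 (g z)) (m v)) in *.
    match goal with |- Cmod ?X <= _ => replace X with
      (Cplus (Cplus (Cmult f1 rg) (Cmult (Cminus f1 (f z)) (m v))) (Cmult (g z) rf))
      by (unfold rf, rg; ring) end.
    assert (Hf1 : Cmod f1 <= a + 1).
    { replace f1 with (Cplus (f z) (Cminus f1 (f z))) by ring.
      eapply Rle_trans; [apply Cmod_triangle|]. fold a. lra. }
    eapply Rle_trans; [apply Cmod_triangle|].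
    eapply Rle_trans; [apply Rplus_le_compat_r, Cmod_triangle|]. rewrite !Cmod_mult. fold b.
    assert (A1 : Cmod f1 * Cmod rg <= (a + 1) * (eps / (3 * (a + 1)) * vnorm v))
      by (apply Rmult_le_compat; auto using Cmod_ge_0).
    assert (A2 : Cmod (Cminus f1 (f z)) * Cmod (m v) <= eps / (3 * M) * (M * vnorm v))
      by (apply Rmult_le_compat; auto using Cmod_ge_0; lra).
    assert (A3 : b * Cmod rf <= (b + 1) * (eps / (3 * (b + 1)) * vnorm v))
      by (apply Rmult_le_compat; auto using Cmod_ge_0; lra).
    replace ((a + 1) * (eps / (3 * (a + 1)) * vnorm v)) with (eps / 3 * vnorm v) in A1 by (field; lra).
    replace (eps / (3 * M) * (M * vnorm v)) with (eps / 3 * vnorm v) in A2 by (field; lra).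
    replace ((b + 1) * (eps / (3 * (b + 1)) * vnorm v)) with (eps / 3 * vnorm v) in A3 by (field; lra).
    lra.
Qed.

Lemma Cmod_minus_ge (x y : C) : Cmod x - Cmod y <= Cmod (Cplus x y).
Proof.
  pose proof (Cmod_triangle (Cplus x y) (Copp y)) as H. rewrite Cmod_opp in H.
  replace (Cplus (Cplus x y) (Copp y)) with x in H by ring. lra.
Qed.

Lemma chol_inv {n : nat} (g : Cn n -> C) (z : Cn n) :
  chol g z -> g z <> RtoC 0 -> chol (fun v => Cinv (g v)) z.
Proof.
  intros Hg Hz. pose proof (chol_continuous g z Hg) as Hgc. destruct Hg as [l [Hl H]].
  exists (fun v => Copp (Cmult (Cinv (Cmult (g z) (g z))) (l v))). split.
  - split; intros; rewrite ?(proj1 Hl), ?(proj2 Hl); ring.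
  - intros eps He. destruct (clinear_bound l Hl) as [M [HM HMv]].
    set (a := Cmod (g z)). assert (Ha : 0 < a) by now apply Cmod_gt_0.
    set (e1 := eps * (a * a) / 4). assert (He1 : 0 < e1)
      by (unfold e1; assert (0 < eps * (a * a)) by (repeat apply Rmult_lt_0_compat; lra); lra).
    set (e2 := eps * (a * a * a) / (4 * M)).
    assert (He2 : 0 < e2) by (unfold e2; apply Rdiv_lt_0_compat; [|lra]; repeat apply Rmult_lt_0_compat; lra).
    destruct (H e1 He1) as [d1 [Hd1 K1]].
    destruct (Hgc (Rmin (a / 2) e2)) as [d2 [Hd2 K2]]; [apply Rmin_glb_lt; lra|].
    exists (Rmin d1 d2). split; [now apply Rmin_glb_lt|]. intros v Hv.
    pose proof (Rmin_l d1 d2). pose proof (Rmin_r d1 d2).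
    specialize (K1 v ltac:(lra)). specialize (K2 v ltac:(lra)).
    pose proof (Rmin_l (a / 2) e2). pose proof (Rmin_r (a / 2) e2).
    specialize (HMv v). pose proof (vnorm_nonneg v) as Hn.
    set (g1 := g (vadd z v)) in *. set (r := Cminus (Cminus g1 (g z)) (l v)) in *.
    assert (Hg1 : a / 2 <= Cmod g1).
    { replace g1 with (Cplus (g z) (Cminus g1 (g z))) by ring.
      eapply Rle_trans; [|apply Cmod_minus_ge]. fold a. lra. }
    assert (Hg10 : g1 <> RtoC 0) by (apply Cmod_gt_0; lra).
    match goal with |- Cmod ?X <= _ => replace X with
      (Cdiv (Cplus (Copp (Cmult (g z) r)) (Cmult (Cminus g1 (g z)) (l v)))
         (Cmult (Cmult (g z) (g z)) g1)) by (unfold r; field; auto) end.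
    rewrite Cmod_div.
    2:{ apply Cmult_neq_0; [now apply Cmult_neq_0|exact Hg10]. }
    rewrite !Cmod_mult. fold a.
    assert (Hden : 0 < a * a * Cmod g1) by (repeat apply Rmult_lt_0_compat; lra).
    apply Rmult_le_reg_r with (a * a * Cmod g1); [exact Hden|].
    unfold Rdiv. rewrite Rmult_assoc, Rinv_l, Rmult_1_r by lra.
    eapply Rle_trans; [apply Cmod_triangle|]. rewrite Cmod_opp, !Cmod_mult. fold a.
    assert (A1 : a * Cmod r <= a * (e1 * vnorm v)) by mono_l.
    assert (A2 : Cmod (Cminus g1 (g z)) * Cmod (l v) <= e2 * (M * vnorm v))
      by (apply Rmult_le_compat; auto using Cmod_ge_0; lra).
    replace (e2 * (M * vnorm v)) with (eps * (a * a * a) / 4 * vnorm v) in A2 by (unfold e2; field; lra).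
    assert (A3 : eps * vnorm v * (a * a) * (a / 2) <= eps * vnorm v * (a * a) * Cmod g1)
      by (apply Rmult_le_compat_l; [mpos; lra|exact Hg1]).
    unfold e1 in A1. lra.
Qed.

Lemma chol_csumn {n : nat} (m : nat) (F : nat -> Cn n -> C) (z : Cn n) :
  (forall j, chol (F j) z) -> chol (fun v => csumn m (fun j => F j v)) z.
Proof.
  intros H. induction m as [|m IH]; simpl; [apply chol_const|]. now apply chol_plus.
Qed.

Lemma clinear_matrix {n : nat} (l : Cn n -> C) (h : Cn n) : clinear l ->
  l h = csum n (fun k => cmul (l (bas (proj1_sig k))) (h k)).
Proof.
  intros Hl. rewrite <- (trunc_all h) at 1. unfold csum, isum.
  assert (G : forall m, (m <= n)%nat -> l (trunc m h) =
    (nsum m (fun j => match lt_dec j n with left a =>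
        fst (cmul (l (bas j)) (h (exist _ j a))) | right _ => 0 end),
     nsum m (fun j => match lt_dec j n with left a =>
        snd (cmul (l (bas j)) (h (exist _ j a))) | right _ => 0 end))).
  { induction m as [|m IH]; intros Hm.
    - rewrite trunc_0. now apply clinear_vzero.
    - rewrite trunc_S, (proj1 Hl), (proj2 Hl), IH by lia. simpl. unfold co.
      destruct (lt_dec m n) as [a|a]; [|lia].
      cpair. }
  apply (G n (le_n n)).
Qed.

Lemma holo_at_of_components {n : nat} (f : Cn n -> Cn n) (z : Cn n) :
  (forall j, chol (fun v => f v j) z) -> holo_at f z.
Proof.
  intros H.
  set (l := fun j => proj1_sig (constructive_indefinite_description _ (H j))).
  assert (Hl : forall j, clinear (l j) /\ forall eps, 0 < eps -> exists d, 0 < d /\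
    forall v, vnorm v < d ->
      Cmod (Cminus (Cminus (f (vadd z v) j) (f z j)) (l j v)) <= eps * vnorm v).
  { intros j. unfold l. now destruct (constructive_indefinite_description _ (H j)). }
  exists (fun j k => l j (bas (proj1_sig k))). intros eps He.
  pose proof (pos_INR n) as Hn.
  set (e := eps / (INR n + 1)). assert (He' : 0 < e) by div_pos.
  assert (Hm : forall m, exists d, 0 < d /\ forall j : idx n, (proj1_sig j < m)%nat ->
    forall v, vnorm v < d ->
      Cmod (Cminus (Cminus (f (vadd z v) j) (f z j)) (l j v)) <= e * vnorm v).
  { induction m as [|m [d [Hd IH]]].
    - exists 1. split; [lra|]. intros j Hj. lia.
    - destruct (lt_dec m n) as [a|a].
      + destruct (proj2 (Hl (exist _ m a)) e He') as [d' [Hd' K]].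
        exists (Rmin d d'). split; [now apply Rmin_glb_lt|]. intros j Hj v Hv.
        pose proof (Rmin_l d d'). pose proof (Rmin_r d d').
        destruct (Nat.eq_dec (proj1_sig j) m) as [E|E].
        * destruct j as [j Hjn]. simpl in E. subst j. rewrite (le_unique _ _ Hjn a).
          apply K. lra.
        * apply IH; [lia|lra].
      + exists d. split; [exact Hd|]. intros j Hj. apply IH. pose proof (proj2_sig j). simpl in H0. lia. }
  destruct (Hm n) as [d [Hd K]]. exists d. split; [exact Hd|]. intros h Hh.
  pose proof (vnorm_nonneg h).
  eapply Rle_trans; [apply (vnorm_le_comp _ (e * vnorm h))|].
  - nra.
  - intros j. specialize (K j (proj2_sig j) h Hh).
    unfold mapply. replace (vsub (vsub (f (vadd z h)) (f z))
      (fun j => csum n (fun k => cmul (l j (bas (proj1_sig k))) (h k))) j)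
      with (Cminus (Cminus (f (vadd z h) j) (f z j)) (l j h)); [exact K|].
    rewrite (clinear_matrix (l j) h (proj1 (Hl j))). reflexivity.
  - assert (E : e * (INR n + 1) = eps) by (unfold e; field; lra).
    assert (0 <= e * vnorm h) by nra. nra.
Qed.

Lemma Cmod_small_eq (x y : C) (k : R) : 0 <= k ->
  (forall e, 0 < e -> Cmod (Cminus x y) <= e * k) -> x = y.
Proof.
  intros Hk H. assert (E : Cmod (Cminus x y) <= 0) by now apply le_of_small_linears with k.
  pose proof (Cmod_ge_0 (Cminus x y)).
  assert (E0 : Cminus x y = RtoC 0) by (apply Cmod_eq_0; lra).
  replace x with (Cplus (Cminus x y) y) by ring. rewrite E0. ring.
Qed.

(** Banach iteration started at the centre, which stays in the disc; the limit is taken separately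
    in the real and imaginary parts. *)
Lemma disc_contraction (g : C -> C) (r : R) : 0 <= r ->
  (forall w, Cmod w <= r -> Cmod (g w) <= r) ->
  (forall w w', Cmod w <= r -> Cmod w' <= r ->
     Cmod (Cminus (g w) (g w')) <= / 2 * Cmod (Cminus w w')) ->
  exists w, Cmod w <= r /\ g w = w.
Proof.
  intros Hr Hg Hlip.
  set (x := fun k => Nat.iter k g (RtoC 0)).
  assert (Hx : forall k, Cmod (x k) <= r).
  { induction k as [|k IH]; [simpl; rewrite Cmod_0; lra|]. apply Hg, IH. }
  assert (Hq : forall k, 0 < (/ 2) ^ k) by (intros k; apply pow_lt; lra).
  assert (Hc : forall k m, Cmod (Cminus (x (k + m)%nat) (x k)) <= 2 * r * (/ 2) ^ k).
  { induction k as [|k IH]; intros m.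
    - simpl. replace (Cminus (x m) (RtoC 0)) with (x m) by ring. pose proof (Hx m). lra.
    - simpl. eapply Rle_trans; [apply Hlip; apply Hx|]. specialize (IH m). simpl in IH |- *. lra. }
  assert (Hsmall : forall e, 0 < e -> exists k, 2 * r * (/ 2) ^ k < e).
  { intros e He. destruct (pow_lt_1_zero (/ 2)) with (y := e / (2 * r + 1)) as [k Hk].
    - rewrite Rabs_pos_eq; lra.
    - div_pos.
    - exists k. specialize (Hk k (le_n k)). rewrite Rabs_pos_eq in Hk by (left; apply Hq).
      assert (e / (2 * r + 1) * (2 * r + 1) = e) by (field; lra). pose proof (Hq k). nra. }
  assert (HC : forall e, 0 < e -> exists k, forall i, (i >= k)%nat -> Cmod (Cminus (x i) (x k)) < e).
  { intros e He. destruct (Hsmall e He) as [k Hk]. exists k. intros i Hi.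
    replace i with (k + (i - k))%nat by lia. eapply Rle_lt_trans; [apply Hc|exact Hk]. }
  assert (Hcau : forall (pr : C -> R), (forall u v, pr (Cminus u v) = pr u - pr v) ->
    (forall u, Rabs (pr u) <= Cmod u) -> Cauchy_crit (fun k => pr (x k))).
  { intros pr Hp1 Hp2 e He. destruct (HC (e / 2)) as [k Hk]; [lra|]. exists k. intros i j Hi Hj.
    unfold Rdist. replace (pr (x i) - pr (x j)) with
      (pr (Cminus (x i) (x k)) - pr (Cminus (x j) (x k))) by (rewrite !Hp1; ring).
    pose proof (Hk i Hi). pose proof (Hk j Hj).
    pose proof (Hp2 (Cminus (x i) (x k))). pose proof (Hp2 (Cminus (x j) (x k))).
    eapply Rle_lt_trans; [apply Rabs_triang|]. rewrite Rabs_Ropp. lra. }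
  destruct (Rcomplete.R_complete _ (Hcau fst (fun _ _ => eq_refl)
    (fun u => Rle_trans _ _ _ (Rmax_l _ _) (Rmax_Cmod u)))) as [a Ha].
  destruct (Rcomplete.R_complete _ (Hcau snd (fun _ _ => eq_refl)
    (fun u => Rle_trans _ _ _ (Rmax_r _ _) (Rmax_Cmod u)))) as [b Hb].
  set (w := (a, b) : C).
  assert (Hlim : forall e, 0 < e -> exists k, forall i, (i >= k)%nat -> Cmod (Cminus (x i) w) < e).
  { intros e He. destruct (Ha (e / 2)) as [k1 K1]; [lra|]. destruct (Hb (e / 2)) as [k2 K2]; [lra|].
    exists (max k1 k2). intros i Hi. specialize (K1 i ltac:(lia)). specialize (K2 i ltac:(lia)).
    unfold Rdist in K1, K2.
    replace (Cminus (x i) w) with (fst (x i) - a, snd (x i) - b) by reflexivity.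
    eapply Rle_lt_trans; [apply Cmod_le_sum|]. lra. }
  assert (Hw : Cmod w <= r).
  { apply Rnot_lt_le. intros Hlt. destruct (Hlim (Cmod w - r)) as [k Hk]; [lra|].
    specialize (Hk k (le_n k)). pose proof (Hx k).
    pose proof (Cmod_minus_ge w (Cminus (x k) w)) as E.
    replace (Cplus w (Cminus (x k) w)) with (x k) in E by ring. lra. }
  exists w. split; [exact Hw|]. apply (Cmod_small_eq _ _ 2); [lra|]. intros e He.
  destruct (Hlim e He) as [k Hk]. pose proof (Hk k (le_n k)) as E1.
  pose proof (Hk (S k) ltac:(lia)) as E2.
  replace (Cminus (g w) w) with (Cplus (Copp (Cminus (g (x k)) (g w))) (Cminus (x (S k)) w))
    by (simpl; ring).
  eapply Rle_trans; [apply Cmod_triangle|]. rewrite Cmod_opp.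
  pose proof (Hlip (x k) w (Hx k) Hw). lra.
Qed.

Lemma Cmod_sq (z : C) : Cmod z ^ 2 = fst z ^ 2 + snd z ^ 2.
Proof. apply Cmod2_alt. Qed.

Lemma fst_le_Cmod (z : C) : Rabs (fst z) <= Cmod z.
Proof. apply re_le_Cmod. Qed.

Lemma snd_le_Cmod (z : C) : Rabs (snd z) <= Cmod z.
Proof. eapply Rle_trans; [apply Rmax_r|apply Rmax_Cmod]. Qed.

Lemma fst_scal (r : R) (z : C) : fst (Cmult (RtoC r) z) = r * fst z.
Proof. simpl. ring. Qed.

Lemma snd_scal (r : R) (z : C) : snd (Cmult (RtoC r) z) = r * snd z.
Proof. simpl. ring. Qed.

Lemma Cmod_csumn (m : nat) (F : nat -> C) : Cmod (csumn m F) <= nsum m (fun j => Cmod (F j)).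
Proof.
  induction m as [|m IH]; simpl; [rewrite Cmod_0; lra|].
  eapply Rle_trans; [apply Cmod_triangle|]. lra.
Qed.

Lemma snd_csumn (m : nat) (F : nat -> C) : snd (csumn m F) = nsum m (fun j => snd (F j)).
Proof. induction m as [|m IH]; simpl; [reflexivity|now rewrite IH]. Qed.

Lemma csumn_minus (m : nat) (F G : nat -> C) :
  Cminus (csumn m F) (csumn m G) = csumn m (fun j => Cminus (F j) (G j)).
Proof. induction m as [|m IH]; simpl; [ring|]. rewrite <- IH. ring. Qed.

(** * The logarithmic cut-off *)

(** The cut-off with one scale: 1 at the origin, small for large [|s|], holomorphic on the right
    half-plane since its only pole is at -1. *)
Definition rec1 (s : C) : C := Cinv (Cplus (RtoC 1) s).

Lemma one_plus_ge (s : C) : 0 <= fst s -> 1 + Cmod s ^ 2 <= Cmod (Cplus (RtoC 1) s) ^ 2.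
Proof. intros H. rewrite !Cmod_sq. simpl. nra. Qed.

Lemma one_plus_neq (s : C) : 0 <= fst s -> Cplus (RtoC 1) s <> RtoC 0.
Proof. intros H E. apply (f_equal fst) in E. simpl in E. lra. Qed.

Lemma rec1_re (s : C) : 0 <= fst s -> 0 <= fst (rec1 s) <= 1.
Proof.
  intros H. unfold rec1, Cinv; simpl.
  set (d := (1 + fst s) * ((1 + fst s) * 1) + (0 + snd s) * ((0 + snd s) * 1)).
  assert (Hd : 0 < d) by (unfold d; nra).
  split; [apply Rdiv_le_0_compat; lra|].
  apply Rmult_le_reg_r with d; [exact Hd|].
  replace ((1 + fst s) / d * d) with (1 + fst s) by (field; lra). unfold d. nra.
Qed.

Lemma rec1_im (s : C) : 0 <= fst s -> Rabs (snd (rec1 s)) <= Cmod s / (1 + Cmod s ^ 2).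
Proof.
  intros H. unfold rec1, Cinv; simpl snd.
  set (d := (fst (Cplus (RtoC 1) s)) ^ 2 + (snd (Cplus (RtoC 1) s)) ^ 2).
  assert (Hd : 1 + Cmod s ^ 2 <= d) by (unfold d; rewrite <- Cmod_sq; now apply one_plus_ge).
  pose proof (pow2_ge_0 (Cmod s)).
  simpl. replace (0 + snd s) with (snd s) by ring.
  replace (Rabs (- snd s / _)) with (Rabs (snd s) / d).
  - pose proof (snd_le_Cmod s). unfold Rdiv. apply Rmult_le_compat.
    + apply Rabs_pos.
    + left. apply Rinv_0_lt_compat. lra.
    + assumption.
    + apply Rinv_le_contravar; lra.
  - unfold Rdiv. rewrite Rabs_mult, Rabs_Ropp, Rabs_inv. f_equal. f_equal.
    rewrite Rabs_pos_eq; unfold d; simpl; [ring|]. nra.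
Qed.

Lemma rec1_mod (s : C) : 0 <= fst s -> Cmod (rec1 s) <= 1 /\ Cmod (rec1 s) * Cmod s <= 1.
Proof.
  intros H. unfold rec1. rewrite Cmod_inv by now apply one_plus_neq.
  pose proof (one_plus_ge s H) as G. set (d := Cmod (Cplus (RtoC 1) s)) in *.
  assert (Hd0 : 0 <= d) by apply Cmod_ge_0. pose proof (Cmod_ge_0 s).
  assert (1 <= d) by nra. assert (Cmod s <= d) by nra.
  split; apply Rmult_le_reg_r with d; try lra.
  - rewrite Rinv_l; lra.
  - replace (/ d * Cmod s * d) with (Cmod s) by (field; lra). lra.
Qed.

(** As [|s| <= |t|], both denominators have modulus at least [sqrt (1 + |s|^2)]. After
    multiplication by [|s|] the factor [|s| / (1 + |s|^2)] is the summand of the dyadic estimate. *)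
Lemma rec1_lip (s t : C) : 0 <= fst s -> 0 <= fst t -> Cmod s <= Cmod t ->
  Cmod (Cminus (rec1 s) (rec1 t)) <= Cmod (Cminus s t) / (1 + Cmod s ^ 2).
Proof.
  intros Hs Ht Hst. unfold rec1.
  replace (Cminus (Cinv (Cplus (RtoC 1) s)) (Cinv (Cplus (RtoC 1) t))) with
    (Cdiv (Copp (Cminus s t)) (Cmult (Cplus (RtoC 1) s) (Cplus (RtoC 1) t)))
    by (field; split; now apply one_plus_neq).
  rewrite Cmod_div by (apply Cmult_neq_0; now apply one_plus_neq).
  rewrite Cmod_opp, Cmod_mult. unfold Rdiv.
  apply Rmult_le_compat_l; [apply Cmod_ge_0|].
  pose proof (one_plus_ge s Hs) as G1. pose proof (one_plus_ge t Ht) as G2.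
  pose proof (Cmod_ge_0 s). pose proof (Cmod_ge_0 t).
  set (a := Cmod (Cplus (RtoC 1) s)) in *. set (b := Cmod (Cplus (RtoC 1) t)) in *.
  assert (0 <= a) by apply Cmod_ge_0. assert (0 <= b) by apply Cmod_ge_0.
  apply Rinv_le_contravar; [pose proof (pow2_ge_0 (Cmod s)); lra|].
  set (q := 1 + Cmod s ^ 2) in *. assert (Hq : 0 < q) by (unfold q; pose proof (pow2_ge_0 (Cmod s)); lra).
  assert (q <= b ^ 2) by (unfold q; nra).
  apply Rsqr_incr_0_var; [|nra]. unfold Rsqr.
  replace (a * b * (a * b)) with (a ^ 2 * b ^ 2) by ring. apply Rmult_le_compat; lra.
Qed.

Lemma nsum_S (m : nat) (f : nat -> R) : nsum (S m) f = nsum m f + f m.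
Proof. reflexivity. Qed.

(* [4 y/((1+2y)(1+y)) >= y/(1+y^2)], and the left-hand side telescopes along dyadic scales. *)
Lemma dyadic_sum (x : R) (m : nat) : 0 <= x ->
  nsum m (fun j => (2 ^ j * x) / (1 + (2 ^ j * x) ^ 2)) <= 4.
Proof.
  intros Hx.
  assert (G : nsum m (fun j => (2 ^ j * x) / (1 + (2 ^ j * x) ^ 2))
              <= 4 * ((2 ^ m * x) / (1 + 2 ^ m * x) - x / (1 + x))).
  { induction m as [|m IH].
    - simpl. replace (1 * x) with x by ring. lra.
    - rewrite nsum_S. set (y := 2 ^ m * x) in *.
      assert (Hy : 0 <= y) by (unfold y; apply Rmult_le_pos; [apply pow_le; lra|exact Hx]).
      replace (2 ^ S m * x) with (2 * y) by (unfold y; simpl; ring).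
      assert (y / (1 + y ^ 2) <= 4 * (2 * y / (1 + 2 * y) - y / (1 + y))); [|lra].
      replace (4 * (2 * y / (1 + 2 * y) - y / (1 + y))) with (y * (4 / ((1 + 2 * y) * (1 + y))))
        by (field; lra).
      unfold Rdiv at 1. apply Rmult_le_compat_l; [exact Hy|].
      apply Rmult_le_reg_r with (1 + y ^ 2); [nra|]. rewrite Rinv_l by nra.
      apply Rmult_le_reg_r with ((1 + 2 * y) * (1 + y)); [nra|].
      replace (4 / ((1 + 2 * y) * (1 + y)) * (1 + y ^ 2) * ((1 + 2 * y) * (1 + y)))
        with (4 * (1 + y ^ 2)) by (field; lra). pose proof (pow2_ge_0 (y - 1)). nra. }
  eapply Rle_trans; [exact G|]. set (y := 2 ^ m * x) in *.
  assert (Hy : 0 <= y) by (unfold y; apply Rmult_le_pos; [apply pow_le; lra|exact Hx]).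
  assert (y / (1 + y) <= 1).
  { apply Rmult_le_reg_r with (1 + y); [lra|]. replace (y / (1 + y) * (1 + y)) with y by (field; lra). lra. }
  assert (0 <= x / (1 + x)) by (apply Rdiv_le_0_compat; lra). lra.
Qed.

(** [co_lip] expresses slow variation on the logarithmic scale, anchored at the smaller of the two
    points. [co_local] is stated on a full disc about 0, left half included: the iteration that
    solves for a preimage does not know the sign of [Re w] beforehand. *)
Record cutoff (kap tau : R) (chi : C -> C) : Prop := {
  co_re : forall w, 0 <= fst w -> 0 <= fst (chi w) <= 1;
  co_im : forall w, 0 <= fst w -> Rabs (snd (chi w)) <= kap;
  co_mod : forall w, 0 <= fst w -> Cmod (chi w) <= 1;
  co_decay : forall w, 0 <= fst w -> Cmod (chi w) * Cmod w <= tau;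
  co_lip : forall w w', 0 <= fst w -> 0 <= fst w' -> Cmod w <= Cmod w' ->
    Cmod w * Cmod (Cminus (chi w) (chi w')) <= kap * Cmod (Cminus w w');
  co_zero : chi (RtoC 0) = RtoC 1;
  co_local : exists rad L, 0 < rad /\ 0 < L /\ forall w w', Cmod w <= rad -> Cmod w' <= rad ->
    Cmod (Cminus (chi w) (chi w')) <= L * Cmod (Cminus w w');
  co_chol : forall n (g : Cn n -> C) z, chol g z -> 0 <= fst (g z) -> chol (fun v => chi (g v)) z
}.

Arguments co_re {kap tau chi} _.
Arguments co_im {kap tau chi} _.
Arguments co_mod {kap tau chi} _.
Arguments co_decay {kap tau chi} _.
Arguments co_lip {kap tau chi} _.
Arguments co_zero {kap tau chi} _.
Arguments co_local {kap tau chi} _.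
Arguments co_chol {kap tau chi} _.

(* An average of [1/(1+w/tau_j)] over dyadic scales [tau_j = tau/2^j]: each point sees only
   boundedly many scales, so averaging over many of them makes the oscillation at any scale small. *)
Lemma cutoff_exists (kap tau : R) : 0 < kap -> 0 < tau -> exists chi, cutoff kap tau chi.
Proof.
  intros Hk Ht.
  (* 4 is the bound for the dyadic sums, so averaging over more than [4 / kap] scales leaves less
     than [kap]. *)
  destruct (INR_unbounded (4 / kap)) as [N HN].
  assert (HN1 : 0 < INR N) by (assert (0 < 4 / kap) by div_pos; lra).
  assert (HNk : 4 <= kap * INR N).
  { assert (4 / kap * kap = 4) by (field; lra). nra. }
  set (a := fun j => 2 ^ j / tau).
  assert (H2 : forall j, 0 < 2 ^ j) by (intros j; apply pow_lt; lra).
  assert (Ha : forall j, 0 < a j) by (intros j; apply Rdiv_lt_0_compat; auto).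
  set (t := fun j w => rec1 (Cmult (RtoC (a j)) w)).
  assert (Hs0 : forall j w, 0 <= fst w -> 0 <= fst (Cmult (RtoC (a j)) w)).
  { intros j w Hw. simpl. pose proof (Ha j). nra. }
  assert (Hsm : forall j w, Cmod (Cmult (RtoC (a j)) w) = 2 ^ j * (Cmod w / tau)).
  { intros j w. rewrite Cmod_mult, Cmod_R, Rabs_pos_eq by (left; apply Ha). unfold a. field. lra. }
  assert (Havg : forall (f : nat -> R) (b : R), nsum N f <= INR N * b -> / INR N * nsum N f <= b).
  { intros f b H. apply Rmult_le_reg_l with (INR N); [exact HN1|].
    rewrite <- Rmult_assoc, Rinv_r, Rmult_1_l by lra. exact H. }
  assert (HiN : 0 < / INR N) by now apply Rinv_0_lt_compat.
  set (chi := fun w => Cmult (RtoC (/ INR N)) (csumn N (fun j => t j w))).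
  assert (Hmod : forall w b, (forall j, (j < N)%nat -> Cmod (t j w) <= b) -> Cmod (chi w) <= b).
  { intros w b H. unfold chi. rewrite Cmod_mult, Cmod_R, Rabs_pos_eq by lra.
    eapply Rle_trans; [apply Rmult_le_compat_l; [lra|apply Cmod_csumn]|]. apply Havg.
    rewrite <- nsum_const. now apply nsum_le. }
  assert (Hdiff : forall w w' m b, 0 <= m ->
    (nsum N (fun j => m * Cmod (Cminus (t j w) (t j w'))) <= INR N * b) ->
    m * Cmod (Cminus (chi w) (chi w')) <= b).
  { intros w w' m b Hm H. unfold chi.
    replace (Cminus (Cmult (RtoC (/ INR N)) (csumn N (fun j => t j w)))
      (Cmult (RtoC (/ INR N)) (csumn N (fun j => t j w')))) with
      (Cmult (RtoC (/ INR N)) (Cminus (csumn N (fun j => t j w)) (csumn N (fun j => t j w')))) by ring.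
    rewrite csumn_minus, Cmod_mult, Cmod_R, Rabs_pos_eq by lra.
    rewrite <- Rmult_assoc, (Rmult_comm m), Rmult_assoc.
    eapply Rle_trans; [apply Rmult_le_compat_l; [lra|]; apply Rmult_le_compat_l; [exact Hm|apply Cmod_csumn]|].
    rewrite <- nsum_scal. now apply Havg. }
  exists chi. split.
  - intros w Hw. unfold chi. rewrite fst_scal, fst_csumn. split.
    + apply Rmult_le_pos; [lra|]. apply nsum_nonneg. intros j _. apply rec1_re, Hs0, Hw.
    + apply Havg. rewrite <- nsum_const. apply nsum_le. intros j _. apply rec1_re, Hs0, Hw.
  - intros w Hw. unfold chi. rewrite snd_scal, snd_csumn, Rabs_mult, (Rabs_pos_eq (/ INR N)) by lra.
    assert (Habs : forall m (f : nat -> R), Rabs (nsum m f) <= nsum m (fun j => Rabs (f j))).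
    { induction m as [|m IH]; intros f; simpl; [rewrite Rabs_R0; lra|].
      eapply Rle_trans; [apply Rabs_triang|]. pose proof (IH f). lra. }
    eapply Rle_trans; [apply Rmult_le_compat_l; [lra|apply Habs]|]. apply Havg.
    eapply Rle_trans; [|rewrite Rmult_comm; exact HNk].
    eapply Rle_trans; [|apply (dyadic_sum (Cmod w / tau) N)].
    + apply nsum_le. intros j _. rewrite <- Hsm. apply rec1_im, Hs0, Hw.
    + apply Rdiv_le_0_compat; [apply Cmod_ge_0|exact Ht].
  - intros w Hw. apply Hmod. intros j _. apply rec1_mod, Hs0, Hw.
  - intros w Hw. pose proof (Cmod_ge_0 w) as Hw0.
    destruct (Req_dec (Cmod w) 0) as [E|E]; [rewrite E, Rmult_0_r; lra|].
    apply Rmult_le_reg_r with (/ Cmod w); [apply Rinv_0_lt_compat; lra|].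
    rewrite Rmult_assoc, Rinv_r, Rmult_1_r by exact E.
    apply Hmod. intros j _. destruct (rec1_mod _ (Hs0 j w Hw)) as [_ G]. rewrite Hsm in G.
    fold (t j w) in G. pose proof (Cmod_ge_0 (t j w)) as H0.
    assert (Hp : 1 <= 2 ^ j) by (apply pow_R1_Rle; lra).
    apply Rmult_le_reg_r with (Cmod w / tau); [div_pos|].
    replace (tau * / Cmod w * (Cmod w / tau)) with 1 by (field; lra).
    assert (0 <= Cmod w / tau) by (apply Rdiv_le_0_compat; lra).
    assert (Cmod (t j w) * (Cmod w / tau) * 1 <= Cmod (t j w) * (Cmod w / tau) * 2 ^ j)
      by (apply Rmult_le_compat_l; [now apply Rmult_le_pos|exact Hp]). lra.
  - intros w w' Hw Hw' Hww. apply Hdiff; [apply Cmod_ge_0|].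
    pose proof (Cmod_ge_0 w) as Hw0. pose proof (Cmod_ge_0 (Cminus w w')) as Hd0.
    apply Rle_trans with (Cmod (Cminus w w') *
       nsum N (fun j => (2 ^ j * (Cmod w / tau)) / (1 + (2 ^ j * (Cmod w / tau)) ^ 2))).
    + rewrite <- nsum_scal. apply nsum_le. intros j _. unfold t.
      set (s := Cmult (RtoC (a j)) w). set (s' := Cmult (RtoC (a j)) w').
      assert (Hss : Cmod s <= Cmod s').
      { unfold s, s'. rewrite !Hsm. apply Rmult_le_compat_l; [left; apply H2|].
        unfold Rdiv. apply Rmult_le_compat_r; [left; now apply Rinv_0_lt_compat|exact Hww]. }
      pose proof (rec1_lip s s' (Hs0 j w Hw) (Hs0 j w' Hw') Hss) as G.
      assert (Es : Cmod (Cminus s s') = a j * Cmod (Cminus w w')).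
      { replace (Cminus s s') with (Cmult (RtoC (a j)) (Cminus w w')) by (unfold s, s'; ring).
        rewrite Cmod_mult, Cmod_R, Rabs_pos_eq by (left; apply Ha). reflexivity. }
      eapply Rle_trans; [apply Rmult_le_compat_l; [exact Hw0|exact G]|].
      rewrite Es. unfold s. rewrite Hsm. right. unfold a, Rdiv. ring.
    + replace (INR N * (kap * Cmod (Cminus w w'))) with (Cmod (Cminus w w') * (kap * INR N)) by ring.
      apply Rmult_le_compat_l; [exact Hd0|].
      eapply Rle_trans; [apply dyadic_sum|exact HNk]. apply Rdiv_le_0_compat; lra.
  - unfold chi.
    assert (E : forall m, csumn m (fun j => t j (RtoC 0)) = RtoC (INR m)).
    { induction m as [|m IH]; [reflexivity|]. simpl csumn. rewrite IH, S_INR.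
      unfold t, rec1. rewrite Cmult_0_r. rewrite RtoC_plus. f_equal. field. }
    rewrite E, <- RtoC_mult. f_equal. field. lra.
  (* The poles are at [-1 / a j] with [j < N], all of modulus at least [2 rad]. On the disc every
     denominator therefore has modulus at least 1/2, and two of them give the factor 4. *)
  - set (rad := / (2 * a N)). assert (Hrad : 0 < rad) by (apply Rinv_0_lt_compat; pose proof (Ha N); lra).
    exists rad, (4 * a N). pose proof (Ha N) as HaN. split; [exact Hrad|]. split; [lra|].
    intros w w' Hw Hw'. rewrite <- (Rmult_1_l (Cmod (Cminus (chi w) (chi w')))).
    apply Hdiff; [lra|]. rewrite <- nsum_const. apply nsum_le. intros j Hj. rewrite Rmult_1_l.
    assert (Haj : a j <= a N).
    { unfold a, Rdiv. apply Rmult_le_compat_r; [left; now apply Rinv_0_lt_compat|].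
      apply Rle_pow; [lra|lia]. }
    assert (Hge : forall u, Cmod u <= rad -> / 2 <= Cmod (Cplus (RtoC 1) (Cmult (RtoC (a j)) u))).
    { intros u Hu. eapply Rle_trans; [|apply Cmod_minus_ge].
      rewrite Cmod_1, Cmod_mult, Cmod_R, Rabs_pos_eq by (left; apply Ha).
      assert (a j * Cmod u <= a N * rad)
        by (apply Rmult_le_compat; [left; apply Ha|apply Cmod_ge_0|exact Haj|exact Hu]).
      assert (a N * rad = / 2) by (unfold rad; field; lra). lra. }
    pose proof (Hge w Hw) as G1. pose proof (Hge w' Hw') as G2. unfold t, rec1.
    set (u := Cplus (RtoC 1) (Cmult (RtoC (a j)) w)) in *.
    set (u' := Cplus (RtoC 1) (Cmult (RtoC (a j)) w')) in *.
    assert (Hu : u <> RtoC 0) by (apply Cmod_gt_0; lra).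
    assert (Hu' : u' <> RtoC 0) by (apply Cmod_gt_0; lra).
    replace (Cminus (Cinv u) (Cinv u')) with (Cdiv (Cmult (RtoC (- a j)) (Cminus w w')) (Cmult u u')).
    + rewrite Cmod_div by now apply Cmult_neq_0. rewrite !Cmod_mult, Cmod_R, Rabs_Ropp, Rabs_pos_eq
        by (left; apply Ha).
      pose proof (Cmod_ge_0 (Cminus w w')) as Hd0.
      apply Rmult_le_reg_r with (Cmod u * Cmod u'); [nra|].
      replace (a j * Cmod (Cminus w w') / (Cmod u * Cmod u') * (Cmod u * Cmod u'))
        with (a j * Cmod (Cminus w w')) by (field; lra).
      assert (/ 4 <= Cmod u * Cmod u') by nra.
      assert (a j * Cmod (Cminus w w') <= a N * Cmod (Cminus w w')) by mono_r.
      assert (0 <= a N * Cmod (Cminus w w')) by nra. nra.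
    + assert (Er : RtoC (- a j) = Copp (RtoC (a j))) by cpair.
      rewrite Er. unfold u, u' in *. field. split; assumption.
  - intros n g z Hg Hz. unfold chi. apply chol_mult; [apply chol_const|].
    apply (chol_csumn N (fun j v => t j (g v))). intros j. unfold t, rec1.
    apply (chol_inv (fun v => Cplus (RtoC 1) (Cmult (RtoC (a j)) (g v)))).
    + apply chol_plus; [apply chol_const|]. apply chol_mult; [apply chol_const|exact Hg].
    + apply one_plus_neq, Hs0, Hz.
Qed.

Lemma le_div_l (a b d : R) : 0 < d -> a <= b / d -> a * d <= b.
Proof. intros Hd H. assert (b / d * d = b) by (field; lra). nra. Qed.

Ltac mposs := repeat match goal with |- 0 < _ * _ => apply Rmult_lt_0_compat end.

(** * The map into the ball *)

Definition small_enough (P : R -> Prop) : Prop := exists s, 0 < s /\ forall x, 0 <= x <= s -> P x.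

Lemma small_linear (C t : R) : 0 <= C -> 0 < t -> small_enough (fun x => C * x <= t).
Proof.
  intros HC Ht. exists (t / (C + 1)). split; [div_pos|]. intros x Hx.
  assert (t / (C + 1) * (C + 1) = t) by (field; lra). nra.
Qed.

Lemma small_and (P Q : R -> Prop) :
  small_enough P -> small_enough Q -> small_enough (fun x => P x /\ Q x).
Proof.
  intros [s [Hs H]] [t [Ht H']]. exists (Rmin s t). split; [now apply Rmin_glb_lt|]. intros x Hx.
  pose proof (Rmin_l s t). pose proof (Rmin_r s t). split; [apply H|apply H']; lra.
Qed.

Lemma re_le_Cmod_self (z : C) : fst z <= Cmod z.
Proof. eapply Rle_trans; [apply Rle_abs|apply fst_le_Cmod]. Qed.

(** The quotient on the left is the inverse of [W |-> (W - b) / (W + conj b)]; its real part is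
    positive exactly for [beta] in the unit disc when [Re b > 0]. *)
Lemma cayley_real_part (b beta : C) : Cminus (RtoC 1) beta <> RtoC 0 ->
  fst (Cdiv (Cplus b (Cmult (Cconj b) beta)) (Cminus (RtoC 1) beta))
  = fst b * (1 - Cmod beta ^ 2) / Cmod (Cminus (RtoC 1) beta) ^ 2.
Proof.
  intros H. assert (Hd : 0 < Cmod (Cminus (RtoC 1) beta) ^ 2) by (apply pow_lt; now apply Cmod_gt_0).
  rewrite !Cmod_sq in *. destruct b as [b1 b2], beta as [x y]. simpl in *. field. lra.
Qed.

Lemma chol_quadratic {n : nat} (A : Cn n -> Cn n -> C) (K : R) (p z : Cn n) :
  (forall v, clinear (fun u => A u v)) -> (forall u v, A u v = A v u) -> 0 < K ->
  (forall u v, Cmod (A u v) <= K * vnorm u * vnorm v) ->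
  chol (fun w => A (vsub w p) (vsub w p)) z.
Proof.
  intros HA Hs HK Hb. exists (fun v => Cmult (RtoC 2) (A v (vsub z p))). split.
  - split; intros; rewrite ?(proj1 (HA _)), ?(proj2 (HA _)); ring.
  - intros eps He. exists (eps / K). split; [div_pos|]. intros v Hv.
    replace (vsub (vadd z v) p) with (vadd (vsub z p) v) by vec.
    match goal with |- Cmod ?X <= _ => replace X with (A v v) end.
    + eapply Rle_trans; [apply Hb|]. pose proof (vnorm_nonneg v).
      apply Rmult_le_compat_r; [lra|].
      assert (eps / K * K = eps) by (field; lra). nra.
    + rewrite (proj1 (HA _)), (Hs (vsub z p) (vadd (vsub z p) v)), (Hs v (vadd (vsub z p) v)).
      rewrite !(proj1 (HA _)), (Hs (vsub z p) v). ring.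
Qed.

Lemma chol_minus {n : nat} (f g : Cn n -> C) (z : Cn n) :
  chol f z -> chol g z -> chol (fun v => Cminus (f v) (g v)) z.
Proof.
  intros Hf Hg.
  replace (fun v => Cminus (f v) (g v)) with
    (fun v => Cplus (f v) (Cmult (RtoC (-1)) (g v))).
  - apply chol_plus; [exact Hf|]. apply chol_mult; [apply chol_const|exact Hg].
  - apply functional_extensionality. intros v. cpair.
Qed.

(** Compares the distances from [W] to [b] and to [- conj b], the mirror image of [b] in the
    imaginary axis. *)
Lemma Cmod_reflection (W b : C) :
  Cmod (Cminus W b) ^ 2 = Cmod (Cplus W (Cconj b)) ^ 2 - 4 * fst b * fst W.
Proof. rewrite !Cmod_sq. simpl. ring. Qed.

Lemma cayley_injective (W1 W2 b : C) : 0 < fst b -> 0 <= fst W1 -> 0 <= fst W2 ->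
  Cdiv (Cminus W1 b) (Cplus W1 (Cconj b)) = Cdiv (Cminus W2 b) (Cplus W2 (Cconj b)) -> W1 = W2.
Proof.
  intros Hb H1 H2 E.
  assert (D1 : Cplus W1 (Cconj b) <> RtoC 0)
    by (intros F; apply (f_equal fst) in F; simpl in F; lra).
  assert (D2 : Cplus W2 (Cconj b) <> RtoC 0)
    by (intros F; apply (f_equal fst) in F; simpl in F; lra).
  assert (Db : Cplus b (Cconj b) <> RtoC 0)
    by (intros F; apply (f_equal fst) in F; simpl in F; lra).
  assert (E2 : Cmult (Cminus W1 W2) (Cplus b (Cconj b)) = RtoC 0).
  { transitivity (Cmult (Cmult (Cplus W1 (Cconj b)) (Cplus W2 (Cconj b)))
      (Cminus (Cdiv (Cminus W1 b) (Cplus W1 (Cconj b))) (Cdiv (Cminus W2 b) (Cplus W2 (Cconj b))))).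
    - field. split; assumption.
    - rewrite E. ring. }
  assert (E3 : Cminus W1 W2 = RtoC 0).
  { transitivity (Cdiv (Cmult (Cminus W1 W2) (Cplus b (Cconj b))) (Cplus b (Cconj b))).
    - field. exact Db.
    - rewrite E2. field. exact Db. }
  replace W1 with (Cplus (Cminus W1 W2) W2) by ring. rewrite E3. ring.
Qed.

Section Model.
Context {n : nat} (Om : Cn n -> Prop) (p : Cn n) (l : Cn n -> Cn n -> C)
  (h A : Cn n -> Cn n -> C) (nu : Cn n) (K c r0 : R).
Hypothesis LM : local_model Om p l h A nu K c r0.

Let HK : 0 < K := lm_K LM.
Let Hc : 0 < c := lm_c LM.
Let m : R := fst (h nu nu).

Lemma normal_mass_pos : 0 < m.
Proof.
  unfold m.
  pose proof (lm_h_low LM nu) as H.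
  pose proof (vnorm_pos nu (lm_nu0 LM)) as H'.
  assert (0 < vnorm nu ^ 2) by now apply pow_lt. nra.
Qed.

Lemma normal_mass_real : l p nu = RtoC m.
Proof.
  unfold m.
  rewrite (lm_nu LM nu).
  pose proof (proj2 (lm_h LM) nu nu) as E. apply (f_equal snd) in E. simpl in E.
  apply injective_projections; simpl; [reflexivity|lra].
Qed.

Lemma form_increment (v w : Cn n) :
  Cmod (Cminus (A v v) (A w w)) <= K * vnorm (vsub v w) * (vnorm v + vnorm w).
Proof.
  pose proof (lm_A LM) as HA. pose proof (lm_A_sym LM) as Hs.
  pose proof (lm_A_up LM) as Hu.
  replace (Cminus (A v v) (A w w)) with (Cplus (A (vsub v w) v) (A (vsub v w) w)).
  - eapply Rle_trans; [apply Cmod_triangle|].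
    pose proof (Hu (vsub v w) v). pose proof (Hu (vsub v w) w). lra.
  - rewrite (clinear_vsub _ v w (HA v)), (clinear_vsub _ v w (HA w)), (Hs w v). ring.
Qed.

Lemma form_bound (v : Cn n) : Cmod (A v v) <= K * vnorm v ^ 2.
Proof.
  pose proof (lm_A_up LM v v). lra.
Qed.

Lemma normal_near (eps : R) : 0 < eps -> exists r, 0 < r /\
  forall p', boundary Om p' -> vnorm (vsub p' p) < r ->
    Cmod (Cminus (l p' nu) (RtoC m)) <= eps.
Proof.
  intros He. pose proof (vnorm_nonneg nu) as Hn.
  destruct (lm_cont LM (eps / (vnorm nu + 1))) as [r [Hr H]];
    [div_pos|].
  exists r. split; [exact Hr|]. intros p' Hp' Hpp. specialize (H p' Hp' Hpp nu).
  rewrite normal_mass_real in H. eapply Rle_trans; [exact H|].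
  assert (eps / (vnorm nu + 1) * (vnorm nu + 1) = eps) by (field; lra).
  assert (0 < eps / (vnorm nu + 1)) by div_pos. nra.
Qed.

Lemma normal_below : exists r, 0 < r /\
  forall p', boundary Om p' -> vnorm (vsub p' p) < r -> m / 2 <= Cmod (l p' nu).
Proof.
  pose proof normal_mass_pos as Hm.
  destruct (normal_near (m / 2)) as [r [Hr H]]; [lra|].
  exists r. split; [exact Hr|]. intros p' Hp' Hpp. specialize (H p' Hp' Hpp).
  replace (l p' nu) with (Cplus (RtoC m) (Cminus (l p' nu) (RtoC m))) by ring.
  eapply Rle_trans; [|apply Cmod_minus_ge]. rewrite Cmod_R, Rabs_pos_eq by lra. lra.
Qed.

(** * The modified normal coordinate: lower bounds and injectivity *)

Definition shear (chi : C -> C) (p' v : Cn n) : C :=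
  Cminus (l p' v) (Cmult (A v v) (chi (l p' v))).

(** Far out [Re l >= c r^2], so the decay of [chi] gives [2 K |chi| <= c]. Then [|A chi|] is at most
    half of [c |v|^2], hence at most half of [Re l]. *)
Lemma shear_lower_far (chi : C -> C) (kap tau r : R) (p' v : Cn n) :
  cutoff kap tau chi -> 0 < r -> tau * (2 * K) <= c * (c * r ^ 2) ->
  c * vnorm v ^ 2 <= fst (l p' v) -> r <= vnorm v ->
  / 2 * fst (l p' v) <= fst (shear chi p' v).
Proof.
  intros Hchi Hr Htau Hs Hv. set (w := l p' v) in *. set (N := vnorm v) in *.
  assert (Hrv : r ^ 2 <= N ^ 2) by (apply pow_incr; lra).
  assert (HX : c * r ^ 2 <= fst w) by nra.
  assert (Hr2 : 0 < r ^ 2) by now apply pow_lt.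
  assert (Hcr : 0 < c * r ^ 2) by (apply Rmult_lt_0_compat; lra).
  pose proof (co_decay Hchi w ltac:(lra)) as Hd.
  pose proof (fst_le_Cmod w) as Hw. pose proof (Rle_abs (fst w)).
  pose proof (Cmod_ge_0 (chi w)) as Hx0. pose proof (form_bound v) as HA. fold N in HA.
  set (x := Cmod (chi w)) in *.
  assert (H1 : x * (c * r ^ 2) <= tau).
  { apply Rle_trans with (x * Cmod w); [apply Rmult_le_compat_l; lra|exact Hd]. }
  assert (H2 : x * (2 * K) <= c).
  { apply Rmult_le_reg_r with (c * r ^ 2); [exact Hcr|].
    apply Rle_trans with (tau * (2 * K)); [|lra].
    replace (x * (2 * K) * (c * r ^ 2)) with (x * (c * r ^ 2) * (2 * K)) by ring.
    apply Rmult_le_compat_r; lra. }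
  assert (H3 : Cmod (Cmult (A v v) (chi w)) <= / 2 * fst w).
  { rewrite Cmod_mult. fold x.
    apply Rle_trans with (K * N ^ 2 * x); [apply Rmult_le_compat_r; lra|].
    assert (x * (2 * K) * N ^ 2 <= c * N ^ 2) by (apply Rmult_le_compat_r; [apply pow2_ge_0|exact H2]).
    lra. }
  pose proof (fst_le_Cmod (Cmult (A v v) (chi w))) as H4.
  pose proof (Rle_abs (fst (Cmult (A v v) (chi w)))) as H5.
  unfold shear. fold w.
  replace (fst (Cminus w (Cmult (A v v) (chi w)))) with (fst w - fst (Cmult (A v v) (chi w)))
    by (simpl; ring). lra.
Qed.

(** Here the Taylor inequality with [h >= c |v|^2] keeps [Re A] below [(1 - g/4) Re l], where
    [g = c / (2 K)]. Multiplication by [Re chi] in [[0, 1]] preserves this bound, and the imaginary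
    part of [chi] costs at most [g/8 Re l], because [|Im A| <= K |v|^2] and [kap] is small. *)
Lemma shear_lower_near (chi : C -> C) (kap tau e : R) (p' v : Cn n) :
  cutoff kap tau chi -> 0 < e -> e <= c / 2 -> e * (4 * K) <= c ->
  kap * (16 * K * K) <= c * c -> c <= K ->
  c * vnorm v ^ 2 <= fst (l p' v) ->
  fst (A v v) + fst (h v v) <= fst (l p' v) + e * (vnorm v ^ 2 + Rabs (fst (l p' v))) ->
  c / (16 * K) * fst (l p' v) <= fst (shear chi p' v).
Proof.
  intros Hchi He0 He1 He2 Hkap HcK Hs HT. set (w := l p' v) in *. set (N := vnorm v ^ 2) in *.
  assert (HN : 0 <= N) by apply pow2_ge_0.
  assert (HX : 0 <= fst w) by nra. rewrite Rabs_pos_eq in HT by exact HX.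
  pose proof (co_re Hchi w HX) as Hth. pose proof (co_im Hchi w HX) as Him.
  pose proof (lm_h_low LM v) as Hh. fold N in Hh.
  pose proof (form_bound v) as HA. fold N in HA.
  pose proof (fst_le_Cmod (A v v)) as HA1. pose proof (snd_le_Cmod (A v v)) as HA2.
  pose proof (Rle_abs (fst (A v v))) as HA3.
  set (X := fst w) in *. set (Y := fst (A v v)) in *. set (Z := snd (A v v)) in *.
  set (th := fst (chi w)) in *. set (im := snd (chi w)) in *.
  (* Half of [h >= c |v|^2] is traded for [g Re A <= c |v|^2 / 2]; the other half covers
     [e |v|^2]. *)
  set (g := c / (2 * K)).
  assert (Hg : g * (2 * K) = c) by (unfold g; field; lra).
  assert (Hg0 : 0 < g) by div_pos.
  assert (Hg1 : g <= / 2) by nra.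
  assert (Heg : e <= g / 2) by nra.
  assert (HYX : Y * (1 + g) <= X * (1 + e)).
  { assert (Y * g <= c / 2 * N) by nra. nra. }
  assert (HthY : th * Y * (1 + g) <= X * (1 + e)).
  { destruct (Rle_or_lt 0 Y) as [HY|HY].
    - assert (th * Y <= Y) by nra. nra.
    - assert (th * Y <= 0) by nra. nra. }
  assert (Hmain : th * Y <= X * (1 - g / 4)).
  { assert (E : (1 + e) <= (1 - g / 4) * (1 + g)) by nra.
    apply Rmult_le_reg_r with (1 + g); [lra|].
    apply Rle_trans with (X * (1 + e)); [exact HthY|]. rewrite Rmult_assoc.
    now apply Rmult_le_compat_l. }
  assert (Hk0 : 0 <= kap) by (pose proof (Rabs_pos im); lra).
  unfold shear. fold w.
  replace (fst (Cminus w (Cmult (A v v) (chi w)))) with (X - (th * Y - Z * im))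
    by (unfold X, Y, Z, th, im; simpl; ring).
  replace (c / (16 * K)) with (g / 8) by (unfold g; field; lra).
  assert (Him3 : Z * im >= - (g / 8 * X)).
  { assert (Rabs (Z * im) <= K * N * kap).
    { rewrite Rabs_mult. apply Rmult_le_compat; try apply Rabs_pos; [lra|exact Him]. }
    pose proof (Rle_abs (- (Z * im))) as Hr. rewrite Rabs_Ropp in Hr.
    assert (B1 : kap * (8 * K) <= c * g).
    { apply Rmult_le_reg_r with (2 * K); [lra|]. replace (c * g * (2 * K)) with (c * (g * (2 * K))) by ring.
      rewrite Hg. lra. }
    assert (B2 : kap * (8 * K) * N <= c * g * N) by (apply Rmult_le_compat_r; assumption).
    assert (B3 : g * (c * N) <= g * X) by mono_l.
    lra. }
  assert (0 <= g * X) by nra. lra.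
Qed.

(** Equal values give [w1 - w2 = A1 (chi1 - chi2) + (A1 - A2) chi2], and each summand is at most a
    quarter of [|w1 - w2|]. For the first, [|A1| <= (K / c) |w1|] meets the slow variation of [chi].
    For the second, [|A1 - A2|] carries the factor [|v1| + |v2|], of order at most [sqrt |w2|],
    which the decay of [chi] at [w2] makes small. Both use the ordering [|w1| <= |w2|]. *)
Lemma shear_fiber_le (chi : C -> C) (kap tau G : R) (p' v1 v2 : Cn n) :
  cutoff kap tau chi -> kap * (4 * K) <= c -> 0 < G -> tau * (64 * K ^ 2 * G ^ 2) <= c ->
  c * vnorm v1 ^ 2 <= fst (l p' v1) -> c * vnorm v2 ^ 2 <= fst (l p' v2) ->
  vnorm (vsub v1 v2) <= G * Cmod (Cminus (l p' v1) (l p' v2)) ->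
  Cmod (l p' v1) <= Cmod (l p' v2) ->
  shear chi p' v1 = shear chi p' v2 -> v1 = v2.
Proof.
  intros Hchi Hkap HG Htau H1 H2 Hd Hle E.
  set (w1 := l p' v1) in *. set (w2 := l p' v2) in *.
  set (N1 := vnorm v1) in *. set (N2 := vnorm v2) in *.
  assert (HN1 : 0 <= N1) by apply vnorm_nonneg. assert (HN2 : 0 <= N2) by apply vnorm_nonneg.
  assert (HX1 : 0 <= fst w1) by (assert (0 <= N1 ^ 2) by apply pow2_ge_0; nra).
  assert (HX2 : 0 <= fst w2) by (assert (0 <= N2 ^ 2) by apply pow2_ge_0; nra).
  assert (Hw1 : fst w1 <= Cmod w1) by (eapply Rle_trans; [apply Rle_abs|apply fst_le_Cmod]).
  assert (Hw2 : fst w2 <= Cmod w2) by (eapply Rle_trans; [apply Rle_abs|apply fst_le_Cmod]).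
  set (d := Cmod (Cminus w1 w2)) in *. assert (Hd0 : 0 <= d) by apply Cmod_ge_0.
  assert (Ew : Cminus w1 w2 = Cplus (Cmult (A v1 v1) (Cminus (chi w1) (chi w2)))
                 (Cmult (Cminus (A v1 v1) (A v2 v2)) (chi w2))).
  { assert (E' : Cplus (shear chi p' v1) (Copp (shear chi p' v2)) = RtoC 0) by (rewrite E; ring).
    unfold shear in E'. fold w1 w2 in E'.
    match goal with |- ?L = ?R => replace L with (Cplus R (RtoC 0)) by (rewrite <- E'; ring) end. ring. }
  assert (T1 : Cmod (A v1 v1) * Cmod (Cminus (chi w1) (chi w2)) <= / 4 * d).
  { pose proof (co_lip Hchi w1 w2 HX1 HX2 Hle) as HL. fold d in HL.
    pose proof (form_bound v1) as HA. fold N1 in HA.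
    set (y := Cmod (Cminus (chi w1) (chi w2))) in *. assert (Hy : 0 <= y) by apply Cmod_ge_0.
    assert (HA' : Cmod (A v1 v1) * c <= K * Cmod w1) by nra.
    apply Rmult_le_reg_r with c; [exact Hc|].
    assert (B1 : Cmod (A v1 v1) * c * y <= K * Cmod w1 * y) by (apply Rmult_le_compat_r; assumption).
    assert (B2 : K * (Cmod w1 * y) <= K * (kap * d)) by mono_l.
    assert (B3 : kap * (4 * K) * d <= c * d) by (apply Rmult_le_compat_r; assumption).
    lra. }
  assert (T2 : Cmod (Cminus (A v1 v1) (A v2 v2)) * Cmod (chi w2) <= / 4 * d).
  { pose proof (form_increment v1 v2) as HI. fold N1 N2 in HI.
    pose proof (co_mod Hchi w2 HX2) as Hm. pose proof (co_decay Hchi w2 HX2) as Hdec.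
    set (x := Cmod (chi w2)) in *. assert (Hx : 0 <= x) by apply Cmod_ge_0.
    set (q := (N1 + N2) * x). assert (Hq : 0 <= q) by (unfold q; nra).
    assert (Hq2 : q ^ 2 * c <= 4 * tau).
    { assert (B1 : c * N1 ^ 2 <= Cmod w2) by lra. assert (B2 : c * N2 ^ 2 <= Cmod w2) by lra.
      assert (B3 : c * (N1 + N2) ^ 2 <= 4 * Cmod w2) by (pose proof (pow2_ge_0 (N1 - N2)); nra).
      assert (B4 : x ^ 2 * Cmod w2 <= tau).
      { assert (x ^ 2 <= x) by nra. pose proof (Cmod_ge_0 w2). nra. }
      assert (B5 : x ^ 2 * (c * (N1 + N2) ^ 2) <= x ^ 2 * (4 * Cmod w2))
        by (apply Rmult_le_compat_l; [apply pow2_ge_0|exact B3]).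
      unfold q. lra. }
    assert (Hq3 : 4 * K * G * q <= 1).
    { assert (HKG : 0 < K * G) by nra.
      apply Rsqr_incr_0_var; [|lra]. unfold Rsqr.
      apply Rmult_le_reg_r with c; [exact Hc|].
      assert (B : q ^ 2 * c * (16 * K ^ 2 * G ^ 2) <= 4 * tau * (16 * K ^ 2 * G ^ 2)).
      { apply Rmult_le_compat_r; [|exact Hq2]. assert (0 <= (K * G) ^ 2) by apply pow2_ge_0. lra. }
      lra. }
    apply Rle_trans with (K * (G * d) * (N1 + N2) * x).
    - apply Rmult_le_compat_r; [exact Hx|]. eapply Rle_trans; [exact HI|].
      apply Rmult_le_compat_r; [lra|]. apply Rmult_le_compat_l; [lra|exact Hd].
    - replace (K * (G * d) * (N1 + N2) * x) with (4 * K * G * q * (/ 4 * d)) by (unfold q; field).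
      nra. }
  assert (Hd1 : d <= / 2 * d).
  { unfold d at 1. rewrite Ew. eapply Rle_trans; [apply Cmod_triangle|]. rewrite !Cmod_mult. lra. }
  assert (Ed : d = 0) by lra. rewrite Ed, Rmult_0_r in Hd.
  apply vsub_eq_zero, vnorm_zero_eq. pose proof (vnorm_nonneg (vsub v1 v2)). lra.
Qed.

(** The cut-off is fixed once for all boundary points near p, so its local Lipschitz constants can
    enter the choice of later thresholds. *)
Lemma shear_exists : exists chi kap tau c3 r1,
  cutoff kap tau chi /\ 0 < c3 /\ 0 < r1 /\ r1 <= r0 /\
  forall p', boundary Om p' -> vnorm (vsub p' p) < r1 ->
    m / 2 <= Cmod (l p' nu) /\
    (forall z, Om z -> c3 * fst (l p' (vsub z p')) <= fst (shear chi p' (vsub z p'))) /\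
    (forall z1 z2 a, Om z1 -> Om z2 -> vsub z1 z2 = cscale a nu ->
       shear chi p' (vsub z1 p') = shear chi p' (vsub z2 p') -> z1 = z2).
Proof.
  pose proof normal_mass_pos as Hm.
  pose proof (vnorm_pos nu (lm_nu0 LM)) as Hnu.
  assert (HcK : c <= K).
  { pose proof (lm_h_low LM nu). pose proof (lm_h_up LM nu).
    assert (0 < vnorm nu ^ 2) by now apply pow_lt. nra. }
  destruct normal_below as [rn [Hrn Hn]].
  set (e := Rmin (c / 2) (c / (4 * K))).
  assert (He : 0 < e) by (apply Rmin_glb_lt; [lra|div_pos]).
  assert (He1 : e <= c / 2) by apply Rmin_l.
  assert (He2 : e * (4 * K) <= c) by (apply le_div_l; [lra|apply Rmin_r]).
  destruct (lm_taylor LM e He) as [r [Hr HT]].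
  (* On a line parallel to [nu] one has [|v1 - v2| = |nu| / |l p' nu|] times [|l p' v1 - l p' v2|],
     and [|l p' nu| >= m / 2]. *)
  set (G := 2 * vnorm nu / m).
  assert (HG : 0 < G) by div_pos.
  set (kap := c * c / (16 * K * K)).
  assert (HKK : 0 < 16 * K * K) by nra.
  assert (Hkap : 0 < kap) by (apply Rdiv_lt_0_compat; nra).
  assert (Hkap1 : kap * (16 * K * K) <= c * c) by (apply le_div_l; [exact HKK|apply Rle_refl]).
  assert (Hkap2 : kap * (4 * K) <= c).
  { apply Rmult_le_reg_r with (4 * K); [lra|]. nra. }
  assert (Hr2 : 0 < r ^ 2) by now apply pow_lt.
  assert (HKG : 0 < 64 * K ^ 2 * G ^ 2).
  { assert (0 < K ^ 2) by now apply pow_lt. assert (0 < G ^ 2) by now apply pow_lt.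
    mposs; lra. }
  assert (Hcr : 0 < c * (c * r ^ 2)) by (mposs; lra).
  (* The first entry serves the lower bound far out, the second the injectivity on lines. *)
  set (tau := Rmin (c * (c * r ^ 2) / (2 * K)) (c / (64 * K ^ 2 * G ^ 2))).
  assert (Htau : 0 < tau) by (apply Rmin_glb_lt; div_pos).
  assert (Htau1 : tau * (2 * K) <= c * (c * r ^ 2)) by (apply le_div_l; [lra|apply Rmin_l]).
  assert (Htau2 : tau * (64 * K ^ 2 * G ^ 2) <= c) by (apply le_div_l; [lra|apply Rmin_r]).
  destruct (cutoff_exists kap tau Hkap Htau) as [chi Hchi].
  exists chi, kap, tau, (c / (16 * K)), (Rmin r0 (Rmin rn r)).
  assert (Hc3 : 0 < c / (16 * K)) by div_pos.
  split; [exact Hchi|]. split; [exact Hc3|].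
  split; [repeat apply Rmin_glb_lt; try assumption; apply (lm_r LM)|].
  split; [apply Rmin_l|]. intros p' Hp' Hpp.
  pose proof (Rmin_l r0 (Rmin rn r)). pose proof (Rmin_r r0 (Rmin rn r)).
  pose proof (Rmin_l rn r). pose proof (Rmin_r rn r).
  pose proof (Hn p' Hp' ltac:(lra)) as Hln.
  assert (Hsup := lm_support LM p' Hp' ltac:(lra)).
  assert (Hll := lm_l LM p' Hp' ltac:(lra)).
  split; [exact Hln|]. split.
  - intros z Hz. specialize (Hsup z Hz). set (v := vsub z p') in *.
    destruct (Rlt_or_le (vnorm v) r) as [Hv|Hv].
    + apply (shear_lower_near chi kap tau e p' v); try assumption.
      apply (HT p' v Hp' ltac:(lra) Hv). unfold v. rewrite vadd_vsub. exact Hz.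
    + eapply Rle_trans; [|apply (shear_lower_far chi kap tau r p' v); assumption].
      apply Rmult_le_compat_r; [pose proof (pow2_ge_0 (vnorm v)); nra|].
      apply Rmult_le_reg_r with (16 * K); [lra|].
      replace (c / (16 * K) * (16 * K)) with c by (field; lra). lra.
  - intros z1 z2 a Hz1 Hz2 Hz E.
    assert (Hd : vsub (vsub z1 p') (vsub z2 p') = cscale a nu) by (rewrite <- Hz; vec).
    assert (Hlip : forall u1 u2 b, vsub u1 u2 = cscale b nu ->
              vnorm (vsub u1 u2) <= G * Cmod (Cminus (l p' u1) (l p' u2))).
    { intros u1 u2 b Hu. rewrite <- (clinear_vsub _ u1 u2 Hll), Hu, (proj2 Hll), Cmod_mult, vnorm_cscale.
      unfold G. pose proof (Cmod_ge_0 b).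
      replace (2 * vnorm nu / m * (Cmod b * Cmod (l p' nu)))
        with (Cmod b * vnorm nu * (Cmod (l p' nu) / (m / 2))) by (field; lra).
      assert (1 <= Cmod (l p' nu) / (m / 2)).
      { apply Rmult_le_reg_r with (m / 2); [lra|].
        replace (Cmod (l p' nu) / (m / 2) * (m / 2)) with (Cmod (l p' nu)) by (field; lra). lra. }
      assert (0 <= Cmod b * vnorm nu) by (apply Rmult_le_pos; lra). nra. }
    assert (Hv : vsub z1 p' = vsub z2 p').
    { destruct (Rle_or_lt (Cmod (l p' (vsub z1 p'))) (Cmod (l p' (vsub z2 p')))) as [Hle|Hlt].
      - apply (shear_fiber_le chi kap tau G p'); auto. now apply (Hlip _ _ a).
      - symmetry. apply (shear_fiber_le chi kap tau G p'); auto; [|lra].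
        apply (Hlip _ _ (Copp a)).
        replace (vsub (vsub z2 p') (vsub z1 p')) with (vscale (-1) (vsub (vsub z1 p') (vsub z2 p'))) by vec.
        rewrite Hd. vec. }
    rewrite <- (vadd_vsub p' z1), Hv. apply vadd_vsub.
Qed.

Lemma herm_cscale (a : C) (v : Cn n) : fst (h (cscale a v) (cscale a v)) = Cmod a ^ 2 * fst (h v v).
Proof.
  pose proof (lm_h LM) as [Hl Hs].
  rewrite (proj2 (Hl _)), (Hs (cscale a v) v), (proj2 (Hl v)), Cmod_sq.
  pose proof (Hs v v) as E. apply (f_equal snd) in E. simpl in E.
  assert (E0 : snd (h v v) = 0) by lra. simpl. rewrite E0. ring.
Qed.

Lemma herm_orthogonal_sum (y : Cn n) (a : C) : h y nu = RtoC 0 ->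
  fst (h (vadd y (cscale a nu)) (vadd y (cscale a nu)))
  = fst (h y y) + Cmod a ^ 2 * m.
Proof.
  intros Hy. unfold m. rewrite <- herm_cscale.
  pose proof (lm_h LM) as [Hl Hs].
  assert (E : h nu y = RtoC 0) by (rewrite Hs, Hy; cpair).
  rewrite (proj1 (Hl _)), (Hs (vadd y (cscale a nu)) y), (Hs (vadd y (cscale a nu)) (cscale a nu)).
  rewrite !(proj1 (Hl _)), (proj2 (Hl y)), E.
  rewrite (Hs (cscale a nu) y), (proj2 (Hl y)), E.
  set (X := h (cscale a nu) (cscale a nu)). set (Y := h y y). simpl. ring.
Qed.

(** * Outer and inner estimates for the image *)

Section Cutoff.
Context (chi : C -> C) (kap tau c3 r1 : R).
Hypothesis Hchi : cutoff kap tau chi.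
Hypothesis Hc3 : 0 < c3.
Hypothesis Hr1 : 0 < r1.
Hypothesis Hr10 : r1 <= r0.
Hypothesis Hlow : forall p', boundary Om p' -> vnorm (vsub p' p) < r1 ->
  forall z, Om z -> c3 * fst (l p' (vsub z p')) <= fst (shear chi p' (vsub z p')).
Hypothesis Hnorm : forall p', boundary Om p' -> vnorm (vsub p' p) < r1 ->
  m / 2 <= Cmod (l p' nu).

(** Where [chi] is close to 1, [W] is close to [l - A], and the expansion lets [h] exceed [Re W]
    only by the errors; those in [|v|^2] are converted by [|v|^2 <= Re l / c]. *)
Lemma shear_taylor_gap (p' v : Cn n) (e : R) : 0 < e ->
  c * vnorm v ^ 2 <= fst (l p' v) -> Cmod (Cminus (chi (l p' v)) (RtoC 1)) <= e ->
  fst (A v v) + fst (h v v) <= fst (l p' v) + e * (vnorm v ^ 2 + Rabs (fst (l p' v))) ->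
  fst (h v v) - fst (shear chi p' v) <= e * ((1 + K) / c + 1) * fst (l p' v).
Proof.
  intros He Hs Hx HT. set (w := l p' v) in *. set (N := vnorm v ^ 2) in *.
  assert (HN : 0 <= N) by apply pow2_ge_0. assert (HX : 0 <= fst w) by nra.
  rewrite Rabs_pos_eq in HT by exact HX.
  pose proof (form_bound v) as HA. fold N in HA.
  assert (HB : fst (Cmult (A v v) (Cminus (chi w) (RtoC 1))) <= K * N * e).
  { eapply Rle_trans; [apply re_le_Cmod_self|]. rewrite Cmod_mult.
    apply Rmult_le_compat; auto using Cmod_ge_0. }
  replace (fst (shear chi p' v)) with
    (fst w - fst (A v v) - fst (Cmult (A v v) (Cminus (chi w) (RtoC 1))))
    by (unfold shear; fold w; simpl; ring).
  assert (HNc : N <= / c * fst w).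
  { apply Rmult_le_reg_l with c; [exact Hc|]. rewrite <- Rmult_assoc, Rinv_r, Rmult_1_l by lra. exact Hs. }
  assert (e * (1 + K) * N <= e * (1 + K) * (/ c * fst w)) by (apply Rmult_le_compat_l; nra).
  replace (e * ((1 + K) / c + 1) * fst w) with (e * (1 + K) * (/ c * fst w) + e * fst w) by (field; lra).
  lra.
Qed.

(** Divided by [|W + conj b|^2], the left side bounds the excess over 1 of the squared [h]-norm of
    [ball_map]. The full [h v v] stands where only its tangential part would occur, which can only
    enlarge it. *)
Lemma image_upper (eps : R) : 0 < eps -> exists db r, 0 < db /\ 0 < r /\
  forall p', boundary Om p' -> vnorm (vsub p' p) < r ->
  forall b : C, 0 < fst b -> Cmod b < db -> Cmod b <= 4 * fst b ->
  forall z, Om z ->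
    let v := vsub z p' in let W := shear chi p' v in
    0 <= fst W /\
    4 * fst b * (fst (h v v) - fst W) <= eps * Cmod (Cplus W (Cconj b)) ^ 2.
Proof.
  intros He.
  destruct (co_local Hchi) as [rad [L [Hrad [HL Hloc]]]].
  (* [M1] bounds [|l| / |W|]: the difference [A chi] is at most [K |v|^2], and
     [c c3 |v|^2 <= Re W]. *)
  set (M1 := 1 + K / (c * c3)).
  assert (Hcc3 : 0 < c * c3) by nra.
  assert (HM1 : 1 < M1) by (unfold M1; assert (0 < K / (c * c3)) by div_pos; lra).
  set (C6 := (1 + K) / c + 1).
  assert (HC6 : 0 < C6) by (unfold C6; assert (0 < (1 + K) / c) by div_pos; lra).
  assert (HCM : 0 < 80 * C6 * M1) by nra.
  (* 80 is 4 times 4 times 5: with [T = |W + conj b|] one has [Re b <= |b| <= 4 T] and [|W| <= 5 T],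
     by the cone condition [|b| <= 4 Re b]. *)
  set (e := eps / (80 * C6 * M1)).
  assert (He0 : 0 < e) by div_pos.
  assert (Ee : e * (80 * C6 * M1) = eps) by (unfold e; field; lra).
  destruct (lm_taylor LM e He0) as [r [Hr HT]].
  assert (Hr2 : 0 < r ^ 2) by now apply pow_lt.
  set (eta := Rmin (Rmin rad (e / L)) (c * r ^ 2)).
  assert (Heta : 0 < eta).
  { unfold eta. repeat apply Rmin_glb_lt; [exact Hrad|div_pos|].
    apply Rmult_lt_0_compat; lra. }
  assert (eta <= rad /\ eta <= e / L /\ eta <= c * r ^ 2) as [Heta1 [Heta2 Heta3]].
  { unfold eta. pose proof (Rmin_l (Rmin rad (e / L)) (c * r ^ 2)).
    pose proof (Rmin_r (Rmin rad (e / L)) (c * r ^ 2)).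
    pose proof (Rmin_l rad (e / L)). pose proof (Rmin_r rad (e / L)). repeat split; lra. }
  (* Where [|l| >= eta], also [|v| >= eta / K], and then [Re W] is at least [k0]. *)
  set (k0 := c3 * (c * (eta / K) ^ 2)).
  assert (Hk0 : 0 < k0).
  { assert (0 < (eta / K) ^ 2) by (apply pow_lt, Rdiv_lt_0_compat; lra). unfold k0. mposs; lra. }
  (* On the whole domain [c |v|^2 <= Re l <= K |v|], so [|v| <= K / c] and [h v v <= H0]. *)
  set (H0 := K * (K / c) ^ 2).
  assert (HH0 : 0 < H0).
  { assert (0 < (K / c) ^ 2) by (apply pow_lt, Rdiv_lt_0_compat; lra). unfold H0. mposs; lra. }
  destruct (small_linear (4 * H0) (eps * k0 ^ 2)) as [db [Hdb Hsm]]; [lra| |].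
  { apply Rmult_lt_0_compat; [lra|now apply pow_lt]. }
  exists db, (Rmin r r1). split; [exact Hdb|]. split; [now apply Rmin_glb_lt|].
  intros p' Hp' Hpp b Hb Hbd Hb4 z Hz v W.
  pose proof (Rmin_l r r1). pose proof (Rmin_r r r1).
  assert (HX := lm_support LM p' Hp' ltac:(lra) z Hz). fold v in HX.
  assert (HlK := lm_l_up LM p' Hp' ltac:(lra) v).
  assert (HWX := Hlow p' Hp' ltac:(lra) z Hz). fold v W in HWX.
  pose proof (vnorm_nonneg v) as HN0. set (N := vnorm v) in *.
  set (w := l p' v) in *. set (X := fst w) in *.
  assert (HN2 : 0 <= N ^ 2) by apply pow2_ge_0.
  assert (HX0 : 0 <= X) by nra. assert (HXw : X <= Cmod w) by apply re_le_Cmod_self.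
  assert (HW0 : 0 <= fst W) by nra. split; [exact HW0|].
  set (T := Cmod (Cplus W (Cconj b))).
  assert (HTre : fst W + fst b <= T).
  { unfold T. eapply Rle_trans; [|apply re_le_Cmod_self]. simpl. lra. }
  assert (HTb : Cmod b <= 4 * T) by lra.
  assert (HTW : Cmod W <= 5 * T).
  { pose proof (Cmod_minus_ge W (Cconj b)) as E. rewrite Cmod_conj in E. fold T in E. lra. }
  assert (Hbm : fst b <= Cmod b) by apply re_le_Cmod_self.
  pose proof (Cmod_ge_0 w) as Hw0. pose proof (Cmod_ge_0 W) as HWm. pose proof (Cmod_ge_0 b) as Hb0.
  destruct (Rlt_or_le (Cmod w) eta) as [Hw|Hw].
  - assert (HNr : N < r).
    { apply Rnot_le_lt. intros Hle. assert (r ^ 2 <= N ^ 2) by (apply pow_incr; lra). nra. }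
    assert (Hchi1 : Cmod (Cminus (chi w) (RtoC 1)) <= e).
    { pose proof (Hloc w (RtoC 0)) as E. rewrite Cmod_0, (co_zero Hchi) in E.
      replace (Cminus w (RtoC 0)) with w in E by ring. specialize (E ltac:(lra) ltac:(lra)).
      assert (e / L * L = e) by (field; lra). nra. }
    assert (Hgap : fst (h v v) - fst W <= e * C6 * X).
    { apply shear_taylor_gap; try assumption.
      apply (proj1 (HT p' v Hp' ltac:(lra) HNr)). unfold v. rewrite vadd_vsub. exact Hz. }
    assert (HwW : Cmod w <= M1 * Cmod W).
    { assert (EW : w = Cplus W (Cmult (A v v) (chi w))) by (unfold W, shear; fold w; ring).
      assert (E1 : Cmod w <= Cmod W + Cmod (A v v) * Cmod (chi w)).
      { rewrite EW at 1. eapply Rle_trans; [apply Cmod_triangle|]. rewrite Cmod_mult. lra. }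
      pose proof (form_bound v) as HA. fold N in HA.
      pose proof (co_mod Hchi w HX0) as Hm.
      assert (E2 : Cmod (A v v) * Cmod (chi w) <= K * N ^ 2).
      { pose proof (Cmod_ge_0 (A v v)). pose proof (Cmod_ge_0 (chi w)). nra. }
      assert (E3 : K * N ^ 2 <= K / (c * c3) * Cmod W).
      { apply Rmult_le_reg_r with (c * c3); [exact Hcc3|].
        replace (K / (c * c3) * Cmod W * (c * c3)) with (K * Cmod W) by (field; lra).
        pose proof (re_le_Cmod_self W).
        assert (c3 * (c * N ^ 2) <= Cmod W) by nra.
        assert (K * (c3 * (c * N ^ 2)) <= K * Cmod W) by mono_l. lra. }
      unfold M1. lra. }
    assert (HeC : 0 <= e * C6) by nra.
    assert (E1 : fst (h v v) - fst W <= e * C6 * (M1 * (5 * T))).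
    { eapply Rle_trans; [exact Hgap|]. apply Rmult_le_compat_l; [exact HeC|].
      assert (M1 * Cmod W <= M1 * (5 * T)) by mono_l. lra. }
    assert (E2 : 4 * fst b * (fst (h v v) - fst W) <= 4 * fst b * (e * C6 * (M1 * (5 * T))))
      by mono_l.
    assert (E3 : 4 * fst b * (e * C6 * (M1 * (5 * T))) <= 4 * (4 * T) * (e * C6 * (M1 * (5 * T)))).
    { apply Rmult_le_compat_r; [|lra]. apply Rmult_le_pos; [exact HeC|]. nra. }
    replace (4 * (4 * T) * (e * C6 * (M1 * (5 * T)))) with (e * (80 * C6 * M1) * T ^ 2) in E3 by ring.
    rewrite Ee in E3. lra.
  - assert (HNlow : eta / K <= N).
    { apply Rmult_le_reg_r with K; [exact HK|]. replace (eta / K * K) with eta by (field; lra). lra. }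
    assert (HWk : k0 <= fst W).
    { assert ((eta / K) ^ 2 <= N ^ 2).
      { apply pow_incr. split; [left; div_pos|exact HNlow]. }
      assert (c * (eta / K) ^ 2 <= X) by nra. unfold k0. nra. }
    assert (HTk : k0 ^ 2 <= T ^ 2) by (apply pow_incr; lra).
    assert (HNup : N <= K / c).
    { apply Rmult_le_reg_r with c; [exact Hc|]. replace (K / c * c) with K by (field; lra).
      destruct (Req_dec N 0) as [->|HN]; [lra|]. assert (0 < N) by lra.
      apply Rmult_le_reg_l with N; [assumption|]. simpl in HX. nra. }
    assert (Hhv : fst (h v v) <= H0).
    { eapply Rle_trans; [apply (lm_h_up LM)|]. fold N. unfold H0.
      apply Rmult_le_compat_l; [lra|]. apply pow_incr. lra. }
    assert (E1 : 4 * fst b * (fst (h v v) - fst W) <= 4 * H0 * Cmod b).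
    { assert (4 * fst b * (fst (h v v) - fst W) <= 4 * fst b * H0) by mono_l. nra. }
    specialize (Hsm (Cmod b) ltac:(lra)).
    assert (eps * k0 ^ 2 <= eps * T ^ 2) by mono_l. lra.
Qed.

(* In the slice [y fixed] the equation [shear = Wh] reads [w = Wh + A(v(w)) chi(w)], which is a
   contraction on a disc of radius comparable to [|b|]. *)
Lemma shear_solve (p' zeta : Cn n) (Wh : C) (mu S Rw rad L : R) :
  clinear (l p') -> 0 < mu -> mu <= Cmod (l p' nu) ->
  0 <= S -> 0 <= Rw -> 0 < L -> Rw <= rad -> L * Rw <= 1 ->
  (forall w w', Cmod w <= rad -> Cmod w' <= rad ->
     Cmod (Cminus (chi w) (chi w')) <= L * Cmod (Cminus w w')) ->
  vnorm zeta + vnorm nu / mu * (Rw + Cmod (l p' zeta)) <= S ->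
  Cmod Wh + 2 * K * S ^ 2 <= Rw ->
  K * S ^ 2 * L <= / 4 -> 4 * K * (vnorm nu / mu) * S <= / 4 ->
  exists a : C, let v := vadd zeta (cscale a nu) in
    shear chi p' v = Wh /\ vnorm v <= S /\ Cmod (l p' v) <= Rw /\
    Cmod a <= (Rw + Cmod (l p' zeta)) / mu.
Proof.
  intros Hl Hmu Hmul HS HRw HL Hrad HLR Hloc HSb HWb Hs1 Hs2.
  pose proof (vnorm_nonneg nu) as Hnu.
  assert (Hln : l p' nu <> RtoC 0) by (apply Cmod_gt_0; lra).
  (* The unknown becomes the value [w] of [l p']: [al w] is the coefficient of [nu] that produces
     it. *)
  set (al := fun w => Cdiv (Cminus w (l p' zeta)) (l p' nu)).
  set (v := fun w => vadd zeta (cscale (al w) nu)).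
  assert (Hlv : forall w, l p' (v w) = w).
  { intros w. unfold v. rewrite (proj1 Hl), (proj2 Hl). unfold al. field. exact Hln. }
  assert (Hdiv : forall u, Cmod (Cdiv u (l p' nu)) <= Cmod u / mu).
  { intros u. rewrite Cmod_div by exact Hln. unfold Rdiv. apply Rmult_le_compat_l; [apply Cmod_ge_0|].
    apply Rinv_le_contravar; lra. }
  assert (Hal : forall w, Cmod w <= Rw -> Cmod (al w) <= (Rw + Cmod (l p' zeta)) / mu).
  { intros w Hw. eapply Rle_trans; [apply Hdiv|]. unfold Rdiv.
    apply Rmult_le_compat_r; [left; now apply Rinv_0_lt_compat|].
    unfold Cminus. eapply Rle_trans; [apply Cmod_triangle|]. rewrite Cmod_opp. lra. }
  assert (Hv : forall w, Cmod w <= Rw -> vnorm (v w) <= S).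
  { intros w Hw. eapply Rle_trans; [|exact HSb]. eapply Rle_trans; [apply vnorm_triangle|].
    rewrite vnorm_cscale. pose proof (Hal w Hw).
    replace (vnorm nu / mu * (Rw + Cmod (l p' zeta))) with ((Rw + Cmod (l p' zeta)) / mu * vnorm nu)
      by (field; lra).
    apply Rplus_le_compat_l, Rmult_le_compat_r; lra. }
  assert (Hvd : forall w w', vnorm (vsub (v w) (v w')) <= vnorm nu / mu * Cmod (Cminus w w')).
  { intros w w'. replace (vsub (v w) (v w')) with (cscale (Cdiv (Cminus w w') (l p' nu)) nu).
    - rewrite vnorm_cscale. pose proof (Hdiv (Cminus w w')).
      replace (vnorm nu / mu * Cmod (Cminus w w')) with (Cmod (Cminus w w') / mu * vnorm nu) by (field; lra).
      apply Rmult_le_compat_r; lra.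
    - replace (Cdiv (Cminus w w') (l p' nu)) with (Cminus (al w) (al w'))
        by (unfold al; field; exact Hln). unfold v. vec. }
  assert (Hx1 : forall w, Cmod w <= Rw -> Cmod (chi w) <= 2).
  { intros w Hw. pose proof (Hloc w (RtoC 0)) as E. rewrite Cmod_0, (co_zero Hchi) in E.
    replace (Cminus w (RtoC 0)) with w in E by ring. specialize (E ltac:(lra) ltac:(lra)).
    replace (chi w) with (Cplus (Cminus (chi w) (RtoC 1)) (RtoC 1)) by ring.
    eapply Rle_trans; [apply Cmod_triangle|]. rewrite Cmod_1.
    assert (L * Cmod w <= L * Rw) by mono_l. lra. }
  assert (HAb : forall w, Cmod w <= Rw -> Cmod (A (v w) (v w)) <= K * S ^ 2).
  { intros w Hw. eapply Rle_trans; [apply (form_bound)|].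
    apply Rmult_le_compat_l; [lra|]. apply pow_incr. split; [apply vnorm_nonneg|now apply Hv]. }
  (* The two hypotheses with bound 1/4 control the variation of [chi] and that of [A]; their sum is
     the contraction factor 1/2. *)
  destruct (disc_contraction (fun w => Cplus Wh (Cmult (A (v w) (v w)) (chi w))) Rw) as [w [Hw Ew]].
  - exact HRw.
  - intros w Hw. eapply Rle_trans; [apply Cmod_triangle|]. rewrite Cmod_mult.
    pose proof (HAb w Hw). pose proof (Hx1 w Hw). pose proof (Cmod_ge_0 (A (v w) (v w))).
    pose proof (Cmod_ge_0 (chi w)).
    assert (Cmod (A (v w) (v w)) * Cmod (chi w) <= K * S ^ 2 * 2) by (apply Rmult_le_compat; lra). lra.
  - intros w w' Hw Hw'. set (d := Cmod (Cminus w w')). assert (Hd : 0 <= d) by apply Cmod_ge_0.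
    match goal with |- Cmod ?X <= _ => replace X with
      (Cplus (Cmult (A (v w) (v w)) (Cminus (chi w) (chi w')))
         (Cmult (Cminus (A (v w) (v w)) (A (v w') (v w'))) (chi w'))) by ring end.
    eapply Rle_trans; [apply Cmod_triangle|]. rewrite !Cmod_mult.
    assert (T1 : Cmod (A (v w) (v w)) * Cmod (Cminus (chi w) (chi w')) <= K * S ^ 2 * (L * d)).
    { apply Rmult_le_compat; auto using Cmod_ge_0. apply Hloc; lra. }
    assert (T2 : Cmod (Cminus (A (v w) (v w)) (A (v w') (v w'))) * Cmod (chi w')
                 <= K * (vnorm nu / mu * d) * (S + S) * 2).
    { apply Rmult_le_compat; auto using Cmod_ge_0.
      eapply Rle_trans; [apply (form_increment)|].
      pose proof (Hv w Hw). pose proof (Hv w' Hw'). pose proof (Hvd w w').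
      pose proof (vnorm_nonneg (v w)). pose proof (vnorm_nonneg (v w')).
      pose proof (vnorm_nonneg (vsub (v w) (v w'))).
      apply Rmult_le_compat; [mpos; lra|lra| |lra]. apply Rmult_le_compat_l; [lra|assumption]. }
    assert (T3 : K * S ^ 2 * L * d <= / 4 * d) by (apply Rmult_le_compat_r; assumption).
    assert (T4 : 4 * K * (vnorm nu / mu) * S * d <= / 4 * d) by (apply Rmult_le_compat_r; assumption).
    lra.
  - exists (al w). fold (v w). cbv zeta. rewrite Hlv. split; [|split; [now apply Hv|split; [exact Hw|now apply Hal]]].
    unfold shear. rewrite Hlv.
    transitivity (Cminus (Cplus Wh (Cmult (A (v w) (v w)) (chi w))) (Cmult (A (v w) (v w)) (chi w)));
      [|ring].
    f_equal. symmetry. exact Ew.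
Qed.

(** With [s = sqrt |b|], the preimage has size of order [s] and its value of [l] is of order [s^2].
    For [W] the prescribed value and [zeta] the prescribed tangential vector, [Re W - h zeta zeta]
    is at least [eps Re b / 4], hence at least [eps s^2 / 16]. The Taylor error, the deviation of
    [chi] from 1 and the component [a nu] each cost at most [eps s^2 / 64], so the solution lies in
    the domain. *)
Lemma image_lower (eps : R) : 0 < eps -> eps < 1 -> exists db r, 0 < db /\ 0 < r /\
  forall p', boundary Om p' -> vnorm (vsub p' p) < r ->
  forall b : C, 0 < fst b -> Cmod b < db -> Cmod b <= 4 * fst b ->
  forall (y : Cn n) (beta : C), h y nu = RtoC 0 ->
    fst (h y y) + Cmod beta ^ 2 <= (1 - eps) ^ 2 ->
    exists a : C,
      let v := vadd (cscale (Cdiv (RtoC (sqrt (fst b))) (Cminus (RtoC 1) beta)) y) (cscale a nu) in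
      Om (vadd p' v) /\
      shear chi p' v = Cdiv (Cplus b (Cmult (Cconj b) beta)) (Cminus (RtoC 1) beta).
Proof.
  intros He He1.
  pose proof (normal_mass_pos) as Hm.
  pose proof (vnorm_nonneg nu) as Hnu.
  destruct (co_local Hchi) as [rad [L [Hrad [HL Hloc]]]].
  set (G := vnorm nu / (m / 2)).
  assert (HG : 0 <= G) by (apply Rdiv_le_0_compat; lra).
  (* [|zeta| <= C9 s], because [c |zeta|^2 <= h zeta zeta <= |b| / |1 - beta|^2] and
     [|1 - beta| >= eps]. *)
  set (C9 := / (sqrt c * eps)).
  assert (Hsc : 0 < sqrt c) by now apply sqrt_lt_R0.
  assert (Hsc2 : sqrt c * sqrt c = c) by (apply sqrt_sqrt; lra).
  assert (HC9 : 0 < C9) by (apply Rinv_0_lt_compat; nra).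
  assert (HC9c : C9 ^ 2 * (c * eps ^ 2) = 1).
  { unfold C9. rewrite <- Hsc2 at 2. field. lra. }
  (* [C7 s] will bound the preimage and [C8 s^2] its value of [l]. In [C8], the summand [2 / eps]
     comes from the prescribed [W], the other from [A chi] with [|chi| <= 2]. *)
  set (C7 := C9 * (1 + G) + 1).
  assert (HC7 : 1 <= C7) by (unfold C7; nra).
  assert (HC72 : 0 <= C7 ^ 2) by apply pow2_ge_0.
  set (C8 := 2 / eps + 2 * K * C7 ^ 2).
  assert (H2e : 0 < 2 / eps) by div_pos.
  assert (HC8 : 0 < C8) by (unfold C8; nra).
  set (e1 := eps / (64 * (C7 ^ 2 + C8))).
  assert (He10 : 0 < e1) by div_pos.
  assert (Ee1 : e1 * (64 * (C7 ^ 2 + C8)) = eps) by (unfold e1; field; lra).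
  (* [e2] bounds both [C8 s] and [|l p' zeta| / s], whence [|a| <= 4 e2 s / m]; its size brings
     [|a|^2 m] below [eps s^2 / 64]. *)
  set (e2 := Rmin 1 (eps * m / 2048)).
  assert (He20 : 0 < e2) by (apply Rmin_glb_lt; nra).
  assert (He21 : e2 <= 1) by apply Rmin_l. assert (He22 : e2 <= eps * m / 2048) by apply Rmin_r.
  set (e3 := e2 / (C9 + 1)).
  assert (He30 : 0 < e3) by div_pos.
  assert (Ee3 : e3 * (C9 + 1) = e2) by (unfold e3; field; lra).
  assert (He31 : e3 <= 1) by nra.
  destruct (lm_taylor LM e1 He10) as [rT [HrT HT]].
  destruct (lm_cont LM e3 He30) as [r2 [Hr2 Hcont]].
  assert (HKL : 0 <= K * C7 ^ 2 * L) by (mpos; lra).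
  assert (Hsmall : small_enough (fun s => 1 * s <= 1 /\ C8 * s <= rad /\ L * C8 * s <= 1 /\ G * C8 * s <= 1 /\
    K * C7 ^ 2 * L * s <= / 4 /\ 4 * K * G * C7 * s <= / 4 /\ C7 * s <= rT / 2 /\
    K * C7 ^ 2 * L * C8 * s <= eps / 64 /\ C8 * s <= e2)).
  { repeat apply small_and; apply small_linear; try lra; mpos; lra. }
  destruct Hsmall as [s0 [Hs0 Hs]].
  exists (s0 ^ 2), (Rmin (Rmin rT r2) r1).
  split; [now apply pow_lt|]. split; [repeat apply Rmin_glb_lt; assumption|].
  intros p' Hp' Hpp b Hb Hbd Hb4 y beta Hy Hyb.
  pose proof (Rmin_l (Rmin rT r2) r1). pose proof (Rmin_r (Rmin rT r2) r1).
  pose proof (Rmin_l rT r2). pose proof (Rmin_r rT r2).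
  set (s := sqrt (Cmod b)). pose proof (Cmod_ge_0 b) as Hb0.
  assert (Hs2 : s ^ 2 = Cmod b) by (apply pow2_sqrt; exact Hb0).
  assert (Hsp : 0 <= s) by apply sqrt_pos.
  assert (Hss : s <= s0).
  { apply Rsqr_incr_0_var; [|lra]. rewrite !Rsqr_pow2. lra. }
  destruct (Hs s ltac:(lra)) as [S1 [S2 [S3 [S4 [S5 [S6 [S7 [S8 S9]]]]]]]].
  assert (Hs2s : s ^ 2 <= s)
    by (assert (s * s <= 1 * s) by mono_r; lra).
  assert (Hs20 : 0 <= s ^ 2) by apply pow2_ge_0.
  assert (Hup : forall D t, 0 <= D -> D * s <= t -> D * s ^ 2 <= t).
  { intros D t HD Ht. assert (D * s ^ 2 <= D * s) by (apply Rmult_le_compat_l; assumption). lra. }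
  set (d := Cminus (RtoC 1) beta).
  assert (Hbm : fst b <= Cmod b) by apply re_le_Cmod_self.
  assert (Hyy : 0 <= fst (h y y)).
  { eapply Rle_trans; [|apply (lm_h_low LM)]. apply Rmult_le_pos; [lra|apply pow2_ge_0]. }
  pose proof (Cmod_ge_0 beta) as Hbe0.
  assert (Hbe : Cmod beta <= 1 - eps).
  { apply Rsqr_incr_0_var; [|lra]. rewrite !Rsqr_pow2. lra. }
  assert (Hd1 : eps <= Cmod d).
  { pose proof (Cmod_minus_ge (RtoC 1) (Copp beta)) as E. rewrite Cmod_opp, Cmod_1 in E.
    unfold d, Cminus. lra. }
  assert (Hd2 : Cmod d <= 2).
  { unfold d, Cminus. eapply Rle_trans; [apply Cmod_triangle|]. rewrite Cmod_opp, Cmod_1. lra. }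
  assert (Hd0 : d <> RtoC 0) by (apply Cmod_gt_0; lra).
  assert (Hdsq : 0 < Cmod d ^ 2) by (apply pow_lt; lra).
  assert (Hdsq1 : eps ^ 2 <= Cmod d ^ 2) by (apply pow_incr; lra).
  assert (Hdsq2 : Cmod d ^ 2 <= 4)
    by (assert (Cmod d ^ 2 <= 2 ^ 2) by (apply pow_incr; lra); lra).
  set (Wh := Cdiv (Cplus b (Cmult (Cconj b) beta)) d).
  set (q := Cdiv (RtoC (sqrt (fst b))) d). set (zeta := cscale q y).
  assert (Hq2 : Cmod q ^ 2 = fst b / Cmod d ^ 2).
  { unfold q. rewrite Cmod_div by exact Hd0. rewrite Cmod_R, Rabs_pos_eq by apply sqrt_pos.
    unfold Rdiv. rewrite Rpow_mult_distr, pow2_sqrt, pow_inv by lra. reflexivity. }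
  assert (Hhz : fst (h zeta zeta) = fst b / Cmod d ^ 2 * fst (h y y)).
  { unfold zeta. rewrite herm_cscale, Hq2. reflexivity. }
  assert (Hznu : h zeta nu = RtoC 0).
  { unfold zeta. rewrite (proj2 (proj1 (lm_h LM) nu)), Hy. ring. }
  assert (Hgap : fst b * eps / 4 <= fst Wh - fst (h zeta zeta)).
  { unfold Wh. rewrite Hhz. unfold d. rewrite cayley_real_part by exact Hd0. fold d.
    replace (fst b * (1 - Cmod beta ^ 2) / Cmod d ^ 2 - fst b / Cmod d ^ 2 * fst (h y y))
      with (fst b * (1 - Cmod beta ^ 2 - fst (h y y)) / Cmod d ^ 2) by (field; lra).
    apply Rmult_le_reg_r with (Cmod d ^ 2); [exact Hdsq|].
    replace (fst b * (1 - Cmod beta ^ 2 - fst (h y y)) / Cmod d ^ 2 * Cmod d ^ 2)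
      with (fst b * (1 - Cmod beta ^ 2 - fst (h y y))) by (field; lra).
    apply Rle_trans with (fst b * eps).
    - assert (0 <= fst b * eps) by (apply Rmult_le_pos; lra).
      assert (fst b * eps / 4 * Cmod d ^ 2 <= fst b * eps / 4 * 4) by mono_l. lra.
    - apply Rmult_le_compat_l; [lra|].
      assert ((1 - eps) * (1 - eps) <= 1 * (1 - eps)) by mono_r. lra. }
  assert (HWh : Cmod Wh <= 2 / eps * s ^ 2).
  { unfold Wh. rewrite Cmod_div, Hs2 by exact Hd0.
    apply Rmult_le_reg_r with (Cmod d); [lra|].
    replace (Cmod (Cplus b (Cmult (Cconj b) beta)) / Cmod d * Cmod d)
      with (Cmod (Cplus b (Cmult (Cconj b) beta))) by (field; lra).
    apply Rle_trans with (2 * Cmod b).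
    - eapply Rle_trans; [apply Cmod_triangle|]. rewrite Cmod_mult, Cmod_conj.
      assert (Cmod b * Cmod beta <= Cmod b * 1) by mono_l. lra.
    - replace (2 / eps * Cmod b * Cmod d) with (2 * Cmod b * (Cmod d / eps)) by (field; lra).
      assert (1 <= Cmod d / eps).
      { apply Rmult_le_reg_r with eps; [lra|]. replace (Cmod d / eps * eps) with (Cmod d) by (field; lra). lra. }
      assert (2 * Cmod b * 1 <= 2 * Cmod b * (Cmod d / eps)) by mono_l. lra. }
  assert (Hzn : vnorm zeta <= C9 * s).
  { apply Rsqr_incr_0_var; [|apply Rmult_le_pos; lra]. rewrite !Rsqr_pow2.
    apply Rmult_le_reg_r with (c * eps ^ 2); [mposs; [lra|now apply pow_lt]|].
    replace ((C9 * s) ^ 2 * (c * eps ^ 2)) with (C9 ^ 2 * (c * eps ^ 2) * s ^ 2) by ring.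
    rewrite HC9c, Hs2, Rmult_1_l.
    pose proof (lm_h_low LM zeta) as E. rewrite Hhz in E.
    assert (Hy1 : fst (h y y) <= 1).
    { pose proof (pow2_ge_0 (Cmod beta)). assert ((1 - eps) ^ 2 <= 1 ^ 2) by (apply pow_incr; lra). lra. }
    assert (E2 : fst b / Cmod d ^ 2 * fst (h y y) * Cmod d ^ 2 = fst b * fst (h y y)) by (field; lra).
    assert (E3 : c * vnorm zeta ^ 2 * Cmod d ^ 2 <= fst b * fst (h y y)).
    { rewrite <- E2. apply Rmult_le_compat_r; lra. }
    assert (E4 : c * vnorm zeta ^ 2 * eps ^ 2 <= c * vnorm zeta ^ 2 * Cmod d ^ 2).
    { apply Rmult_le_compat_l; [|exact Hdsq1]. apply Rmult_le_pos; [lra|apply pow2_ge_0]. }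
    assert (E5 : fst b * fst (h y y) <= fst b * 1) by mono_l. lra. }
  (* [zeta] is [h]-orthogonal to [nu], so [l p zeta = 0] and only the difference between [l p'] and
     [l p] remains. *)
  assert (Hlz : Cmod (l p' zeta) <= e3 * vnorm zeta).
  { pose proof (Hcont p' Hp' ltac:(lra) zeta) as E.
    rewrite (lm_nu LM zeta), Hznu in E.
    replace (Cminus (l p' zeta) (RtoC 0)) with (l p' zeta) in E by ring. exact E. }
  pose proof (vnorm_nonneg zeta) as Hzn0. pose proof (Cmod_ge_0 (l p' zeta)) as Hlz0.
  assert (Hlz1 : Cmod (l p' zeta) <= C9 * s)
    by (assert (e3 * vnorm zeta <= 1 * vnorm zeta) by mono_r; lra).
  assert (Hlz2 : Cmod (l p' zeta) <= e2 * s).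
  { assert (e3 * vnorm zeta <= e3 * (C9 * s)) by mono_l.
    assert (e3 * C9 * s <= e2 * s) by mono_r. lra. }
  assert (HS2 : (C7 * s) ^ 2 = C7 ^ 2 * s ^ 2) by ring.
  assert (Hln := Hnorm p' Hp' ltac:(lra)).
  destruct (shear_solve p' zeta Wh (m / 2) (C7 * s) (C8 * s ^ 2) rad L) as [a [Ea [Hva [Hwa Haa]]]].
  - apply (lm_l LM p' Hp'). lra.
  - lra.
  - exact Hln.
  - apply Rmult_le_pos; lra.
  - apply Rmult_le_pos; lra.
  - exact HL.
  - apply Hup; lra.
  - rewrite <- Rmult_assoc. apply Hup; [apply Rmult_le_pos; lra|exact S3].
  - exact Hloc.
  - fold G. assert (G * C8 * s ^ 2 <= s).
    { replace (G * C8 * s ^ 2) with (G * C8 * s * s) by ring.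
      assert (G * C8 * s * s <= 1 * s) by mono_r. lra. }
    assert (G * Cmod (l p' zeta) <= G * (C9 * s)) by mono_l.
    unfold C7. lra.
  - rewrite HS2. unfold C8. lra.
  - rewrite HS2. replace (K * (C7 ^ 2 * s ^ 2) * L) with (K * C7 ^ 2 * L * s ^ 2) by ring.
    apply Hup; [exact HKL|exact S5].
  - fold G. lra.
  - exists a. split; [|exact Ea]. set (v := vadd zeta (cscale a nu)) in *.
    set (w := l p' v) in *.
    apply (proj2 (HT p' v Hp' ltac:(lra) ltac:(lra))). fold w.
    pose proof (vnorm_nonneg v) as Hv0.
    assert (Hv2 : vnorm v ^ 2 <= C7 ^ 2 * s ^ 2) by (rewrite <- HS2; apply pow_incr; lra).
    assert (Hwr : Rabs (fst w) <= C8 * s ^ 2) by (eapply Rle_trans; [apply fst_le_Cmod|exact Hwa]).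
    assert (Hx1 : Cmod (Cminus (chi w) (RtoC 1)) <= L * (C8 * s ^ 2)).
    { pose proof (Hloc w (RtoC 0)) as E. rewrite Cmod_0, (co_zero Hchi) in E.
      replace (Cminus w (RtoC 0)) with w in E by ring.
      assert (C8 * s ^ 2 <= rad) by (apply Hup; lra). specialize (E ltac:(lra) ltac:(lra)).
      assert (L * Cmod w <= L * (C8 * s ^ 2)) by mono_l. lra. }
    set (g := Cmult (A v v) (Cminus (chi w) (RtoC 1))).
    assert (Hg : - fst g <= eps / 64 * s ^ 2).
    { eapply Rle_trans; [apply Rle_abs|]. rewrite Rabs_Ropp.
      eapply Rle_trans; [apply fst_le_Cmod|]. unfold g. rewrite Cmod_mult.
      assert (E1 : Cmod (A v v) * Cmod (Cminus (chi w) (RtoC 1)) <= K * (C7 ^ 2 * s ^ 2) * (L * (C8 * s ^ 2))).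
      { apply Rmult_le_compat; auto using Cmod_ge_0.
        eapply Rle_trans; [apply (form_bound)|].
        apply Rmult_le_compat_l; lra. }
      assert (E2 : K * C7 ^ 2 * L * C8 * s ^ 2 <= eps / 64) by (apply Hup; [mpos; lra|exact S8]).
      assert (E3 : K * C7 ^ 2 * L * C8 * s ^ 2 * s ^ 2 <= eps / 64 * s ^ 2)
        by (apply Rmult_le_compat_r; assumption).
      lra. }
    assert (Ew : fst w = fst Wh + fst (A v v) + fst g).
    { rewrite <- Ea. unfold shear. fold w. unfold g. simpl. ring. }
    assert (Ha2 : Cmod a ^ 2 * m <= eps / 64 * s ^ 2).
    { assert (E1 : Cmod a <= 4 * e2 * s / m).
      { eapply Rle_trans; [exact Haa|].
        replace ((C8 * s ^ 2 + Cmod (l p' zeta)) / (m / 2)) with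
          (2 / m * (C8 * s * s + Cmod (l p' zeta))) by (field; lra).
        replace (4 * e2 * s / m) with (2 / m * (2 * e2 * s)) by (field; lra).
        apply Rmult_le_compat_l; [left; div_pos|].
        assert (C8 * s * s <= e2 * s) by mono_r. lra. }
      assert (E2 : Cmod a ^ 2 <= (4 * e2 * s / m) ^ 2) by (apply pow_incr; split; [apply Cmod_ge_0|exact E1]).
      assert (E3 : (4 * e2 * s / m) ^ 2 * m = 16 / m * e2 ^ 2 * s ^ 2) by (field; lra).
      assert (E4 : Cmod a ^ 2 * m <= (4 * e2 * s / m) ^ 2 * m) by mono_r.
      assert (E5 : 16 / m * e2 ^ 2 <= eps / 64).
      { apply Rmult_le_reg_r with m; [exact Hm|].
        replace (16 / m * e2 ^ 2 * m) with (16 * e2 ^ 2) by (field; lra).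
        assert (e2 * e2 <= 1 * e2) by mono_r.
        assert (0 < eps * m) by (apply Rmult_lt_0_compat; lra). lra. }
      assert (E6 : 16 / m * e2 ^ 2 * s ^ 2 <= eps / 64 * s ^ 2) by (apply Rmult_le_compat_r; assumption).
      lra. }
    assert (Hhv : fst (h v v) = fst (h zeta zeta) + Cmod a ^ 2 * m) by (now apply herm_orthogonal_sum).
    assert (He1b : e1 * (vnorm v ^ 2 + Rabs (fst w)) <= eps / 64 * s ^ 2).
    { assert (E1 : e1 * (vnorm v ^ 2 + Rabs (fst w)) <= e1 * ((C7 ^ 2 + C8) * s ^ 2))
        by mono_l.
      assert (E2 : e1 * ((C7 ^ 2 + C8) * s ^ 2) = e1 * (64 * (C7 ^ 2 + C8)) * / 64 * s ^ 2) by field.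
      rewrite Ee1 in E2. lra. }
    assert (Hfb : eps / 16 * s ^ 2 <= fst b * eps / 4).
    { rewrite Hs2. assert (eps * Cmod b <= eps * (4 * fst b)) by mono_l. lra. }
    assert (0 < eps * s ^ 2) by (rewrite Hs2; apply Rmult_lt_0_compat; lra).
    rewrite Ew, Hhv. rewrite Ew in He1b. lra.
Qed.

End Cutoff.

(** * Cayley transform onto the unit ball of [h] *)

Definition ncoord (v : Cn n) : C := Cdiv (l p v) (RtoC m).
Definition tangential (v : Cn n) : Cn n := vsub v (cscale (ncoord v) nu).

Lemma m_neq0 : RtoC m <> RtoC 0.
Proof.
  intros E. apply (f_equal fst) in E. simpl in E.
  pose proof (normal_mass_pos).  lra.
Qed.

Lemma lp_clinear : clinear (l p).
Proof.
  pose proof (lm_h LM) as [Hl _].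
  pose proof (lm_nu LM) as Hn.
  split; intros; rewrite !Hn; [apply (Hl nu)|apply (proj2 (Hl nu))].
Qed.

Lemma h_nu_nu : h nu nu = RtoC m.
Proof.
  rewrite <- (lm_nu LM). apply (normal_mass_real).
Qed.

Lemma tangential_orthogonal (v : Cn n) : h (tangential v) nu = RtoC 0.
Proof.
  pose proof (proj1 (lm_h LM) nu) as Hl.
  unfold tangential. rewrite (clinear_vsub _ _ _ Hl), (proj2 Hl), h_nu_nu.
  rewrite <- (lm_nu LM). unfold ncoord. field. exact m_neq0.
Qed.

Lemma tangential_split (v : Cn n) : vadd (tangential v) (cscale (ncoord v) nu) = v.
Proof. unfold tangential. vec. Qed.

Lemma herm_split (v : Cn n) : fst (h v v) = fst (h (tangential v) (tangential v)) + Cmod (ncoord v) ^ 2 * m.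
Proof.
  rewrite <- (tangential_split v) at 1 2.
  apply (herm_orthogonal_sum), tangential_orthogonal.
Qed.

Lemma ncoord_clinear : clinear ncoord.
Proof.
  pose proof lp_clinear as [H1 H2]. split; intros; unfold ncoord; rewrite ?H1, ?H2; field; exact m_neq0.
Qed.

Lemma ncoord_sum (y : Cn n) (a : C) : h y nu = RtoC 0 -> ncoord (vadd y (cscale a nu)) = a.
Proof.
  intros Hy. unfold ncoord. rewrite (proj1 lp_clinear), (proj2 lp_clinear).
  rewrite (normal_mass_real), (lm_nu LM), Hy.
  fold m. field. exact m_neq0.
Qed.

Lemma tangential_sum (y : Cn n) (a : C) : h y nu = RtoC 0 -> tangential (vadd y (cscale a nu)) = y.
Proof. intros Hy. unfold tangential. rewrite ncoord_sum by exact Hy. vec. Qed.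

(** The Cayley transform of the Siegel domain in the coordinates (tangential part, [W]), with the
    point (0, [b]) sent to 0; [nu / sqrt m] is the [h]-unit normal. [W] is a separate argument so
    that the modified normal coordinate can be inserted. *)
Definition ball_map (W b : C) (v : Cn n) : Cn n :=
  vadd (cscale (Cdiv (RtoC (2 * sqrt (fst b))) (Cplus W (Cconj b))) (tangential v))
       (cscale (Cdiv (Cdiv (Cminus W b) (Cplus W (Cconj b))) (RtoC (sqrt m))) nu).

Lemma sqrt_m : 0 < sqrt m /\ sqrt m ^ 2 = m.
Proof.
  pose proof (normal_mass_pos) as Hm.
  split; [now apply sqrt_lt_R0|apply pow2_sqrt; lra].
Qed.

Lemma sqrt_m_neq0 : RtoC (sqrt m) <> RtoC 0.
Proof. intros E. apply (f_equal fst) in E. simpl in E. pose proof sqrt_m. lra. Qed.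

Lemma ball_map_orthogonal (W b : C) (v : Cn n) :
  h (cscale (Cdiv (RtoC (2 * sqrt (fst b))) (Cplus W (Cconj b))) (tangential v)) nu = RtoC 0.
Proof.
  rewrite (proj2 (proj1 (lm_h LM) nu)), tangential_orthogonal. ring.
Qed.

(** Pythagoras for [h], then the reflection identity for the normal component: the squared norm is
    below 1 exactly when [Re W] exceeds [h] at the tangential part. *)
Lemma ball_map_norm (W b : C) (v : Cn n) : 0 < fst b -> 0 <= fst W ->
  fst (h (ball_map W b v) (ball_map W b v)) * Cmod (Cplus W (Cconj b)) ^ 2
  = Cmod (Cplus W (Cconj b)) ^ 2 + 4 * fst b * (fst (h (tangential v) (tangential v)) - fst W).
Proof.
  intros Hb HW.
  assert (D : Cplus W (Cconj b) <> RtoC 0)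
    by (intros F; apply (f_equal fst) in F; simpl in F; lra).
  pose proof (proj1 (Cmod_gt_0 _) D) as Hd.
  unfold ball_map. rewrite (herm_orthogonal_sum) by apply ball_map_orthogonal.
  rewrite (herm_cscale). fold m.
  rewrite (Cmod_div _ _ sqrt_m_neq0), !(Cmod_div _ _ D), !Cmod_R.
  pose proof (sqrt_pos (fst b)). pose proof sqrt_m as [Hm1 Hm2].
  rewrite !Rabs_pos_eq by lra. set (d := Cmod (Cplus W (Cconj b))) in *.
  set (x := fst (h (tangential v) (tangential v))).
  replace (((2 * sqrt (fst b) / d) ^ 2 * x + (Cmod (Cminus W b) / d / sqrt m) ^ 2 * m) * d ^ 2)
    with (4 * sqrt (fst b) ^ 2 * x + Cmod (Cminus W b) ^ 2 * (m / sqrt m ^ 2)) by (field; lra).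
  rewrite Hm2, pow2_sqrt, Cmod_reflection by lra. fold d. field.
  pose proof (normal_mass_pos). lra.
Qed.

(** The map sees only [W] and the tangential part, so a displacement along [nu] remains
    undetermined; injectivity of the modified coordinate on lines parallel to [nu] removes it. *)
Lemma ball_map_injective (W1 W2 b : C) (v1 v2 : Cn n) : 0 < fst b -> 0 <= fst W1 -> 0 <= fst W2 ->
  ball_map W1 b v1 = ball_map W2 b v2 -> W1 = W2 /\ exists a, vsub v1 v2 = cscale a nu.
Proof.
  intros Hb H1 H2 E.
  assert (EW : W1 = W2).
  { apply (cayley_injective W1 W2 b Hb H1 H2).
    apply (f_equal ncoord) in E. unfold ball_map in E.
    rewrite !ncoord_sum in E by apply ball_map_orthogonal.
    apply (f_equal (fun x => Cmult x (RtoC (sqrt m)))) in E.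
    assert (Hx : forall x, Cmult (Cdiv x (RtoC (sqrt m))) (RtoC (sqrt m)) = x)
      by (intros x; field; exact sqrt_m_neq0).
    rewrite !Hx in E. exact E. }
  split; [exact EW|]. subst W2.
  set (al := Cdiv (RtoC (2 * sqrt (fst b))) (Cplus W1 (Cconj b))).
  assert (D : Cplus W1 (Cconj b) <> RtoC 0)
    by (intros F; apply (f_equal fst) in F; simpl in F; lra).
  assert (Hal : al <> RtoC 0).
  { apply Cmod_gt_0. unfold al. rewrite Cmod_div, Cmod_R by exact D.
    pose proof (sqrt_lt_R0 (fst b) Hb). rewrite Rabs_pos_eq by lra.
    apply Rdiv_lt_0_compat; [lra|]. now apply Cmod_gt_0. }
  apply (f_equal tangential) in E. unfold ball_map in E.
  rewrite !tangential_sum in E by apply ball_map_orthogonal. fold al in E.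
  assert (Et : tangential v1 = tangential v2).
  { fext j. apply (f_equal (fun u => u j)) in E.
    unfold cscale in E.
    transitivity (Cmult (Cinv al) (Cmult al (tangential v1 j))).
    - rewrite Cmult_assoc, Cinv_l, Cmult_1_l by exact Hal. reflexivity.
    - rewrite E, Cmult_assoc, Cinv_l, Cmult_1_l by exact Hal. reflexivity. }
  exists (Cminus (ncoord v1) (ncoord v2)).
  rewrite <- (tangential_split v1) at 1. rewrite <- (tangential_split v2) at 1. rewrite Et. vec.
Qed.

(** The arguments are the inverse Cayley transform of ([y], [beta]): there
    [W + conj b = 2 Re b / (1 - beta)] and [W - b = 2 Re b beta / (1 - beta)]. *)
Lemma ball_map_solution (b beta : C) (y : Cn n) (a : C) : 0 < fst b -> Cmod beta < 1 ->
  h y nu = RtoC 0 ->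
  ball_map (Cdiv (Cplus b (Cmult (Cconj b) beta)) (Cminus (RtoC 1) beta)) b
    (vadd (cscale (Cdiv (RtoC (sqrt (fst b))) (Cminus (RtoC 1) beta)) y) (cscale a nu))
  = vadd y (cscale (Cdiv beta (RtoC (sqrt m))) nu).
Proof.
  intros Hb Hbe Hy.
  assert (Hd : Cminus (RtoC 1) beta <> RtoC 0).
  { intros E. assert (E' : beta = RtoC 1).
    { replace beta with (Cminus (RtoC 1) (Cminus (RtoC 1) beta)) by ring. rewrite E. ring. }
    rewrite E', Cmod_1 in Hbe. lra. }
  set (s := sqrt (fst b)). assert (Hs : 0 < s) by now apply sqrt_lt_R0.
  assert (Hs2 : Cplus b (Cconj b) = Cmult (RtoC 2) (Cmult (RtoC s) (RtoC s))).
  { rewrite <- RtoC_mult. unfold s. rewrite sqrt_sqrt by lra.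
    cpair. }
  assert (Hsn : RtoC s <> RtoC 0) by (intros E; apply (f_equal fst) in E; simpl in E; lra).
  assert (H2n : RtoC 2 <> RtoC 0) by (intros E; apply (f_equal fst) in E; simpl in E; lra).
  unfold ball_map. rewrite tangential_sum.
  2:{ rewrite (proj2 (proj1 (lm_h LM) nu)), Hy. ring. }
  set (d := Cminus (RtoC 1) beta) in *. fold s.
  set (W := Cdiv (Cplus b (Cmult (Cconj b) beta)) d).
  assert (EW : Cplus W (Cconj b) = Cdiv (Cmult (RtoC 2) (Cmult (RtoC s) (RtoC s))) d).
  { rewrite <- Hs2. unfold W. transitivity (Cdiv (Cplus (Cplus b (Cmult (Cconj b) beta)) (Cmult (Cconj b) d)) d).
    - field. exact Hd.
    - f_equal. unfold d. ring. }
  assert (EW' : Cminus W b = Cdiv (Cmult (Cmult (RtoC 2) (Cmult (RtoC s) (RtoC s))) beta) d).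
  { rewrite <- Hs2. unfold W. transitivity (Cdiv (Cminus (Cplus b (Cmult (Cconj b) beta)) (Cmult b d)) d).
    - field. exact Hd.
    - f_equal. unfold d. ring. }
  rewrite EW, EW'. f_equal.
  - assert (E1 : Cmult (Cdiv (RtoC (2 * s)) (Cdiv (Cmult (RtoC 2) (Cmult (RtoC s) (RtoC s))) d))
                  (Cdiv (RtoC s) d) = RtoC 1).
    { rewrite RtoC_mult. field. auto. }
    transitivity (cscale (Cmult (Cdiv (RtoC (2 * s)) (Cdiv (Cmult (RtoC 2) (Cmult (RtoC s) (RtoC s))) d))
                  (Cdiv (RtoC s) d)) y); [vec|rewrite E1; vec].
  - f_equal. field. repeat split; auto using sqrt_m_neq0.
Qed.

Lemma ball_map_center (b : C) (t : R) : ball_map b b (vscale t nu) = vzero.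
Proof.
  unfold ball_map.
  replace (vscale t nu) with (vadd vzero (cscale (RtoC t) nu)) by vec.
  rewrite tangential_sum.
  - replace (Cminus b b) with (RtoC 0) by ring. unfold Cdiv. rewrite !Cmult_0_l. vec.
  - apply (clinear_vzero (fun v => h v nu)), (lm_h LM).
Qed.

(** The map is [ball_map], then the isometry [T], then division by [1 + eps]. Before the division
    the squared norm is at most [1 + eps] and the ball of radius [1 - eps] is covered, which
    explains the quotient. *)
Lemma squeeze_near (eps : R) : 0 < eps -> eps < 1 ->
  near p (fun q => Om q -> squeeze_radii Om q ((1 - eps) / (1 + eps))).
Proof.
  intros He He1.
  destruct (shear_exists) as
    [chi [kap [tau [c3 [r1 [Hchi [Hc3 [Hr1 [Hr10 Hsh]]]]]]]]].
  destruct (image_upper chi kap tau c3 r1 Hchi Hc3 Hr1 Hr10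
    (fun p' H1 H2 => proj1 (proj2 (Hsh p' H1 H2))) eps He) as [db1 [s1 [Hdb1 [Hs1 HU]]]].
  destruct (image_lower chi kap tau r1 Hchi Hr1 Hr10
    (fun p' H1 H2 => proj1 (Hsh p' H1 H2)) eps He He1) as [db2 [s2 [Hdb2 [Hs2 HL]]]].
  pose proof (normal_mass_pos) as Hm.
  pose proof (sqrt_m) as Hsqm.
 
  (* Two errors of relative size 1/8, from [l p' nu] and from [t A nu nu], give
     [|b - t m| <= t m / 4]; hence [|b| <= 5/4 t m <= 4 Re b], the cone condition of both
     estimates. *)
  destruct (normal_near (m / 8)) as [s3 [Hs3 HN]]; [lra|].
  
  destruct (small_and _ _ (small_linear (Cmod (A nu nu)) (m / 8) (Cmod_ge_0 _) ltac:(lra))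
    (small_linear (5 / 4 * m) (Rmin db1 db2 / 2) ltac:(lra)
       ltac:(assert (0 < Rmin db1 db2) by (now apply Rmin_glb_lt); lra))) as [s4 [Hs4 Hsm]].
  set (r := Rmin (Rmin (Rmin s1 s2) (Rmin s3 s4)) r1).
  assert (Hr : 0 < r) by (unfold r; repeat apply Rmin_glb_lt; assumption).
  assert (r <= s1 /\ r <= s2 /\ r <= s3 /\ r <= s4 /\ r <= r1) as [R1 [R2 [R3 [R4 R5]]]].
  { unfold r. pose proof (Rmin_l (Rmin (Rmin s1 s2) (Rmin s3 s4)) r1).
    pose proof (Rmin_r (Rmin (Rmin s1 s2) (Rmin s3 s4)) r1).
    pose proof (Rmin_l (Rmin s1 s2) (Rmin s3 s4)). pose proof (Rmin_r (Rmin s1 s2) (Rmin s3 s4)).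
    pose proof (Rmin_l s1 s2). pose proof (Rmin_r s1 s2).
    pose proof (Rmin_l s3 s4). pose proof (Rmin_r s3 s4). repeat split; lra. }
  eapply near_imp; [|exact (lm_exit LM r Hr)].
  cbv beta. intros q Hq Hqo. destruct (Hq Hqo) as [p' [t [Hp' [Hpp [Ht ->]]]]]. clear Hq.
  specialize (HU p' Hp' ltac:(lra)). specialize (HL p' Hp' ltac:(lra)).
  specialize (HN p' Hp' ltac:(lra)). destruct (Hsh p' Hp' ltac:(lra)) as [_ [_ Hinj]]. clear Hsh.
  destruct (Hsm t ltac:(lra)) as [T1 T2].
  assert (Hlc := lm_l LM p' Hp' ltac:(lra)).
  pose proof (lm_A LM) as HA. pose proof (lm_A_sym LM) as HAs.
  (* The centre is the modified normal coordinate of the given point [p' + t nu] itself, so that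
     this point goes exactly to 0; [b] may be non-real. *)
  set (b := shear chi p' (vscale t nu)).
  assert (Elt : l p' (vscale t nu) = Cmult (RtoC t) (l p' nu))
    by (rewrite vscale_cscale; apply (proj2 Hlc)).
  assert (EAt : A (vscale t nu) (vscale t nu) = Cmult (RtoC (t * t)) (A nu nu)).
  { rewrite vscale_cscale, (proj2 (HA _)), (HAs nu (cscale (RtoC t) nu)), (proj2 (HA _)), RtoC_mult. ring. }
  assert (Hlre : 0 <= fst (l p' (vscale t nu))).
  { rewrite Elt, fst_scal. apply Rmult_le_pos; [lra|].
    pose proof (fst_le_Cmod (Cminus (l p' nu) (RtoC m))) as E. simpl in E.
    apply Rabs_le_between in E. lra. }
  assert (Hbt : Cmod (Cminus b (RtoC (t * m))) <= t * m / 4).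
  { unfold b, shear. set (x := chi (l p' (vscale t nu))).
    assert (Hx : Cmod x <= 1) by (apply (co_mod Hchi); exact Hlre).
    rewrite Elt, EAt.
    replace (Cminus (Cminus (Cmult (RtoC t) (l p' nu)) (Cmult (Cmult (RtoC (t * t)) (A nu nu)) x)) (RtoC (t * m)))
      with (Cplus (Cmult (RtoC t) (Cminus (l p' nu) (RtoC m)))
                  (Copp (Cmult (RtoC t) (Cmult (Cmult (RtoC t) (A nu nu)) x))))
      by (rewrite !RtoC_mult; ring).
    eapply Rle_trans; [apply Cmod_triangle|].
    rewrite Cmod_opp, !Cmod_mult, !Cmod_R, !Rabs_pos_eq by lra.
    pose proof (Cmod_ge_0 (A nu nu)). pose proof (Cmod_ge_0 x).
    assert (0 <= Cmod (A nu nu) * t) by (apply Rmult_le_pos; lra).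
    assert (E1 : Cmod (A nu nu) * t * Cmod x <= m / 8 * 1) by (apply Rmult_le_compat; lra).
    assert (E2 : t * (t * Cmod (A nu nu) * Cmod x) <= t * (m / 8)) by mono_l.
    assert (E3 : t * Cmod (Cminus (l p' nu) (RtoC m)) <= t * (m / 8)) by mono_l.
    lra. }
  assert (Htm : 0 < t * m) by (apply Rmult_lt_0_compat; lra).
  assert (Hb1 : 3 / 4 * (t * m) <= fst b).
  { pose proof (fst_le_Cmod (Cminus b (RtoC (t * m)))) as E.
    change (fst (Cminus b (RtoC (t * m)))) with (fst b - t * m) in E.
    apply Rabs_le_between in E. lra. }
  assert (Hb2 : Cmod b <= 5 / 4 * (t * m)).
  { replace b with (Cplus (Cminus b (RtoC (t * m))) (RtoC (t * m))) by ring.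
    eapply Rle_trans; [apply Cmod_triangle|]. rewrite Cmod_R, Rabs_pos_eq by lra. lra. }
  assert (Hb0 : 0 < fst b) by lra. assert (Hb4 : Cmod b <= 4 * fst b) by lra.
  assert (Hbdb : Cmod b < db1 /\ Cmod b < db2).
  { pose proof (Rmin_l db1 db2). pose proof (Rmin_r db1 db2). split; lra. }
  specialize (HU b Hb0 (proj1 Hbdb) Hb4). specialize (HL b Hb0 (proj2 Hbdb) Hb4). cbv zeta in HU, HL.
  pose proof (lm_h LM) as Hh.
  assert (Hhp : forall v, v <> vzero -> 0 < fst (h v v)).
  { intros v Hv. pose proof (lm_h_low LM v). pose proof (vnorm_pos v Hv).
    pose proof (lm_c LM). assert (0 < vnorm v ^ 2) by now apply pow_lt. nra. }
  destruct (herm_isometry h Hh Hhp) as [T [HTl [HTn HTs]]].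
  assert (HT0 : T vzero = vzero).
  { fext j. apply (clinear_vzero _ (HTl j)). }
  assert (HTi : forall u v, T u = T v -> u = v).
  { intros u v E. apply vsub_eq_zero. apply NNPP. intros Hne. apply Hhp in Hne. rewrite <- HTn in Hne.
    replace (T (vsub u v)) with (@vzero n) in Hne; [rewrite vnorm_vzero in Hne; lra|].
    fext j. rewrite (clinear_vsub _ u v (HTl j)), E.
    unfold vzero. cpair. }
  set (W := fun z => shear chi p' (vsub z p')).
  set (F := fun z => ball_map (W z) b (vsub z p')).
  set (f := fun z => vscale (/ (1 + eps)) (T (F z))).
  assert (Hie : 0 < / (1 + eps)) by (apply Rinv_0_lt_compat; lra).
  split; [div_pos|]. exists f. split; [split; [|split; [|split]]|].
  - intros z Hz. apply holo_at_of_components. intros j.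
    assert (HW : chol W z).
    { unfold W, shear. apply chol_minus; [apply (chol_affine (l p') p' z Hlc)|].
      apply chol_mult.
      - apply (chol_quadratic A K); [exact HA|exact HAs|exact HK|exact (lm_A_up LM)].
      - apply (co_chol Hchi n (fun z => l p' (vsub z p')) z (chol_affine (l p') p' z Hlc)).
        eapply Rle_trans; [|apply (lm_support LM p' Hp' ltac:(lra) z Hz)].
        apply Rmult_le_pos; [left; apply (lm_c LM)|apply pow2_ge_0]. }
    assert (HWz : Cplus (W z) (Cconj b) <> RtoC 0).
    { destruct (HU z Hz) as [H0 _]. fold (W z) in H0.
      intros E. apply (f_equal fst) in E.
      change (fst (W z) + fst b = 0) in E. lra. }
    assert (Hden : chol (fun z => Cinv (Cplus (W z) (Cconj b))) z)
      by (apply (chol_inv (fun z => Cplus (W z) (Cconj b))); [apply chol_plus; [exact HW|apply chol_const]|exact HWz]).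
    set (lt := fun v => T (tangential v) j).
    assert (Hlt : clinear lt).
    { pose proof (ncoord_clinear) as [N1 N2]. unfold lt, tangential. split.
      - intros u v. rewrite !(clinear_vsub _ _ _ (HTl j)), !(proj2 (HTl j)), (proj1 (HTl j)), N1. ring.
      - intros a v. rewrite !(clinear_vsub _ _ _ (HTl j)), !(proj2 (HTl j)), N2. ring. }
    replace (fun v => f v j) with (fun z => Cmult (RtoC (/ (1 + eps)))
      (Cplus (Cmult (Cmult (RtoC (2 * sqrt (fst b))) (Cinv (Cplus (W z) (Cconj b)))) (lt (vsub z p')))
             (Cmult (Cmult (Cmult (Cminus (W z) b) (Cinv (Cplus (W z) (Cconj b)))) (Cinv (RtoC (sqrt m))))
                (T nu j)))).
    + apply chol_mult; [apply chol_const|]. apply chol_plus.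
      * apply chol_mult; [apply chol_mult; [apply chol_const|exact Hden]|now apply chol_affine].
      * apply chol_mult; [|apply chol_const]. apply chol_mult; [|apply chol_const].
        apply chol_mult; [|exact Hden]. apply chol_minus; [exact HW|apply chol_const].
    + apply functional_extensionality. intros w. unfold f, F, ball_map.
      rewrite vscale_cscale. unfold cscale at 1. f_equal.
      rewrite (proj1 (HTl j)), !(proj2 (HTl j)). reflexivity.
  - intros z w Hz Hw E.
    assert (EF : F z = F w).
    { apply HTi. fext j. apply (f_equal (fun u => u j)) in E.
      unfold f, vscale in E. apply injective_projections.
      - apply (f_equal fst) in E. simpl in E. apply Rmult_eq_reg_l in E; lra.
      - apply (f_equal snd) in E. simpl in E. apply Rmult_eq_reg_l in E; lra. }
    destruct (HU z Hz) as [Hz0 _], (HU w Hw) as [Hw0 _].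
    destruct (ball_map_injective _ _ _ _ _ Hb0 Hz0 Hw0 EF) as [EW [a Ea]].
    apply (Hinj z w a Hz Hw); [|exact EW].
    rewrite <- Ea. vec.
  - intros z Hz. destruct (HU z Hz) as [Hz0 Hz1]. fold (W z) in Hz0, Hz1.
    pose proof (ball_map_norm (W z) b (vsub z p') Hb0 Hz0) as E. fold (F z) in E.
    set (d := Cmod (Cplus (W z) (Cconj b)) ^ 2) in *.
    assert (Hd : 0 < d).
    { apply pow_lt. pose proof (re_le_Cmod_self (Cplus (W z) (Cconj b))) as H.
      change (fst (W z) + fst b <= Cmod (Cplus (W z) (Cconj b))) in H. lra. }
    (* Passes from the full form in the outer estimate to its tangential part in the norm
       formula. *)
    assert (Htan : fst (h (tangential (vsub z p')) (tangential (vsub z p')))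
                   <= fst (h (vsub z p') (vsub z p'))).
    { rewrite (herm_split (vsub z p')). fold m.
      pose proof (pow2_ge_0 (Cmod (ncoord (vsub z p')))). nra. }
    assert (HF : fst (h (F z) (F z)) <= 1 + eps).
    { apply Rmult_le_reg_r with d; [exact Hd|]. rewrite E. nra. }
    unfold f. rewrite vnorm_vscale, Rabs_pos_eq by lra.
    assert (HTF : vnorm (T (F z)) < 1 + eps).
    { apply Rsqr_incrst_0; [|apply vnorm_nonneg|lra]. rewrite !Rsqr_pow2, HTn. nra. }
    apply Rmult_lt_reg_l with (1 + eps); [lra|]. rewrite <- Rmult_assoc, Rinv_r, Rmult_1_l by lra. lra.
  - unfold f, F, W. rewrite vsub_vadd. fold b.
    rewrite (ball_map_center), HT0. vec.
  - intros x Hx. unfold ball in Hx. replace (vsub x vzero) with x in Hx by vec.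
    destruct (HTs (vscale (1 + eps) x)) as [X HX].
    assert (HXn : fst (h X X) <= (1 - eps) ^ 2).
    { rewrite <- HTn, HX. apply pow_incr. split; [apply vnorm_nonneg|].
      rewrite vnorm_vscale, Rabs_pos_eq by lra. left.
      assert ((1 - eps) / (1 + eps) * (1 + eps) = 1 - eps) by (field; lra). nra. }
    (* The factor [sqrt m] in [beta] compensates the normalisation of [nu] in [ball_map], and ([y],
       [beta]) has the same squared norm as [X]. *)
    set (y := tangential X). set (beta := Cmult (ncoord X) (RtoC (sqrt m))).
    assert (Hy : h y nu = RtoC 0) by apply (tangential_orthogonal).
    assert (Hyb : fst (h y y) + Cmod beta ^ 2 <= (1 - eps) ^ 2).
    { rewrite (herm_split X) in HXn. fold y m in HXn.
      unfold beta. rewrite Cmod_mult, Cmod_R, Rabs_pos_eq, Rpow_mult_distr by lra.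
      rewrite (proj2 Hsqm). exact HXn. }
    assert (Hb1' : Cmod beta < 1).
    { apply Rsqr_incrst_0; [|apply Cmod_ge_0|lra]. rewrite !Rsqr_pow2.
      assert (0 <= fst (h y y)).
      { eapply Rle_trans; [|apply (lm_h_low LM)].
        apply Rmult_le_pos; [left; apply (lm_c LM)|apply pow2_ge_0]. }
      nra. }
    destruct (HL y beta Hy Hyb) as [a [Ha Ea]].
    exists (vadd p' (vadd (cscale (Cdiv (RtoC (sqrt (fst b))) (Cminus (RtoC 1) beta)) y) (cscale a nu))).
    split; [exact Ha|]. unfold f, F, W. rewrite vsub_vadd, Ea.
    rewrite (ball_map_solution b beta y a Hb0 Hb1' Hy). fold m.
    replace (Cdiv beta (RtoC (sqrt m))) with (ncoord X).
    + unfold y. rewrite tangential_split, HX.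
      fext j. unfold vscale.
      apply injective_projections; simpl; field; lra.
    + unfold beta. field. intros E. apply (f_equal fst) in E. simpl in E. lra.
Qed.

End Model.

(** A radius above 1 would put a unit vector into the image, whose points have norm below 1; the
    nonzero [v] supplies that vector. The set of radii being nonempty and bounded, [squeezing] is
    its supremum and not the default value. *)
Lemma squeezing_between {n : nat} (Om : Cn n -> Prop) (q v : Cn n) (r : R) :
  v <> vzero -> squeeze_radii Om q r -> r <= squeezing Om q <= 1.
Proof.
  intros Hv Hr.
  assert (Hub : is_upper_bound (squeeze_radii Om q) 1).
  { intros s [Hs [f [[_ [_ [Hf _]]] Hsurj]]]. apply Rnot_lt_le. intros Hlt.
    pose proof (vnorm_pos v Hv) as Hvp.
    assert (H1 : vnorm (vscale (/ vnorm v) v) = 1).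
    { rewrite vnorm_vscale, Rabs_pos_eq by (left; now apply Rinv_0_lt_compat). field. lra. }
    destruct (Hsurj (vscale (/ vnorm v) v)) as [z [Hz Ez]].
    - unfold ball. replace (vsub (vscale (/ vnorm v) v) vzero) with (vscale (/ vnorm v) v) by vec. lra.
    - pose proof (Hf z Hz) as H. rewrite Ez in H. lra. }
  unfold squeezing. destruct (excluded_middle_informative _) as [E|E].
  - destruct (constructive_indefinite_description _ E) as [s [Hs1 Hs2]]; simpl.
    split; [now apply Hs1|now apply Hs2].
  - elim E. destruct (completeness (squeeze_radii Om q)) as [s Hs]; [now exists 1|now exists r|].
    now exists s.
Qed.

Theorem theorem2 (n : nat) (Om : Cn n -> Prop) :
  bounded_domain Om -> C2_strongly_convex_boundary Om ->
  forall p : Cn n, boundary Om p ->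
  forall eps, 0 < eps -> exists delta, 0 < delta /\
    forall q, Om q -> vnorm (vsub q p) < delta ->
      Rabs (squeezing Om q - 1) < eps.
Proof.
  intros [Hopen [Hconn [_ Hbd]]] [U [rho [D [D2 [HU [Hcl [HC2 [Hdef [Hgrad Hsc]]]]]]]]] p Hp eps He.
  destruct (local_model_exists Om U rho D D2 HU Hcl HC2 Hdef Hgrad Hsc Hopen Hconn p Hp Hbd)
    as [l [h [A [nu [K [c [r0 LM]]]]]]].
  (* Chosen for [(1 - e) / (1 + e) >= 1 - 2 e] and [2 e < eps]. *)
  set (e := Rmin (/ 2) (eps / 4)).
  assert (He0 : 0 < e) by (apply Rmin_glb_lt; lra).
  assert (He1 : e <= / 2) by apply Rmin_l. assert (He2 : e <= eps / 4) by apply Rmin_r.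
  destruct (squeeze_near _ _ _ _ _ _ _ _ _ LM e He0 ltac:(lra)) as [d [Hd H]].
  exists d. split; [exact Hd|]. intros q Hq Hqp.
  pose proof (squeezing_between Om q nu _ (lm_nu0 LM) (H q Hqp Hq)) as Hs.
  assert (Hr : 1 - 2 * e <= (1 - e) / (1 + e)).
  { apply Rmult_le_reg_r with (1 + e); [lra|].
    replace ((1 - e) / (1 + e) * (1 + e)) with (1 - e) by (field; lra). nra. }
  apply Rabs_def1; lra.
Qed.
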